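(* Let $(M,0)$ be a germ of a CR singular real-analytic surface at $0$ in $\mathbb{C}^2$. Assume that $M$ is defined near $0$ by $w=\rho(z,\bar z)$, where $\rho$ is real-analytic and vanishes to order at least $2$ at $0$. Then the following are equivalent: (i) There are a germ of a totally real, real-analytic surface $(N,0)$ in $\mathbb{C}^2$ and a finite holomorphic map $F \colon (\mathbb{C}^2,0) \to (\mathbb{C}^2,0)$ such that $F|_N$ is a diffeomorphism onto $M = F(N)$ (as germs at $0$). (ii) $\rho(0,\bar z) \not\equiv 0$. In addition, if $M$ is a Bishop surface, then (i) and (ii) are equivalent to the following: $M$ is not (locally) biholomorphically equivalent to $M_0:=\{w = |z|^2\}$. In this case, for $F$ as in (i): if the Bishop invariant $\gamma$ of $M$ satisfies $\gamma \neq 0$, then $\mathrm{mult}_0(F) = 2$; otherwise (that is, $\gamma=0$), $\mathrm{mult}_0(F)$ is the Moser invariant $s$ of $M$.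
   Context: A surface is a $2$-dimensional real submanifold. For $q\in M\subset\mathbb{C}^2$, $T^{0,1}_qM$ is the space of antiholomorphic vectors in $\mathbb{C}\otimes T_q\mathbb{C}^2$ tangent to $M$; a CR singular point is a point of discontinuity of $q\mapsto\dim_{\mathbb{C}}T^{0,1}_qM$. A surface $N$ is totally real if $T_pN\cap J(T_pN)=\{0\}$ for all $p\in N$, $J$ being the complex structure. In $\rho(z,\bar z)$ the variables $z,\bar z$ are treated as independent variables of the convergent power series; $\rho(0,\bar z)$ is obtained by setting $z=0$ and keeping $\bar z$. A holomorphic germ $F=(F_1,F_2)\colon(\mathbb{C}^2,0)\to(\mathbb{C}^2,0)$ is finite if $\mathrm{mult}_0(F):=\dim_{\mathbb{C}}\mathcal{O}_0/(F_1,F_2)<\infty$, $\mathcal{O}_0$ being the ring of germs of holomorphic functions at $0$. Bishop surface: $\rho$ vanishes exactly to order $2$ at $0$, with quadratic part not holomorphic, so that after a local biholomorphic change of coordinates $M$ is given by $w=|z|^2+\gamma(z^2+\bar z^2)+O(|z|^3)$ with $0\le\gamma\le\infty$, where for $\gamma=\infty$ the equation is understood as $w=z^2+\bar z^2+O(|z|^3)$. The number $\gamma$ is the Bishop invariant. Moser invariant (for Bishop surfaces with $\gamma=0$): the invariant $s\in\{3,4,\dots\}\cup\{\infty\}$ such that after a formal change of coordinates $M$ is brought to the form $w=|z|^2+z^s+\bar z^s+\sum_{i+j\ge s+1}a_{ij}z^i\bar z^j$; $s=\infty$ means that $M$ is formally equivalent to $M_0$. *)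

(* Defs.v *)
(* MathComp-Analysis *)
From mathcomp Require Import all_boot all_order all_algebra complex.
From mathcomp Require Import all_classical all_reals all_analysis.

Set Implicit Arguments.
Unset Strict Implicit.
Unset Printing Implicit Defensive.

Import Order.TTheory GRing.Theory Num.Theory.
Import numFieldNormedType.Exports.

Local Open Scope classical_set_scope.
Local Open Scope ring_scope.

(* R[i] is packed as a numClosedFieldType so that it receives the topology and
   the normed module structure that MathComp-Analysis puts on numeric fields. *)
Definition cplx (R : realType) : numClosedFieldType := R[i].

Notation C2 R := (cplx R * cplx R)%type.

Definition ofreal (R : realType) (t : R) : cplx R := (t%:C)%C.

(* [quotient_dim S W n]: the dimension of S / W is n, for linear subspaces
   W `<=` S of V; the classes of the b k form a basis. *)
Definition quotient_dim (K : fieldType) (V : lmodType K) (S W : set V)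
    (n : nat) : Prop :=
  exists b : 'I_n -> V, (forall k, S (b k)) /\
    forall x, S x ->
      exists! c : {ffun 'I_n -> K}, W (x - \sum_(k < n) c k *: b k).

(** * Power series in two variables *)

(* a i j is the coefficient of x^i y^j.  The second variable is either the
   second coordinate of C^2, or the conjugate of the first variable. *)
Definition pser (R : realType) := nat -> nat -> cplx R.

Section PowerSeries.
Variable R : realType.
Implicit Types (a b u v : pser R) (F G : pser R * pser R).

Definition convergent a : Prop :=
  exists r K : cplx R, 0 < r /\ forall i j, `|a i j| * r ^+ (i + j) <= K.

Definition pseval a (x y : cplx R) : cplx R :=
  limn (fun n => \sum_(i < n) \sum_(j < n) a i j * x ^+ i * y ^+ j).

Definition monom (p q : nat) : pser R :=
  fun i j => ((i == p) && (j == q))%:R.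

Definition psmul a b : pser R := fun n m =>
  \sum_(i < n.+1) \sum_(j < m.+1) a i j * b (n - i)%N (m - j)%N.

Definition psexp a (n : nat) : pser R := iter n (psmul a) (monom 0 0).

(* a(u, v), meaningful when u and v have no constant term: then u^i v^j has
   order at least i + j, and only finitely many terms contribute. *)
Definition pscomp a u v : pser R := fun n m =>
  \sum_(i < (n + m).+1) \sum_(j < (n + m).+1)
    a i j * psmul (psexp u i) (psexp v j) n m.

(* The series in (z, zbar) of the complex conjugate of a(z, zbar). *)
Definition psconj a : pser R := fun i j => (a j i)^*.

(* O_0 is identified with the ring of convergent power series. *)
Definition O0 : set (pser R) := [set a | convergent a].

Definition ideal0 F : set (pser R) :=
  [set a | exists h1 h2,
     [/\ O0 h1, O0 h2 & a = psmul h1 F.1 + psmul h2 F.2]].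

(* mult_0(F) = s, with None for infinity. *)
Definition mult0 F (s : option nat) : Prop :=
  match s with
  | Some n => quotient_dim O0 (ideal0 F) n
  | None => forall n, ~ quotient_dim O0 (ideal0 F) n
  end.

Definition finite_germ F : Prop := exists n, mult0 F (Some n).

Definition fixes0 F : Prop := F.1 0%N 0%N = 0 /\ F.2 0%N 0%N = 0.

Definition holo_germ F : Prop :=
  [/\ convergent F.1, convergent F.2 & fixes0 F].

Definition mapeval F (p : C2 R) : C2 R :=
  (pseval F.1 p.1 p.2, pseval F.2 p.1 p.2).

Definition biholo_germ F : Prop :=
  holo_germ F /\ exists G, holo_germ G /\
    \forall p \near (0 : C2 R),
      mapeval G (mapeval F p) = p /\ mapeval F (mapeval G p) = p.

Definition formal_change F : Prop :=
  fixes0 F /\ exists G, [/\ fixes0 G,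
    pscomp G.1 F.1 F.2 = monom 1 0 /\ pscomp G.2 F.1 F.2 = monom 0 1 &
    pscomp F.1 G.1 G.2 = monom 1 0 /\ pscomp F.2 G.1 G.2 = monom 0 1].

End PowerSeries.

(** * Germs at 0 of surfaces in C^2, represented by sets *)

Section Surfaces.
Variable R : realType.
Implicit Types (M N : set (C2 R)) (F : pser R * pser R) (rho : pser R).

(* Real differentiability at t = 0, through real and imaginary parts. *)
Definition path_deriv (g : R -> cplx R) (v : cplx R) : Prop :=
  is_derive (0 : R) (1 : R) (fun t => complex.Re (g t)) (complex.Re v) /\
  is_derive (0 : R) (1 : R) (fun t => complex.Im (g t)) (complex.Im v).

Definition tangent M (q : C2 R) : set (C2 R) :=
  [set v | exists g : R -> C2 R,
    [/\ g 0 = q, \forall t \near (0 : R), M (g t),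
        path_deriv (fun t => (g t).1) v.1 &
        path_deriv (fun t => (g t).2) v.2]].

(* c stands for the antiholomorphic vector c.1 d/dzbar + c.2 d/dwbar.  Its real
   and imaginary parts are the real vectors cbar / 2 and i cbar / 2; it belongs
   to the complexification of T_q M iff both parts belong to T_q M. *)
Definition T01 M (q : C2 R) : set (C2 R) :=
  [set c | tangent M q (2^-1 *: (c.1^*, c.2^*)) /\
           tangent M q (('i / 2) *: (c.1^*, c.2^*))].

Definition T01_dim M (q : C2 R) (n : nat) : Prop :=
  quotient_dim (T01 M q) [set 0] n.

(* The integer-valued function dim T01 is discontinuous at 0 along M. *)
Definition CR_singular0 M : Prop :=
  ~ exists n, \forall q \near (0 : C2 R), M q -> T01_dim M q n.

Definition totally_real_germ N : Prop :=
  \forall p \near (0 : C2 R), N p ->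
    tangent N p `&` [set 'i *: v | v in tangent N p] = [set 0].

(* The parameter t in C = R^2 enters through convergent series in t and tbar.
   The last part says that phi is a homeomorphism from V onto N `&` U. *)
Definition real_analytic_surface N : Prop :=
  exists phi : pser R * pser R,
    let par (t : cplx R) := mapeval phi (t, t^*) in
    [/\ holo_germ phi,
        forall v : cplx R,
          phi.1 1%N 0%N * v + phi.1 0%N 1%N * v^* = 0 ->
          phi.2 1%N 0%N * v + phi.2 0%N 1%N * v^* = 0 -> v = 0 &
        exists (V : set (cplx R)) (U : set (C2 R)) (psi : C2 R -> cplx R),
          [/\ open_nbhs (0 : cplx R) V, open_nbhs (0 : C2 R) U,
              par @` V = N `&` U,
              forall t, V t -> psi (par t) = t &
              {within N `&` U, continuous psi}]].

(* g is of class C^k on the open set V, in the sense of real calculus. *)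
Fixpoint Ck_on (V : set (C2 R)) (k : nat) (g : C2 R -> cplx R) : Prop :=
  (forall p, V p -> {for p, continuous g}) /\
  match k with
  | 0 => True
  | k'.+1 => forall v : C2 R, exists dg : C2 R -> cplx R,
      (forall p, V p -> path_deriv (fun t => g (p + ofreal t *: v)) (dg p)) /\
      Ck_on V k' dg
  end.

Definition smooth_on (V : set (C2 R)) (G : C2 R -> C2 R) : Prop :=
  forall k, Ck_on V k (fun p => (G p).1) /\ Ck_on V k (fun p => (G p).2).

(* F|_N is a diffeomorphism onto M: F is a bijection from N `&` U onto M `&` V
   whose inverse is the restriction of the smooth map G. *)
Definition diffeo_onto F N M : Prop :=
  exists (U V : set (C2 R)) (G : C2 R -> C2 R),
    [/\ open_nbhs (0 : C2 R) U, open_nbhs (0 : C2 R) V,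
        mapeval F @` (N `&` U) = M `&` V,
        forall p, N p -> U p -> G (mapeval F p) = p & smooth_on V G].

Definition finite_parametrization N F M : Prop :=
  [/\ real_analytic_surface N, totally_real_germ N,
      holo_germ F, finite_germ F & diffeo_onto F N M].

Definition graph rho : set (C2 R) := [set p | p.2 = pseval rho p.1 p.1^*].

Definition germ_eq M N : Prop := \forall p \near (0 : C2 R), M p <-> N p.

Definition biholo_equiv M N : Prop :=
  exists F, biholo_germ F /\
    \forall p \near (0 : C2 R), M p <-> N (mapeval F p).

Definition M0 : set (C2 R) := [set p | p.2 = `|p.1| ^+ 2].

Definition vanishes2 rho : Prop :=
  forall i j, (i + j < 2)%N -> rho i j = 0.

(* rho has order exactly 2: the second condition says that the quadratic part
   contains z zbar or zbar^2, i.e. is not holomorphic (hence not zero). *)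
Definition bishop_surface rho : Prop :=
  vanishes2 rho /\ (rho 1%N 1%N != 0 \/ rho 0%N 2%N != 0).

(* |z|^2 + gamma (z^2 + zbar^2), or z^2 + zbar^2 for gamma = +oo;
   the value at -oo is irrelevant. *)
Definition bishop_quadric (gamma : \bar R) : pser R :=
  match gamma with
  | r%:E => monom R 1 1 + ofreal r *: (monom R 2 0 + monom R 0 2)
  | _ => monom R 2 0 + monom R 0 2
  end.

Definition bishop_invariant M (gamma : \bar R) : Prop :=
  (0 <= gamma)%E /\ exists rho',
    [/\ convergent rho',
        forall i j, (i + j < 3)%N -> rho' i j = bishop_quadric gamma i j &
        biholo_equiv M (graph rho')].

(* A formal change F maps the formal surface w = rho(z, zbar) to
   w = rho'(z, zbar). *)
Definition formal_equiv rho rho' : Prop :=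
  exists F, formal_change F /\
    let f := pscomp F.1 (monom R 1 0) rho in
    pscomp F.2 (monom R 1 0) rho = pscomp rho' f (psconj f).

(* None stands for s = infinity. *)
Definition moser_invariant rho (s : option nat) : Prop :=
  match s with
  | Some n => (3 <= n)%N /\ exists rho',
      (forall i j, (i + j <= n)%N ->
         rho' i j = (monom R 1 1 + monom R n 0 + monom R 0 n) i j) /\
      formal_equiv rho rho'
  | None => formal_equiv rho (monom R 1 1)
  end.

End Surfaces.

Arguments M0 : clear implicits.

(* Main.v *)
Require Import Defs.
From mathcomp Require Import all_boot all_order all_algebra complex.
From mathcomp Require Import all_classical all_reals all_analysis.
From mathcomp Require Import ring lra zify.

(** The proof complexifies: zbar is replaced by an independent variable w, and a
   real-analytic identity in (z, zbar) becomes an identity between convergent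
   power series (lemma pser_eq_conj).

   Let F and N be as in (i), with N parametrized by phi(z, zbar). Since N is totally
   real, the complexification of phi is a local biholomorphism (totally_real_jac).
   Since F|_N is a diffeomorphism onto the graph M, the function f = F1 o phi is
   a local diffeomorphism of C (diffeo_kernel), which means that (f, fbar) is a local
   biholomorphism as well. The equation of M says that F2 o phi = rho(f, fbar). Hence
   F o T = (x, rho(x, y)) with T = phi o (f, fbar)^-1
   (finite_parametrization_normal_form), and the multiplicity of F is that of
   (x, rho(x, y)), namely the order of rho(0, y), infinite if rho(0, y) = 0
   (mult0_graph, not_finite_graph). This gives (i) => (ii); conversely
   (x, rho(x, y)) itself, restricted to w = zbar, has the properties of (i)
   (antidiag_parametrization).

   The order of rho(0, zbar) is invariant under biholomorphic, and even formal,
   changes of coordinates (order_transfer). It is infinite for M0, it is 2 when the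
   Bishop invariant is not 0, and it is s for the normal form with Moser invariant s.
   This gives the multiplicities, and shows that (ii) excludes equivalence with M0.

   It remains to see that a Bishop surface with rho(0, zbar) = 0 is equivalent to M0
   by a convergent change of coordinates (biholo_equiv_M0). One looks for
   Phi(z, u) = (z a(z, u), B(z, u)) that maps M0 into M. With A(z, w) = a(z, zw) and
   A*(z, w) its conjugate with exchanged variables, such a B exists as soon as
   rho(zA, wA* ) contains only monomials z^i w^j with i >= j, since these are series in
   z and zw. Such monomials are all that the part of rho in z alone contributes; the
   rest is a multiple of zw(1 + k(z, w)) with k(0) = 0, so the condition concerns
   A A* (1 + k(zA, wA* )). Writing A = 1 + X with X made of monomials i > j, it becomes
   a fixed point equation for X whose right-hand side is quadratic in X or involves k
   (flattening).

   This equation, the inverse function theorem and division by units are all solved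
   by one principle (causal_fix): a map on power series that gains one degree of
   precision has a fixed point, and if the map preserves a bound on l^1 norms on a
   polydisc then the fixed point satisfies it, hence converges. *)

Set Implicit Arguments.
Unset Strict Implicit.
Unset Printing Implicit Defensive.

Import Order.TTheory GRing.Theory Num.Theory.
Import numFieldNormedType.Exports.

Local Open Scope classical_set_scope.
Local Open Scope ring_scope.

(** * The modulus of complex numbers *)

Section Modulus.
Variable R : realType.
Implicit Types x y z : cplx R.

(** The modulus as an element of R: unlike cplx R, R is totally ordered, so
   estimates can be left to linear arithmetic. *)
Definition nm z : R := complex.Re `|z|.

Lemma nmE z : `|z| = ofreal (nm z).
Proof. by rewrite /nm normc_def. Qed.

Lemma ofreal_le (s t : R) : (ofreal s <= ofreal t) = (s <= t).
Proof. exact: lecR. Qed.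

Lemma ofreal_lt (s t : R) : (ofreal s < ofreal t) = (s < t).
Proof. exact: ltcR. Qed.

Lemma ofrealD (s t : R) : ofreal (s + t) = ofreal s + ofreal t.
Proof. exact: (rmorphD (real_complex R)). Qed.

Lemma ofrealM (s t : R) : ofreal (s * t) = ofreal s * ofreal t.
Proof. exact: (rmorphM (real_complex R)). Qed.

Lemma ofrealX (t : R) n : ofreal (t ^+ n) = ofreal t ^+ n.
Proof. exact: (rmorphXn (real_complex R)). Qed.

Lemma ofreal_inj (s t : R) : ofreal s = ofreal t -> s = t.
Proof. by case. Qed.

Lemma nm_ge0 z : 0 <= nm z.
Proof. by rewrite -ofreal_le -nmE; exact: normr_ge0. Qed.

Lemma nm0 : nm 0 = 0.
Proof. by apply: ofreal_inj; rewrite -nmE normr0. Qed.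

Lemma nm1 : nm 1 = 1.
Proof. by apply: ofreal_inj; rewrite -nmE normr1. Qed.

Lemma nm_eq0 z : nm z = 0 -> z = 0.
Proof. by move=> h; apply/eqP; rewrite -normr_eq0 nmE h. Qed.

Lemma nm_gt0 z : z != 0 -> 0 < nm z.
Proof.
by move=> z0; rewrite lt_neqAle nm_ge0 andbT eq_sym; apply: contra_neq z0 => /nm_eq0.
Qed.

Lemma nmM y z : nm (y * z) = nm y * nm z.
Proof. by apply: ofreal_inj; rewrite -nmE normrM !nmE ofrealM. Qed.

Lemma nmN z : nm (- z) = nm z.
Proof. by apply: ofreal_inj; rewrite -!nmE normrN. Qed.

Lemma nmC y z : nm (y - z) = nm (z - y).
Proof. by rewrite -nmN opprB. Qed.

Lemma nmX z n : nm (z ^+ n) = nm z ^+ n.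
Proof. by elim: n => [|n IH]; rewrite ?expr0 ?nm1// !exprS nmM IH. Qed.

Lemma nmD y z : nm (y + z) <= nm y + nm z.
Proof. by rewrite -ofreal_le ofrealD -!nmE ler_normD. Qed.

Lemma nmB y z : nm (y - z) <= nm y + nm z.
Proof. by rewrite (le_trans (nmD _ _))// nmN. Qed.

Lemma nm_dist x y z : nm (x - z) <= nm (x - y) + nm (y - z).
Proof. by rewrite (_ : x - z = (x - y) + (y - z)) ?nmD//; ring. Qed.

Lemma nm_sum I (r : seq I) (P : pred I) (F : I -> cplx R) :
  nm (\sum_(i <- r | P i) F i) <= \sum_(i <- r | P i) nm (F i).
Proof.
elim/big_ind2: _ => // [|x1 x2 y1 y2 h1 h2]; first by rewrite nm0.
by rewrite (le_trans (nmD _ _))// lerD.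
Qed.

Lemma nm_conj z : nm (z^*) = nm z.
Proof. by apply: ofreal_inj; rewrite -!nmE norm_conjC. Qed.

Lemma nm_ofreal (t : R) : nm (ofreal t) = `|t|.
Proof. by apply: ofreal_inj; rewrite -nmE normc_def /= expr0n /= addr0 sqrtr_sqr. Qed.

Lemma nm_inv z : nm (z^-1) = (nm z)^-1.
Proof.
have [->|z0] := eqVneq z 0; first by rewrite invr0 nm0 invr0.
have h := nm_gt0 z0; apply: (mulfI (lt0r_neq0 h)).
by rewrite -nmM !mulfV ?nm1// lt0r_neq0.
Qed.

Lemma Re_le_nm z : `|complex.Re z| <= nm z.
Proof. by rewrite -ofreal_le -nmE; exact: normc_ge_Re. Qed.

Lemma cplx_i : ('i : cplx R) = 'i%C.
Proof. by rewrite -(complexiE R). Qed.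

Lemma nmi : nm 'i = 1.
Proof.
apply/eqP; rewrite -(@eqrXn2 _ 2) ?nm_ge0//; apply/eqP.
by rewrite -nmX sqrCi nmN nm1 expr1n.
Qed.

Lemma Im_le_nm z : `|complex.Im z| <= nm z.
Proof.
have := Re_le_nm ('i * z); rewrite nmM nmi mul1r; congr (_ <= _).
by rewrite cplx_i; case: z => a b /=; rewrite mul0r mul1r sub0r normrN.
Qed.

Lemma complexE z : z = ofreal (complex.Re z) + 'i * ofreal (complex.Im z).
Proof.
by rewrite cplx_i; exact: complex.complexE.
Qed.

Lemma nm_le_ReIm z : nm z <= `|complex.Re z| + `|complex.Im z|.
Proof.
by rewrite {1}(complexE z) (le_trans (nmD _ _))// nmM nmi mul1r !nm_ofreal.
Qed.

Lemma ReD y z : complex.Re (y + z) = complex.Re y + complex.Re z.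
Proof. by case: y z => ? ? []. Qed.
Lemma ReN z : complex.Re (- z) = - complex.Re z.
Proof. by case: z. Qed.
Lemma ImD y z : complex.Im (y + z) = complex.Im y + complex.Im z.
Proof. by case: y z => ? ? []. Qed.
Lemma ImN z : complex.Im (- z) = - complex.Im z.
Proof. by case: z. Qed.

Lemma ReZ (t : R) z : complex.Re (ofreal t * z) = t * complex.Re z.
Proof. by case: z => ? ? /=; rewrite mul0r subr0. Qed.
Lemma ImZ (t : R) z : complex.Im (ofreal t * z) = t * complex.Im z.
Proof. by case: z => ? ? /=; rewrite mul0r addr0. Qed.

(** * Neighbourhoods *)

Lemma pos_ofreal (e : cplx R) : 0 < e -> e = ofreal (complex.Re e) /\ 0 < complex.Re e.
Proof.
move=> e0; have h : e = ofreal (complex.Re e).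
  move: e0; rewrite (ltcE (0 : R[i]) e) => /andP[/eqP/= e0 _].
  by rewrite [LHS]complexE -[complex.Im e]/(complex.Im (e : R[i])) e0 (_ : ofreal 0 = 0)// mulr0 addr0.
by split => //; rewrite -ofreal_lt -h.
Qed.

Lemma ballE z (e : R) y : ball z (ofreal e) y <-> nm (z - y) < e.
Proof. by rewrite -ball_normE /ball_ /= nmE ofreal_lt. Qed.

Lemma nbhs_nm z (P : set (cplx R)) :
  nbhs z P <-> exists2 e : R, 0 < e & forall y, nm (z - y) < e -> P y.
Proof.
split.
  case/nbhs_ballP => e /= /pos_ofreal[-> e0] h; exists (complex.Re e) => // y hy.
  exact/h/ballE.
case=> e e0 h; apply/nbhs_ballP; exists (ofreal e) => /=; first by rewrite ofreal_lt.
by move=> y /ballE /h.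
Qed.

Lemma nbhs_C2 (p : C2 R) (P : set (C2 R)) :
  nbhs p P <-> exists2 e : R, 0 < e &
     forall q, nm (p.1 - q.1) < e -> nm (p.2 - q.2) < e -> P q.
Proof.
split.
  case=> [[A B]] /= [/nbhs_nm[e e0 hA] /nbhs_nm[d d0 hB]] h.
  exists (Num.min e d) => [|q]; first by rewrite lt_min e0.
  rewrite !lt_min => /andP[q1 _] /andP[_ q2]; apply: h; split => /=.
    exact: hA.
  exact: hB.
case=> e e0 h.
exists ([set y | nm (p.1 - y) < e], [set y | nm (p.2 - y) < e]) => /=.
  by split; apply/nbhs_nm; exists e.
by move=> q [/= q1 q2]; exact: h.
Qed.

Lemma near0_C2 (P : C2 R -> Prop) :
  (\forall p \near (0 : C2 R), P p) <-> exists2 e : R, 0 < e &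
     forall x y, nm x < e -> nm y < e -> P (x, y).
Proof.
split.
  case/nbhs_C2 => e e0 h; exists e => // x y hx hy.
  by apply: h => /=; rewrite sub0r nmN.
case=> e e0 h; apply/nbhs_C2; exists e => // -[x y] /=.
by rewrite !sub0r !nmN; exact: h.
Qed.

Lemma cvg_nm (u : nat -> cplx R) l :
  (forall e : R, 0 < e -> exists N, forall n, (N <= n)%N -> nm (l - u n) < e) ->
  u @ \oo --> l.
Proof.
move=> h; apply/cvgrPdist_lt => e /pos_ofreal[-> e0].
case: (h _ e0) => N hN; exists N => // n /= /hN.
by rewrite nmE ofreal_lt.
Qed.

Lemma exp_half_small (K e : R) : 0 < e -> exists N, forall n, (N <= n)%N -> K / 2 ^+ n < e.
Proof.
move=> e0; set L := `|K| + 1.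
have L0 : 0 < L by rewrite ltr_wpDl.
have KL : K < L by rewrite (le_lt_trans (ler_norm K))// ltrDl.
exists (Num.Def.truncn (L / e)).+1 => n hn.
have h1 : L / e < n%:R.
  by rewrite (lt_le_trans (truncnS_gt _))// ler_nat.
have h2 : (n%:R : R) <= 2 ^+ n by rewrite -natrX ler_nat ltnW// ltn_expl.
rewrite ltr_pdivrMr ?exprn_gt0// (lt_le_trans KL)//.
rewrite -ler_pdivrMl// mulrC; exact/ltW/(lt_le_trans h1 h2).
Qed.

(** The approximations [c n] are known to be geometrically close to all later
   terms; completeness of the reals, applied to both parts, yields a limit. *)
Lemma geom_cvg (u c : nat -> cplx R) (K : R) :
  (forall n m, (n <= m)%N -> nm (u m - c n) <= K / 2 ^+ n) ->
  exists l, u @ \oo --> l /\ forall n, nm (l - c n) <= K / 2 ^+ n.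
Proof.
move=> h.
have h2 n m k : (n <= m)%N -> (n <= k)%N -> nm (u m - u k) <= (K *+ 2) / 2 ^+ n.
  move=> nm_ nk; rewrite (le_trans (nm_dist _ (c n) _))// mulr2n mulrDl.
  by rewrite lerD ?h// nmC h.
have cau (f : cplx R -> R) : (forall y z, `|f y - f z| <= nm (y - z)) ->
    exists l : R, forall e, 0 < e -> exists N, forall n, (N <= n)%N -> `|l - f (u n)| < e.
  move=> hf.
  have hc : cvg ((fun n => f (u n)) @ \oo).
    apply: cauchy_cvg; apply: cauchy_exP => e e0.
    have [N hN] := exp_half_small (K *+ 2) e0.
    exists (f (u N)); exists N => // n /= hn.
    by rewrite /ball /= (le_lt_trans (hf _ _))// (le_lt_trans (h2 N _ _ _ _) (hN N _)).
  exists (limn (fun n => f (u n))) => e e0.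
  move/cvgrPdist_lt: hc => hl.
  by case: (hl _ e0) => N _ hN; exists N => n /hN.
have [|a ha] := cau (@complex.Re R).
  by move=> y z; rewrite -ReN -ReD Re_le_nm.
have [|b hb] := cau (@complex.Im R).
  by move=> y z; rewrite -ImN -ImD Im_le_nm.
have hl (e : R) : 0 < e -> exists N, forall n, (N <= n)%N -> nm ((a +i* b)%C - u n) < e.
  move=> e0; have e2 : 0 < e / 2 by rewrite divr_gt0.
  have [N hN] := ha _ e2; have [N' hN'] := hb _ e2.
  exists (maxn N N') => n; rewrite geq_max => /andP[n1 n2].
  rewrite (le_lt_trans (nm_le_ReIm _))// ReD ImD ReN ImN /= (splitr e).
  by rewrite ltrD ?hN ?hN'.
exists (a +i* b)%C; split; first exact: cvg_nm.
move=> n; apply/ler_addgt0Pr => e e0; have [N hN] := hl _ e0.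
rewrite (le_trans (nm_dist _ (u (maxn n N)) _))// addrC lerD//.
  by rewrite h ?leq_maxl.
by rewrite ltW// hN ?leq_maxr.
Qed.

End Modulus.

(** * Triangular sums *)

Section TriangularSums.

(** Summing over triangles instead of squares grades a double series by its
   total degree. *)
Definition tri (V : nmodType) (n : nat) (f : nat -> nat -> V) : V :=
  \sum_(i < n) \sum_(j < n - i) f i j.

Lemma tri_box (V : nmodType) n m (f : nat -> nat -> V) : (n <= m)%N ->
  tri n f = \sum_(i < m) \sum_(j < m | (i + j < n)%N) f i j.
Proof.
move=> nm; rewrite /tri (big_ord_widen m (fun i => \sum_(j < n - i) f i j))//.
rewrite big_mkcond; apply: eq_bigr => i _; case: ifPn => hi.
  rewrite (big_ord_widen m (f i)) ?(leq_trans (leq_subr _ _))//.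
  by apply: eq_bigl => j; rewrite ltn_subRL.
by rewrite big1// => j hj; exfalso; move: hi hj; lia.
Qed.

Lemma tri_swap (V : nmodType) n (f : nat -> nat -> V) :
  tri n f = tri n (fun i j => f j i).
Proof.
rewrite !(tri_box _ (leqnn n)) (exchange_big_dep xpredT)//=; apply: eq_bigr => i _.
by apply: eq_bigl => j; rewrite addnC.
Qed.

Lemma tri_recr (V : nmodType) n (f : nat -> nat -> V) :
  tri n.+1 f = tri n f + \sum_(k < n.+1) f k (n - k)%N.
Proof.
rewrite /tri [X in X + _](_ : _ = \sum_(i < n.+1) \sum_(j < n - i) f i j).
  rewrite -big_split; apply: eq_bigr => -[i hi] _ /=.
  by rewrite subSn ?big_ord_recr//.
by rewrite big_ord_recr /= subnn big_ord0 addr0.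
Qed.

(** The same pairs of indices, enumerated by diagonals and by rows. *)
Lemma tri_cauchy (V : nmodType) n (f : nat -> nat -> V) :
  \sum_(i < n) \sum_(k < i.+1) f k (i - k)%N = tri n f.
Proof.
elim: n => [|n IH]; first by rewrite /tri !big_ord0.
by rewrite big_ord_recr IH tri_recr.
Qed.

Lemma box_single (V : nmodType) n m (f : nat -> nat -> V) p q : (p < n)%N -> (q < m)%N ->
  (forall i j, (i < n)%N -> (j < m)%N -> (i, j) != (p, q) -> f i j = 0) ->
  \sum_(i < n) \sum_(j < m) f i j = f p q.
Proof.
move=> hp hq h; rewrite (bigD1 (Ordinal hp))//= (bigD1 (Ordinal hq))//=.
rewrite [X in _ + X + _]big1 ?addr0; last first.
  by move=> j jq; rewrite h// xpair_eqE eqxx.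
rewrite [X in _ + X]big1 ?addr0// => i ip; rewrite big1// => j _.
by rewrite h// xpair_eqE negb_and; apply/orP; left.
Qed.

Variable R : realType.

Lemma ler_sum_widen n m (f : nat -> R) : (n <= m)%N -> (forall i, 0 <= f i) ->
  \sum_(i < n) f i <= \sum_(i < m) f i.
Proof.
move=> nm f0; rewrite (big_ord_widen m f)// big_mkcond.
by apply: ler_sum => i _; case: ifP.
Qed.

Lemma tri_le_box n m (f : nat -> nat -> R) : (n <= m)%N -> (forall i j, 0 <= f i j) ->
  tri n f <= \sum_(i < m) \sum_(j < m) f i j.
Proof.
move=> nm f0; rewrite (tri_box _ nm); apply: ler_sum => i _.
by rewrite big_mkcond; apply: ler_sum => j _; case: ifP.
Qed.

Lemma box_le_tri n m (f : nat -> nat -> R) : (n + n <= m)%N -> (forall i j, 0 <= f i j) ->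
  \sum_(i < n) \sum_(j < n) f i j <= tri m f.
Proof.
move=> nm f0; rewrite /tri.
apply: (@le_trans _ _ (\sum_(i < n) \sum_(j < m - i) f i j)).
  by apply: ler_sum => i _; apply: ler_sum_widen => //; have := ltn_ord i; lia.
by apply: (@ler_sum_widen n m (fun i => \sum_(j < m - i) f i j)); [lia|move=> i; apply: sumr_ge0].
Qed.

Lemma ler_tri n m (f g : nat -> nat -> R) : (n <= m)%N -> (forall i j, 0 <= g i j) ->
  (forall i j, (i + j < n)%N -> f i j <= g i j) -> tri n f <= tri m g.
Proof.
move=> nm g0 fg; apply: (@le_trans _ _ (tri n g)).
  apply: ler_sum => i _; apply: ler_sum => j _; apply: fg.
  by have := ltn_ord j; have := ltn_ord i; lia.
rewrite /tri; apply: (@le_trans _ _ (\sum_(i < n) \sum_(j < m - i) g i j)).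
  by apply: ler_sum => i _; apply: ler_sum_widen => //; lia.
by apply: (@ler_sum_widen n m (fun i => \sum_(j < m - i) g i j)) => // i; apply: sumr_ge0.
Qed.

End TriangularSums.

Lemma eq_tri (V : nmodType) n (f g : nat -> nat -> V) :
  (forall i j, (i + j < n)%N -> f i j = g i j) -> tri n f = tri n g.
Proof.
move=> fg; apply: eq_bigr => i _; apply: eq_bigr => j _; apply: fg.
by have := ltn_ord j; have := ltn_ord i; lia.
Qed.

(** * Norms and values of convergent series *)

Section TruncatedNorms.
Variable R : realType.
Implicit Types (a b u v : pser R) (s t K L : R).

Definition weight s a i j : R := nm (a i j) * s ^+ (i + j).

Definition trunc_norm s n a : R := tri n (weight s a).

(** The l^1 norm on the polydisc of radius s is at most K; bounding all the
   truncations avoids the supremum. *)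
Definition bnd s K a := forall n, trunc_norm s n a <= K.

Definition agree n a b := forall i j, (i + j < n)%N -> a i j = b i j.

Lemma weight_ge0 s a i j : 0 <= s -> 0 <= weight s a i j.
Proof. by move=> s0; rewrite mulr_ge0 ?nm_ge0// exprn_ge0. Qed.
Hint Resolve weight_ge0 : core.

Lemma trunc_norm_ge0 s n a : 0 <= s -> 0 <= trunc_norm s n a.
Proof. by move=> s0; apply: sumr_ge0 => i _; apply: sumr_ge0 => j _; apply: weight_ge0. Qed.

Lemma bnd_ge0 s K a : 0 <= s -> bnd s K a -> 0 <= K.
Proof. by move=> s0 h; rewrite (le_trans _ (h 0%N))// trunc_norm_ge0. Qed.

Lemma agree_trunc_norm s n a b : agree n a b -> trunc_norm s n a = trunc_norm s n b.
Proof. by move=> h; apply: eq_tri => i j /h; rewrite /weight => ->. Qed.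

Lemma bnd_box s K a n : 0 <= s -> bnd s K a -> \sum_(i < n) \sum_(j < n) weight s a i j <= K.
Proof.
by move=> s0 h; rewrite (le_trans _ (h (n + n)%N))// box_le_tri// => i j; apply: weight_ge0.
Qed.

Lemma bnd_coef s K a i j : 0 <= s -> bnd s K a -> weight s a i j <= K.
Proof.
move=> s0 h; rewrite (le_trans _ (bnd_box (i + j).+1 s0 h))//.
have hi : (i < (i + j).+1)%N by lia.
have hj : (j < (i + j).+1)%N by lia.
rewrite (bigD1 (Ordinal hi))//= (bigD1 (Ordinal hj))//= -addrA lerDl addr_ge0//.
  by apply: sumr_ge0 => k _; apply: weight_ge0.
by apply: sumr_ge0 => k _; apply: sumr_ge0 => l _; apply: weight_ge0.
Qed.

Lemma bndW s t K L a : 0 <= t -> t <= s -> K <= L -> bnd s K a -> bnd t L a.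
Proof.
move=> t0 ts KL h n; rewrite (le_trans _ KL)// (le_trans _ (h n))//.
apply: ler_tri => // i j; first exact/weight_ge0/(le_trans t0).
by move=> _; rewrite ler_wpM2l ?nm_ge0// lerXn2r// nnegrE// (le_trans t0).
Qed.

Lemma bndD s K L a b : 0 <= s -> bnd s K a -> bnd s L b -> bnd s (K + L) (a + b).
Proof.
move=> s0 ha hb n; rewrite (le_trans _ (lerD (ha n) (hb n)))//.
rewrite /trunc_norm /tri -big_split; apply: ler_sum => i _ /=.
rewrite -big_split; apply: ler_sum => j _ /=.
by rewrite /weight -mulrDl ler_wpM2r ?exprn_ge0// nmD.
Qed.

Lemma bndZ s K (c : cplx R) a : 0 <= s -> bnd s K a -> bnd s (nm c * K) (c *: a).
Proof.
move=> s0 ha n; rewrite (le_trans _ (ler_wpM2l (nm_ge0 c) (ha n)))//.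
rewrite /trunc_norm /tri mulr_sumr; apply: ler_sum => i _ /=.
rewrite mulr_sumr; apply: ler_sum => j _ /=.
by rewrite /weight nmM mulrA.
Qed.

Lemma bndN s K a : 0 <= s -> bnd s K a -> bnd s K (- a).
Proof. by move=> s0 /(bndZ (-1) s0); rewrite scaleN1r nmN nm1 mul1r. Qed.

Lemma bnd0 s K : 0 <= K -> bnd s K 0.
Proof.
move=> K0 n; rewrite /trunc_norm /tri big1// => i _; rewrite big1// => j _.
by rewrite /weight nm0 mul0r.
Qed.

Lemma monom_eq0 p q i j : (i, j) != (p, q) -> monom R p q i j = 0.
Proof. by rewrite xpair_eqE /monom => /negbTE ->. Qed.

Lemma bnd_monom s p q : 0 <= s -> bnd s (s ^+ (p + q)) (monom R p q).
Proof.
move=> s0 n; rewrite /trunc_norm.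
apply: (@le_trans _ _ (tri (n + (p + q).+1) (weight s (monom R p q)))).
  by apply: ler_tri; [lia|move=> i j; exact: weight_ge0|].
have hp : (p < n + (p + q).+1)%N by lia.
have hq : (q < n + (p + q).+1)%N by lia.
rewrite (le_trans (tri_le_box (leqnn _) _))// => [i j|]; first exact: weight_ge0.
rewrite (@box_single _ _ _ (weight s (monom R p q)) p q)//.
  by rewrite /weight /monom !eqxx nm1 mul1r.
by move=> i j _ _ /monom_eq0; rewrite /weight => ->; rewrite nm0 mul0r.
Qed.

Lemma trunc_norm_psconj s n a : trunc_norm s n (psconj a) = trunc_norm s n a.
Proof.
rewrite /trunc_norm tri_swap; apply: eq_tri => i j _.
by rewrite /weight /psconj nm_conj addnC.
Qed.

Lemma bnd_psconj s K a : bnd s K a -> bnd s K (psconj a).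
Proof. by move=> h n; rewrite trunc_norm_psconj. Qed.

(** Every product of two coefficients that contributes in degree less than n
   occurs on the right; the rearrangement is done in one variable at a time. *)
Lemma trunc_norm_psmul s n a b : 0 <= s -> trunc_norm s n (psmul a b) <= trunc_norm s n a * trunc_norm s n b.
Proof.
move=> s0.
pose f i k j l := weight s a k l * weight s b (i - k)%N (j - l)%N.
apply: (@le_trans _ _ (\sum_(i < n) \sum_(k < i.+1)
    \sum_(j < n - i) \sum_(l < j.+1) f i k j l)).
  apply: ler_sum => i _; rewrite exchange_big; apply: ler_sum => j _ /=.
  rewrite /weight /psmul (le_trans (ler_wpM2r _ (nm_sum _ _ _))) ?exprn_ge0//.
  rewrite mulr_suml; apply: ler_sum => k _.
  rewrite (le_trans (ler_wpM2r _ (nm_sum _ _ _))) ?exprn_ge0//.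
  rewrite mulr_suml; apply: ler_sum => l _; rewrite nmM /f /weight mulrACA -exprD.
  by rewrite (_ : (k + l + (i - k + (j - l)) = i + j)%N)//; have := ltn_ord k; have := ltn_ord l; lia.
pose A k := \sum_(l < n - k) weight s a k l.
pose B k := \sum_(l < n - k) weight s b k l.
have A0 k : 0 <= A k by apply: sumr_ge0 => ? _; exact: weight_ge0.
have B0 k : 0 <= B k by apply: sumr_ge0 => ? _; exact: weight_ge0.
apply: (@le_trans _ _ (\sum_(i < n) \sum_(k < i.+1) A k * B (i - k)%N)).
  apply: ler_sum => i _; apply: ler_sum => k _.
  rewrite (tri_cauchy _ (fun l q => weight s a k l * weight s b (i - k)%N q)) /tri.
  apply: (@le_trans _ _ (\sum_(l < n - i) weight s a k l * B (i - k)%N)).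
    apply: ler_sum => l _; rewrite -mulr_sumr ler_wpM2l ?weight_ge0//.
    by apply: ler_sum_widen => [|q]; [lia|exact: weight_ge0].
  rewrite -mulr_suml ler_wpM2r//.
  by apply: ler_sum_widen => [|q]; [have := ltn_ord k; lia|exact: weight_ge0].
rewrite (tri_cauchy _ (fun k p => A k * B p)).
rewrite (le_trans (tri_le_box (leqnn _) _))// => [i j|]; first exact: mulr_ge0.
by rewrite /trunc_norm /tri mulr_suml; apply: ler_sum => i _; rewrite -mulr_sumr.
Qed.

Lemma bnd_psmul s K L a b : 0 <= s -> bnd s K a -> bnd s L b -> bnd s (K * L) (psmul a b).
Proof.
move=> s0 ha hb n; rewrite (le_trans (trunc_norm_psmul n a b s0))//.
by rewrite ler_pM ?trunc_norm_ge0.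
Qed.

Lemma bnd_psexp s K a n : 0 <= s -> bnd s K a -> bnd s (K ^+ n) (psexp a n).
Proof.
move=> s0 ha; elim: n => [|n IH].
  by have := bnd_monom 0 0 s0.
by rewrite exprS; apply: bnd_psmul.
Qed.

(** Composition does not increase norms: the powers u^i v^j have norm at most
   s^(i + j). *)
Lemma bnd_pscomp s t K a u v : 0 <= s -> 0 <= t ->
  bnd s K a -> bnd t s u -> bnd t s v -> bnd t K (pscomp a u v).
Proof.
move=> s0 t0 ha hu hv N.
apply: le_trans (bnd_box N s0 ha).
pose w i j n m := weight t (psmul (psexp u i) (psexp v j)) n m.
apply: (@le_trans _ _ (\sum_(n < N) \sum_(m < N - n)
    \sum_(i < N) \sum_(j < N) nm (a i j) * w i j n m)).
  apply: ler_sum => n _; apply: ler_sum => m _.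
  have nmN : ((n + m).+1 <= N)%N by have := ltn_ord n; have := ltn_ord m; lia.
  rewrite /weight /pscomp (le_trans (ler_wpM2r _ (nm_sum _ _ _))) ?exprn_ge0//.
  rewrite mulr_suml.
  apply: le_trans (@ler_sum_widen _ _ N (fun i => \sum_(j < N) nm (a i j) * w i j n m) nmN _); last first.
    by move=> i; apply: sumr_ge0 => j _; rewrite mulr_ge0 ?nm_ge0 ?weight_ge0.
  apply: ler_sum => i _.
  rewrite (le_trans (ler_wpM2r _ (nm_sum _ _ _))) ?exprn_ge0// mulr_suml.
  apply: le_trans (@ler_sum_widen _ _ N (fun j => nm (a i j) * w i j n m) nmN _); last first.
    by move=> j; rewrite mulr_ge0 ?nm_ge0 ?weight_ge0.
  by apply: ler_sum => j _; rewrite nmM -mulrA.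
under eq_bigr => n _ do rewrite exchange_big.
rewrite exchange_big; apply: ler_sum => i _ /=.
under eq_bigr => n _ do rewrite exchange_big.
rewrite exchange_big; apply: ler_sum => j _ /=.
under eq_bigr => n _ do rewrite -mulr_sumr.
rewrite -mulr_sumr ler_wpM2l ?nm_ge0// exprD.
by apply: (bnd_psmul t0 (bnd_psexp i t0 hu) (bnd_psexp j t0 hv)).
Qed.

(** Shrinking the radius by t multiplies the terms of degree k by t^k. *)
Lemma bnd_small s K a d (t : R) : 0 <= s -> 0 <= t <= 1 ->
  (forall i j, (i + j < d)%N -> a i j = 0) -> bnd s K a -> bnd (t * s) (t ^+ d * K) a.
Proof.
move=> s0 /andP[t0 t1] a0 h n; rewrite (le_trans _ (ler_wpM2l _ (h n))) ?exprn_ge0//.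
rewrite /trunc_norm /tri mulr_sumr; apply: ler_sum => i _ /=.
rewrite mulr_sumr; apply: ler_sum => j _ /=; rewrite /weight.
have [hd|hd] := ltnP (i + j) d; first by rewrite a0// nm0 !mul0r mulr0.
rewrite mulrCA ler_wpM2l ?nm_ge0// exprMn ler_wpM2r ?exprn_ge0//.
exact: ler_wiXn2l.
Qed.

Lemma sum_half n : \sum_(i < n) (2^-1 : R) ^+ i <= 2.
Proof.
have -> : \sum_(i < n) (2^-1 : R) ^+ i = 2 - 2 * 2^-1 ^+ n.
  elim: n => [|n IH]; first by rewrite big_ord0 expr0; lra.
  by rewrite big_ord_recr /= IH exprS; field.
by rewrite gerBl mulr_ge0// exprn_ge0.
Qed.

(** Halving the radius turns a bound on coefficients into a summable one, by
   comparison with a geometric series. *)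
Lemma convergentP a : convergent a <-> exists s K, 0 < s /\ bnd s K a.
Proof.
split.
  case=> r [K [/pos_ofreal[rE r0] h]]; rewrite rE in h.
  set s := complex.Re r in h r0.
  have K0 : 0 <= K by rewrite (le_trans _ (h 0%N 0%N))// expr0 mulr1 normr_ge0.
  have h' i j : weight s a i j <= nm K.
    by move: (h i j) => hij; rewrite -(ger0_norm K0) !nmE -ofrealX -ofrealM ofreal_le in hij.
  exists (s / 2), (nm K * 4); split; first by rewrite divr_gt0.
  move=> n.
  have b0 i j : 0 <= nm K * (2^-1 ^+ i * 2^-1 ^+ j).
    by rewrite !mulr_ge0 ?nm_ge0 ?exprn_ge0.
  apply: le_trans (@ler_tri _ _ n _ (fun i j => nm K * (2^-1 ^+ i * 2^-1 ^+ j)) (leqnn _) b0 _) _.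
    move=> i j _; rewrite /weight exprMn mulrA -exprD ler_wpM2r ?exprn_ge0//; exact: h'.
  rewrite (le_trans (tri_le_box (leqnn n) b0))//.
  under eq_bigr => i _ do rewrite -mulr_sumr -mulr_sumr mulrCA.
  rewrite -mulr_suml mulrC -mulrA ler_wpM2l ?nm_ge0// (_ : 4 = 2 * 2); last by lra.
  by rewrite ler_pM ?sum_half ?sumr_ge0// => i _; rewrite exprn_ge0.
case=> s [K [s0 h]]; exists (ofreal s), (ofreal K); rewrite ofreal_lt; split => // i j.
rewrite nmE -ofrealX -ofrealM ofreal_le; exact: (bnd_coef i j (ltW s0) h).
Qed.

Definition trunc_eval n a (x y : cplx R) : cplx R := tri n (fun i j => a i j * x ^+ i * y ^+ j).

(** The terms left out by the triangle have degree at least n, hence carry a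
   factor t^n. *)
Lemma box_trunc_eval s t K a n m x y : 0 <= s -> 0 <= t <= 1 -> bnd s K a ->
  nm x <= t * s -> nm y <= t * s -> (n <= m)%N ->
  nm (\sum_(i < m) \sum_(j < m) a i j * x ^+ i * y ^+ j - trunc_eval n a x y) <= t ^+ n * K.
Proof.
move=> s0 /andP[t0 t1] h hx hy nlm; rewrite /trunc_eval (tri_box _ nlm).
under [X in _ - X]eq_bigr => i _ do rewrite big_mkcond.
rewrite -sumrB.
under eq_bigr => i _ do rewrite -sumrB.
rewrite (le_trans (nm_sum _ _ _))//.
have h2 := bnd_box m s0 h.
rewrite (le_trans _ (ler_wpM2l _ h2)) ?exprn_ge0//.
rewrite mulr_sumr; apply: ler_sum => i _.
rewrite (le_trans (nm_sum _ _ _))// mulr_sumr; apply: ler_sum => j _.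
have w0 := weight_ge0 a i j s0.
case: ifPn => hij; first by rewrite subrr nm0 mulr_ge0 ?exprn_ge0.
rewrite subr0 !nmM !nmX /weight -!mulrA [leRHS]mulrCA ler_wpM2l ?nm_ge0//.
apply: (@le_trans _ _ ((t * s) ^+ i * (t * s) ^+ j)).
  by rewrite ler_pM ?exprn_ge0 ?nm_ge0// lerXn2r ?nnegrE ?nm_ge0 ?mulr_ge0.
rewrite -exprD exprMn ler_wpM2r ?exprn_ge0//.
by rewrite ler_wiXn2l// leqNgt.
Qed.

Lemma pseval_trunc_eval s K a n x y : 0 <= s -> bnd s K a -> nm x <= s / 2 -> nm y <= s / 2 ->
  nm (pseval a x y - trunc_eval n a x y) <= K / 2 ^+ n.
Proof.
move=> s0 h hx hy.
have h2 n' m : (n' <= m)%N ->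
    nm (\sum_(i < m) \sum_(j < m) a i j * x ^+ i * y ^+ j - trunc_eval n' a x y) <= K / 2 ^+ n'.
  move=> le; rewrite mulrC -exprVn; apply: (box_trunc_eval s0 _ h) => //; try by rewrite mulrC.
  by apply/andP; split; lra.
have [l [hl hn]] := geom_cvg h2.
by rewrite /pseval (cvg_lim _ hl).
Qed.

(** The error bound carries the full power of t, not only the geometric factor
   needed for convergence: this yields the derivative at 0 and isolates leading
   homogeneous parts. *)
Lemma pseval_tail s t K a n x y : 0 <= s -> 0 <= t <= 2^-1 -> bnd s K a ->
  nm x <= t * s -> nm y <= t * s ->
  nm (pseval a x y - trunc_eval n a x y) <= t ^+ n * K.
Proof.
move=> s0 /andP[t0 t1] h hx hy.
have t2 : 0 <= t <= 1 by rewrite t0 (le_trans t1)//; lra.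
have le2 z : z <= t * s -> z <= s / 2.
  by move=> /le_trans -> //; rewrite mulrC ler_wpM2l.
apply/ler_addgt0Pr => e e0.
have [N hN] := exp_half_small (K *+ 2) e0; set m := maxn N n.
have := box_trunc_eval s0 t2 h hx hy (leq_maxr N n); set B := (X in nm (X - _) <= _) => hB.
rewrite (le_trans (nm_dist _ B _))// addrC lerD// (le_trans (nm_dist _ (trunc_eval m a x y) _))//.
rewrite (le_trans _ (ltW (hN m (leq_maxl _ _))))// mulr2n mulrDl lerD ?(pseval_trunc_eval m s0 h) ?le2//.
rewrite nmC mulrC -exprVn; apply: (box_trunc_eval s0 _ h) => //; try by rewrite mulrC le2.
by apply/andP; split; lra.
Qed.

Lemma geom_eq0 (z : cplx R) C : (forall n, nm z <= C / 2 ^+ n) -> z = 0.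
Proof.
move=> h; apply: nm_eq0; apply/eqP; rewrite eq_le nm_ge0 andbT.
apply/ler_addgt0Pr => e e0; rewrite add0r.
by have [N hN] := exp_half_small C e0; rewrite (le_trans (h N))// ltW// hN.
Qed.

Lemma pseval_uniq s K C a l x y : 0 <= s -> bnd s K a -> nm x <= s / 2 -> nm y <= s / 2 ->
  (forall n, nm (l - trunc_eval n a x y) <= C / 2 ^+ n) -> pseval a x y = l.
Proof.
move=> s0 h hx hy hl; apply/subr0_eq/(@geom_eq0 _ (K + C)) => n.
rewrite (le_trans (nm_dist _ (trunc_eval n a x y) _))// mulrDl lerD ?(pseval_trunc_eval n s0 h)//.
by rewrite nmC.
Qed.

Lemma pseval_bound s K a x y : 0 <= s -> bnd s K a -> nm x <= s / 2 -> nm y <= s / 2 ->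
  nm (pseval a x y) <= K.
Proof.
move=> s0 h hx hy; have := pseval_trunc_eval 0 s0 h hx hy.
by rewrite /trunc_eval /tri big_ord0 subr0 expr0 divr1.
Qed.

Lemma pseval_linear s K L a b (c : cplx R) x y : 0 <= s -> bnd s K a -> bnd s L b ->
  nm x <= s / 2 -> nm y <= s / 2 ->
  pseval (a + c *: b) x y = pseval a x y + c * pseval b x y.
Proof.
move=> s0 ha hb hx hy.
apply: (pseval_uniq (C := K + nm c * L) s0 (bndD s0 ha (bndZ c s0 hb)) hx hy) => n.
have -> : trunc_eval n (a + c *: b) x y = trunc_eval n a x y + c * trunc_eval n b x y.
  rewrite /trunc_eval /tri mulr_sumr -big_split; apply: eq_bigr => i _ /=.
  rewrite mulr_sumr -big_split; apply: eq_bigr => j _ /=.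
  by rewrite mulrDl mulrDl !mulrA.
rewrite opprD addrACA -mulrBr (le_trans (nmD _ _))// mulrDl lerD ?(pseval_trunc_eval n s0 ha)//.
by rewrite nmM -mulrA ler_wpM2l ?nm_ge0// (pseval_trunc_eval n s0 hb).
Qed.

Lemma trunc_eval_monom n p q x y :
  trunc_eval n (monom R p q) x y = if (p + q < n)%N then x ^+ p * y ^+ q else 0.
Proof.
rewrite /trunc_eval; case: ifP => h; last first.
  rewrite /tri big1// => i _; rewrite big1// => j _; rewrite monom_eq0 ?mul0r//.
  by rewrite xpair_eqE; have := ltn_ord j; have := ltn_ord i; lia.
rewrite (tri_box _ (leqnn n)).
under eq_bigr => i _ do rewrite big_mkcond.
rewrite (@box_single _ _ _
  (fun i j => if (i + j < n)%N then monom R p q i j * x ^+ i * y ^+ j else 0) p q); [|lia|lia|].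
  by rewrite h /monom !eqxx mul1r.
by move=> i j _ _ ij; rewrite monom_eq0// !mul0r; case: ifP.
Qed.

Lemma pseval_monom p q x y : pseval (monom R p q) x y = x ^+ p * y ^+ q.
Proof.
set s := 2 * (nm x + nm y).
have s0 : 0 <= s by rewrite mulr_ge0// addr_ge0 ?nm_ge0.
have sE : s / 2 = nm x + nm y by rewrite /s; field.
apply: (pseval_uniq (C := nm (x ^+ p * y ^+ q) * 2 ^+ (p + q)) s0 (bnd_monom p q s0)).
- by rewrite sE lerDl nm_ge0.
- by rewrite sE lerDr nm_ge0.
move=> n; rewrite trunc_eval_monom; case: ifPn => h.
  by rewrite subrr nm0 !mulr_ge0 ?nm_ge0 ?invr_ge0 ?exprn_ge0.
rewrite subr0 -mulrA ler_peMr ?nm_ge0// ler_pdivlMr ?exprn_gt0// mul1r.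
by rewrite ler_weXn2l ?ler1n// leqNgt.
Qed.

(** A functional that is bounded for one of the norms and vanishes on monomials
   vanishes on every series with a finite norm of larger radius, because such a
   series is the limit of its truncations for the first norm. *)
Lemma bounded_functional_eq0 s C (L : pser R -> cplx R) : 0 <= s ->
  (forall c a b K1 K2, bnd s K1 a -> bnd s K2 b -> L (a + c *: b) = L a + c * L b) ->
  (forall p q, L (monom R p q) = 0) ->
  (forall a K, bnd s K a -> nm (L a) <= C * K) ->
  forall a K, bnd (2 * s) K a -> L a = 0.
Proof.
move=> s0 hL hm hb a K ha.
pose Q b := (exists K, bnd s K b) /\ L b = 0.
have b00 : bnd s 0 0 by apply: bnd0.
have Q0 : Q 0.
  split; first by exists 0.
  have := hL 1 _ _ _ _ b00 b00; rewrite scale1r add0r mul1r => h.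
  by apply: (addrI (L 0)); rewrite -h addr0.
have QD b c : Q b -> Q c -> Q (b + c).
  case=> [[K1 h1] e1] [[K2 h2] e2]; split; first by exists (K1 + K2); apply: bndD.
  by have := hL 1 _ _ _ _ h1 h2; rewrite scale1r e1 e2 mulr0 addr0.
have Qm c p q : Q (c *: monom R p q).
  split; first by exists (nm c * s ^+ (p + q)); apply/bndZ/bnd_monom.
  by have := hL c _ _ _ _ b00 (bnd_monom p q s0); rewrite add0r hm (proj2 Q0) mulr0 addr0.
pose t n : pser R := tri n (fun p q => a p q *: monom R p q).
have Qt n : Q (t n).
  by apply: (big_ind Q) => // p _; apply: (big_ind Q) => // q _; exact: Qm.
have tE n i j : t n i j = if (i + j < n)%N then a i j else 0.
  have -> : t n i j = trunc_eval n (fun p q => a p q * (monom R i j p q)) 1 1.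
    rewrite /t /trunc_eval /tri !fct_sumE; apply: eq_bigr => p _; rewrite !fct_sumE.
    apply: eq_bigr => q _; rewrite !expr1n !mulr1.
    by rewrite (_ : (a p q *: monom R p q) i j = a p q * monom R p q i j)// /monom (eq_sym i) (eq_sym j).
  have -> : trunc_eval n (fun p q => a p q * monom R i j p q) 1 1 = a i j * trunc_eval n (monom R i j) 1 1.
    rewrite /trunc_eval /tri mulr_sumr; apply: eq_bigr => p _.
    rewrite mulr_sumr; apply: eq_bigr => q _; rewrite /monom.
    rewrite !expr1n !mulr1; have [pi|_] := eqVneq (p : nat) i; last by rewrite !mulr0.
    by have [qj|_] := eqVneq (q : nat) j; rewrite ?mulr0//= -pi -qj.
  by rewrite trunc_eval_monom !expr1n !mulr1; case: ifP; rewrite ?mulr1 ?mulr0.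
apply: (@geom_eq0 _ (C * K)) => n.
have [[K' ht] Lt] := Qt n.
have subE i j : (a - t n) i j = a i j - t n i j by [].
have h : bnd s (2^-1 ^+ n * K) (a - t n).
  have -> : s = 2^-1 * (2 * s) by field.
  apply: bnd_small; [by rewrite mulr_ge0|by apply/andP; split; lra| |].
    by move=> i j hij; rewrite subE tE hij subrr.
  move=> m; rewrite (le_trans _ (ha m))//.
  apply: ler_tri => // i j; first by rewrite weight_ge0 ?mulr_ge0.
  move=> _; rewrite /weight ler_wpM2r ?exprn_ge0 ?mulr_ge0//.
  rewrite subE tE; case: ifP => _; last by rewrite subr0.
  by rewrite subrr nm0 nm_ge0.
have := hL 1 _ _ _ _ ht h; rewrite scale1r subrKC Lt add0r mul1r => ->.
by rewrite (le_trans (hb _ _ h))// exprVn (mulrC _ K) mulrA.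
Qed.

End TruncatedNorms.

(* Unification must not unfold values of series into limits. *)
#[local] Opaque pseval.

(** * Algebra of power series *)

Section SeriesAlgebra.
Variable R : realType.
Implicit Types (a b d u v : pser R).

Lemma pserDE a b i j : (a + b) i j = a i j + b i j. Proof. by []. Qed.
Lemma pserNE a i j : (- a) i j = - a i j. Proof. by []. Qed.
Lemma pserBE a b i j : (a - b) i j = a i j - b i j. Proof. by []. Qed.
Lemma pserZE c a i j : (c *: a) i j = c * a i j. Proof. by []. Qed.
Lemma pser0E i j : (0 : pser R) i j = 0. Proof. by []. Qed.

Lemma pserP a b : (forall i j, a i j = b i j) -> a = b.
Proof. by move=> h; apply/funext => i; apply/funext => j. Qed.

Lemma psmulDl c a b d : psmul (a + c *: b) d = psmul a d + c *: psmul b d.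
Proof.
apply: pserP => n m; rewrite pserDE pserZE /psmul mulr_sumr -big_split.
apply: eq_bigr => i _ /=; rewrite mulr_sumr -big_split; apply: eq_bigr => j _ /=.
by rewrite mulrDl mulrA.
Qed.

Lemma psmulC a b : psmul a b = psmul b a.
Proof.
apply: pserP => n m; rewrite /psmul (reindex_inj rev_ord_inj); apply: eq_bigr => i _ /=.
rewrite (reindex_inj rev_ord_inj); apply: eq_bigr => j _ /=.
by rewrite mulrC !subSS !subKn// -ltnS.
Qed.

Lemma psmulDr c a b d : psmul d (a + c *: b) = psmul d a + c *: psmul d b.
Proof. by rewrite psmulC psmulDl !(psmulC d). Qed.

Lemma psmul_monom p q a i j :
  psmul (monom R p q) a i j = if (p <= i)%N && (q <= j)%N then a (i - p)%N (j - q)%N else 0.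
Proof.
rewrite /psmul; case: ifPn => h; last first.
  rewrite big1// => k _; rewrite big1// => l _; rewrite monom_eq0 ?mul0r//.
  by rewrite xpair_eqE; have := ltn_ord k; have := ltn_ord l; lia.
rewrite (@box_single _ _ _ (fun k l => monom R p q k l * a (i - k)%N (j - l)%N) p q); [|lia|lia|].
  by rewrite /monom !eqxx mul1r.
by move=> k l _ _ kl; rewrite monom_eq0// mul0r.
Qed.

Lemma psmul_monom_monom p q p' q' : psmul (monom R p q) (monom R p' q') = monom R (p + p') (q + q').
Proof.
apply: pserP => i j; rewrite psmul_monom /monom; case: ifPn => h.
  by rewrite (_ : _ && _ = (i == p + p')%N && (j == q + q')%N)//; lia.
by rewrite (_ : _ && _ = false)//; lia.
Qed.

Lemma psmul1 a : psmul (monom R 0 0) a = a.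
Proof. by apply: pserP => i j; rewrite psmul_monom /= !subn0. Qed.

Lemma psexp1 a : psexp a 1 = a.
Proof. by rewrite /psexp /= psmulC psmul1. Qed.

Definition ordp n a := agree n a 0.

Lemma psmul_ord n m a b : ordp n a -> ordp m b -> ordp (n + m) (psmul a b).
Proof.
move=> ha hb i j hij; rewrite /psmul big1// => -[k hk] _; rewrite big1// => -[l hl] _ /=.
have [h|h] := ltnP (k + l) n; first by rewrite ha// mul0r.
by rewrite hb ?mulr0//; lia.
Qed.

Lemma psexp_ord a n : a 0%N 0%N = 0 -> ordp n (psexp a n).
Proof.
move=> a0; elim: n => [|n IH] //; apply: (@psmul_ord 1) => // i j.
by case: i => //; case: j.
Qed.

Arguments psexp_ord [a] n _.

Lemma ordp1 a : a 0%N 0%N = 0 -> ordp 1 a.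
Proof. by move=> a0; rewrite -(psexp1 a); apply: psexp_ord. Qed.

Lemma pscompD c a b u v : pscomp (a + c *: b) u v = pscomp a u v + c *: pscomp b u v.
Proof.
apply: pserP => n m; rewrite pserDE pserZE /pscomp mulr_sumr -big_split.
apply: eq_bigr => i _ /=; rewrite mulr_sumr -big_split; apply: eq_bigr => j _ /=.
by rewrite pserDE pserZE mulrDl mulrA.
Qed.

Lemma pscomp_monom p q u v : u 0%N 0%N = 0 -> v 0%N 0%N = 0 ->
  pscomp (monom R p q) u v = psmul (psexp u p) (psexp v q).
Proof.
move=> u0 v0; apply: pserP => n m; rewrite /pscomp.
have W := psmul_ord (psexp_ord p u0) (psexp_ord q v0).
have [h|h] := leqP (p + q) (n + m); last first.
  rewrite W// big1// => k _; rewrite big1// => l _.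
  have [[-> ->]|kl] := eqVneq (k : nat, l : nat) (p, q); first by rewrite W// mulr0.
  by rewrite monom_eq0 ?mul0r.
rewrite (@box_single _ _ _
  (fun k l => monom R p q k l * psmul (psexp u k) (psexp v l) n m) p q); [|lia|lia|].
  by rewrite /monom !eqxx mul1r.
by move=> k l _ _ kl; rewrite monom_eq0// mul0r.
Qed.

Lemma pscomp00 a u v : u 0%N 0%N = 0 -> v 0%N 0%N = 0 -> pscomp a u v 0%N 0%N = a 0%N 0%N.
Proof.
by move=> u0 v0; rewrite /pscomp !big_ord1 /= psmul1 /monom mulr1.
Qed.

(** ** Dependence on finitely many coefficients *)

Lemma agreeD n a b a' b' : agree n a a' -> agree n b b' -> agree n (a + b) (a' + b').
Proof. by move=> h1 h2 i j hij; rewrite !pserDE h1 ?h2. Qed.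

Lemma agreeN n a a' : agree n a a' -> agree n (- a) (- a').
Proof. by move=> h i j hij; rewrite !pserNE h. Qed.

Lemma agreeZ n c a a' : agree n a a' -> agree n (c *: a) (c *: a').
Proof. by move=> h i j hij; rewrite !pserZE h. Qed.

Lemma agree_psconj n a b : agree n a b -> agree n (psconj a) (psconj b).
Proof. by move=> h i j hij; rewrite /psconj h// addnC. Qed.

(** The order of one factor relaxes the precision required from the other. *)
Lemma agree_psmul_ord n p q a b a' b' : agree (n - q) a a' -> agree (n - p) b b' ->
  ordp q b -> ordp p a' ->
  agree n (psmul a b) (psmul a' b').
Proof.
move=> ha hb b0 a0 i j hij; rewrite /psmul; apply: eq_bigr => -[k hk] _.
apply: eq_bigr => -[l hl] _ /=.
transitivity (a' k l * b (i - k)%N (j - l)%N).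
  have [h|h] := ltnP (k + l) (n - q); first by rewrite ha.
  by rewrite b0 ?mulr0//; lia.
have [h|h] := ltnP ((i - k) + (j - l)) (n - p); first by rewrite hb.
by rewrite a0 ?mul0r//; lia.
Qed.

Lemma agree_psmul n a b a' b' : agree n a a' -> agree n b b' ->
  agree n (psmul a b) (psmul a' b').
Proof.
by move=> ha hb; apply: (@agree_psmul_ord n 0 0) => //; rewrite subn0.
Qed.

Lemma agree_psmulS n a b a' b' : agree n a a' -> agree n b b' ->
  a' 0%N 0%N = 0 -> b 0%N 0%N = 0 -> agree n.+1 (psmul a b) (psmul a' b').
Proof.
move=> ha hb a0 b0; apply: (@agree_psmul_ord n.+1 1 1); rewrite ?subn1 //; exact: ordp1.
Qed.

Lemma agree_psexp n a a' k : agree n a a' -> agree n (psexp a k) (psexp a' k).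
Proof. by move=> h; elim: k => [|k IH] //; apply: agree_psmul. Qed.

Lemma psexp00 a k : (0 < k)%N -> a 0%N 0%N = 0 -> psexp a k 0%N 0%N = 0.
Proof. by move=> k0 a0; rewrite (psexp_ord k). Qed.

Lemma agree_psexpS n a a' k : agree n a a' -> a 0%N 0%N = 0 -> a' 0%N 0%N = 0 ->
  (k != 1)%N -> agree n.+1 (psexp a k) (psexp a' k).
Proof.
move=> h a0 a0'; case: k => [|[|k]] // _.
exact: (agree_psmulS h (agree_psexp k.+1 h) a0' (psexp00 _ a0)).
Qed.

Lemma agree_pscomp n a u v u' v' : agree n u u' -> agree n v v' ->
  agree n (pscomp a u v) (pscomp a u' v').
Proof.
move=> hu hv i j hij; rewrite /pscomp; apply: eq_bigr => k _; apply: eq_bigr => l _.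
by rewrite (agree_psmul (agree_psexp k hu) (agree_psexp l hv)).
Qed.

(** Without linear terms every monomial contains two inner series, each of which
   multiplies the error of the other by a series without constant term. *)
Lemma agree_pscompS n a u v u' v' : agree n u u' -> agree n v v' ->
  fixes0 (u, v) -> fixes0 (u', v') -> a 1%N 0%N = 0 -> a 0%N 1%N = 0 ->
  agree n.+1 (pscomp a u v) (pscomp a u' v').
Proof.
move=> hu hv [/= u0 v0] [/= u0' v0'] a10 a01 i j hij; rewrite /pscomp.
apply: eq_bigr => -[k hk] _; apply: eq_bigr => -[l hl] _ /=.
case: k hk => [|k] hk; last case: l hl => [|l] hl.
- have [->|l1] := eqVneq l 1%N; first by rewrite a01 !mul0r.
  by rewrite /= !psmul1 (agree_psexpS hv).
- case: k hk => [|k] hk; first by rewrite a10 !mul0r.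
  by rewrite !(psmulC _ (psexp _ 0)) !psmul1 (agree_psexpS hu).
- rewrite (agree_psmulS (agree_psexp k.+1 hu) (agree_psexp l.+1 hv))//; exact: psexp00.
Qed.

(** A map that gains one degree of precision at each application has a fixed
   point, whose coefficients are read off the iterates; bounds on the truncated
   norms that the map preserves pass to the fixed point, so that convergence
   needs no completeness of a space of series. *)
Lemma causal_fix (I : Type) (T : (I -> pser R) -> I -> pser R) :
  (forall n X Y, (forall k, agree n (X k) (Y k)) -> forall k, agree n.+1 (T X k) (T Y k)) ->
  exists X, T X = X /\ forall s D, 0 <= D ->
    (forall X, (forall k, bnd s D (X k)) -> forall k, bnd s D (T X k)) ->
    forall k, bnd s D (X k).
Proof.
move=> cT; pose It n := iter n T (fun=> 0).
have stepI n m k : agree n (It n k) (It (n + m)%N k).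
  elim: n m k => [|n IH] m k; first by [].
  by apply: cT => k'; apply: IH.
pose X k i j := It (i + j).+1 k i j.
have XI n k : agree n (X k) (It n k).
  move=> i j hij; rewrite /X -(subnKC hij); apply: (stepI (i + j).+1 _ k); lia.
exists X; split.
  apply/funext => k; apply: pserP => i j.
  by rewrite (cT (i + j)%N _ _ (XI (i + j)%N))//; lia.
move=> s D D0 hT k n; rewrite (agree_trunc_norm _ (XI n k)).
suff : forall k, bnd s D (It n k) by apply.
by elim: n {k} => [|n IH] k; [apply: bnd0|apply: hT].
Qed.

(** ** Evaluation *)

Lemma psconjD c a b : psconj (a + c *: b) = psconj a + c^* *: psconj b.
Proof. by apply: pserP => i j; rewrite /psconj !pserDE !pserZE rmorphD rmorphM. Qed.

Lemma psconj_monom p q : psconj (monom R p q) = monom R q p.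
Proof.
apply: pserP => i j; rewrite /psconj /monom andbC.
by case: (_ && _); rewrite ?conjC1 ?conjC0.
Qed.


Lemma pseval_psconj s K a x y : 0 <= s -> bnd s K a -> nm x <= s / 2 -> nm y <= s / 2 ->
  pseval (psconj a) x y = (pseval a (y^*) (x^*))^*.
Proof.
move=> s0 h hx hy; apply: (pseval_uniq (C := K) s0 (bnd_psconj h) hx hy) => n.
have -> : trunc_eval n (psconj a) x y = (trunc_eval n a (y^*) (x^*))^*.
  rewrite /trunc_eval tri_swap /tri rmorph_sum; apply: eq_bigr => i _.
  rewrite rmorph_sum; apply: eq_bigr => j _.
  by rewrite !rmorphM !rmorphXn /= !conjCK /psconj mulrAC.
by rewrite -rmorphB nm_conj (pseval_trunc_eval n s0 h) ?nm_conj.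
Qed.

(** Both sides are bounded functionals of each factor, and they agree when both
   factors are monomials. *)
Lemma pseval_psmul s K L a b x y : 0 <= s -> bnd (2 * s) K a -> bnd (2 * s) L b ->
  nm x <= s / 2 -> nm y <= s / 2 ->
  pseval (psmul a b) x y = pseval a x y * pseval b x y.
Proof.
move=> s0 ha hb hx hy.
have s2 : s <= 2 * s by rewrite ler_peMl// ler1n.
have L0 : 0 <= L by apply: (bnd_ge0 _ hb); rewrite mulr_ge0.
have hb1 : bnd s L b by apply: bndW hb.
have step1 p q : pseval (psmul (monom R p q) b) x y = x ^+ p * y ^+ q * pseval b x y.
  apply/subr0_eq.
  apply: (@bounded_functional_eq0 _ s (s ^+ (p + q) + nm (x ^+ p * y ^+ q))
    (fun b => pseval (psmul (monom R p q) b) x y - x ^+ p * y ^+ q * pseval b x y)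
    s0 _ _ _ _ _ hb) => /=.
  - move=> c a1 a2 K1 K2 h1 h2; rewrite psmulDr.
    have hm := bnd_monom p q s0.
    rewrite (pseval_linear c s0 (bnd_psmul s0 hm h1) (bnd_psmul s0 hm h2) hx hy).
    rewrite (pseval_linear c s0 h1 h2 hx hy); ring.
  - by move=> p' q'; rewrite psmul_monom_monom !pseval_monom !exprD; ring.
  - move=> a' K' h'; rewrite (le_trans (nmB _ _))// mulrDl lerD//.
      exact: (pseval_bound s0 (bnd_psmul s0 (bnd_monom p q s0) h') hx hy).
    by rewrite nmM ler_wpM2l ?nm_ge0// (pseval_bound s0 h').
apply/subr0_eq.
apply: (@bounded_functional_eq0 _ s (L + L)
    (fun a => pseval (psmul a b) x y - pseval a x y * pseval b x y)
    s0 _ _ _ _ _ ha) => /=.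
- move=> c a1 a2 K1 K2 h1 h2; rewrite psmulDl.
  rewrite (pseval_linear c s0 (bnd_psmul s0 h1 hb1) (bnd_psmul s0 h2 hb1) hx hy).
  rewrite (pseval_linear c s0 h1 h2 hx hy); ring.
- by move=> p q; rewrite step1 pseval_monom subrr.
- move=> a' K' h'; rewrite (le_trans (nmB _ _))// mulrDl lerD//.
    by rewrite mulrC; exact: (pseval_bound s0 (bnd_psmul s0 h' hb1) hx hy).
  rewrite nmM mulrC ler_pM ?nm_ge0//; first exact: (pseval_bound s0 hb1).
  exact: (pseval_bound s0 h').
Qed.

Lemma pseval_psexp s K a n x y : 0 <= s -> bnd (2 * s) K a ->
  nm x <= s / 2 -> nm y <= s / 2 ->
  pseval (psexp a n) x y = pseval a x y ^+ n.
Proof.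
move=> s0 ha hx hy; elim: n => [|n IH].
  by rewrite /psexp /= pseval_monom !expr0 mulr1.
have s20 : 0 <= 2 * s by rewrite mulr_ge0.
rewrite exprS -IH; exact: (pseval_psmul s0 ha (bnd_psexp n s20 ha)).
Qed.

(** Both sides are bounded functionals of the outer series; on monomials this is
   multiplicativity. *)
Lemma pseval_pscomp s t K a u v x y : 0 <= s -> 0 <= t -> bnd (2 * s) K a ->
  bnd (2 * t) (s / 2) u -> bnd (2 * t) (s / 2) v -> fixes0 (u, v) ->
  nm x <= t / 2 -> nm y <= t / 2 ->
  pseval (pscomp a u v) x y = pseval a (pseval u x y) (pseval v x y).
Proof.
move=> s0 t0 ha hu hv [/= u0 v0] hx hy.
have t2 : t <= 2 * t by rewrite ler_peMl// ler1n.
have t20 : 0 <= 2 * t by rewrite mulr_ge0.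
have s2 : s / 2 <= s by rewrite ler_pdivrMr// ler_peMr// ler1n.
have hu2 : bnd t s u by apply: bndW hu.
have hv2 : bnd t s v by apply: bndW hv.
have hu1 : bnd t (s / 2) u by apply: bndW hu.
have hv1 : bnd t (s / 2) v by apply: bndW hv.
have ux := pseval_bound t0 hu1 hx hy.
have vx := pseval_bound t0 hv1 hx hy.
apply/subr0_eq.
apply: (@bounded_functional_eq0 _ s 2
    (fun a => pseval (pscomp a u v) x y - pseval a (pseval u x y) (pseval v x y))
    s0 _ _ _ _ _ ha) => /=.
- move=> c a1 a2 K1 K2 h1 h2; rewrite pscompD.
  rewrite (pseval_linear c t0 (bnd_pscomp s0 t0 h1 hu2 hv2) (bnd_pscomp s0 t0 h2 hu2 hv2) hx hy).
  by rewrite (pseval_linear c s0 h1 h2 ux vx) opprD addrACA mulrBr.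
- move=> p q; rewrite pscomp_monom// pseval_monom.
  rewrite (pseval_psmul t0 (bnd_psexp p t20 hu) (bnd_psexp q t20 hv) hx hy).
  by rewrite (pseval_psexp p t0 hu hx hy) (pseval_psexp q t0 hv hx hy) subrr.
- move=> a' K' h'; rewrite (le_trans (nmB _ _))// mulr_natl mulr2n lerD//.
    exact: (pseval_bound t0 (bnd_pscomp s0 t0 h' hu2 hv2) hx hy).
  exact: (pseval_bound s0 h' ux vx).
Qed.

End SeriesAlgebra.
Arguments psexp_ord {R} [a] n _.

(** * Germs of holomorphic functions *)

Section Germs.
Variable R : realType.
Implicit Types (a b u v : pser R) (F G : pser R * pser R).

Lemma convergent_common_bnd a b : convergent a -> convergent b ->
  exists s K, [/\ 0 < s, 0 < K, bnd s K a & bnd s K b].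
Proof.
move=> /convergentP[s [K [s0 ha]]] /convergentP[t [L [t0 hb]]].
have K0 := bnd_ge0 (ltW s0) ha; have L0 := bnd_ge0 (ltW t0) hb.
exists (Num.min s t), (K + L + 1); split; first by rewrite lt_min s0.
- lra.
- by apply: bndW ha; rewrite ?ge_min ?lexx ?le_min ?(ltW s0) ?(ltW t0)//; lra.
- by apply: bndW hb; rewrite ?ge_min ?lexx ?orbT ?le_min ?(ltW s0) ?(ltW t0)//; lra.
Qed.

Lemma convergentD c a b : convergent a -> convergent b -> convergent (a + c *: b).
Proof.
move=> ha hb; have [s [K [s0 K0 h1 h2]]] := convergent_common_bnd ha hb.
apply/convergentP; exists s, (K + nm c * K); split => //.
exact: (bndD (ltW s0) h1 (bndZ c (ltW s0) h2)).
Qed.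

Lemma convergent_monom p q : convergent (monom R p q).
Proof. by apply/convergentP; exists 1, (1 ^+ (p + q)); split => //; exact: bnd_monom. Qed.

Lemma convergent0 : convergent (0 : pser R).
Proof. by apply/convergentP; exists 1, 0; split => //; exact: bnd0. Qed.

Lemma convergentZ c a : convergent a -> convergent (c *: a).
Proof. by move=> /(convergentD c convergent0); rewrite add0r. Qed.

Lemma convergentB a b : convergent a -> convergent b -> convergent (a - b).
Proof. by move=> ha /(convergentD (-1) ha); rewrite scaleN1r. Qed.

Lemma convergent_add a b : convergent a -> convergent b -> convergent (a + b).
Proof. by move=> ha /(convergentD 1 ha); rewrite scale1r. Qed.

Lemma convergent_psconj a : convergent a -> convergent (psconj a).
Proof.
by move=> /convergentP[s [K [s0 h]]]; apply/convergentP; exists s, K; split => //; exact: bnd_psconj.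
Qed.

Lemma convergent_psmul a b : convergent a -> convergent b -> convergent (psmul a b).
Proof.
move=> ha hb; have [s [K [s0 K0 h1 h2]]] := convergent_common_bnd ha hb.
by apply/convergentP; exists s, (K * K); split => //; apply: bnd_psmul => //; exact: ltW.
Qed.

Lemma bnd_dom s K a b : 0 <= s -> (forall i j, nm (b i j) <= nm (a i j)) -> bnd s K a -> bnd s K b.
Proof.
move=> s0 ab h n; rewrite (le_trans _ (h n))//; apply: ler_tri => // i j.
  exact: weight_ge0.
by rewrite /weight ler_wpM2r ?exprn_ge0.
Qed.

(** This makes the inner series of a composition small enough to stay in the
   domain of convergence of the outer one. *)
Lemma bnd_small_const u (e : R) : convergent u -> u 0%N 0%N = 0 -> 0 < e ->
  exists2 t0, 0 < t0 & forall t, 0 <= t <= t0 -> bnd t e u.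
Proof.
move=> /convergentP[s [K [s0 h]]] u0 e0.
have K0 := bnd_ge0 (ltW s0) h.
pose w := Num.min 1 (e / (K + 1)).
have w0 : 0 < w by rewrite lt_min ltr01 divr_gt0//; lra.
exists (w * s); first by rewrite mulr_gt0.
move=> t /andP[t0 t1].
have hw := @bnd_small _ s K u 1 w (ltW s0) _ (ordp1 u0) h.
apply: bndW (hw _) => //; last by rewrite (ltW w0) ge_min lexx.
rewrite expr1 (@le_trans _ _ (e / (K + 1) * K))//.
  by rewrite ler_wpM2r// ge_min lexx orbT.
by rewrite mulrAC ler_pdivrMr ?ler_wpM2l//; lra.
Qed.

Lemma convergent_pscomp a u v : convergent a -> convergent u -> convergent v ->
  fixes0 (u, v) -> convergent (pscomp a u v).
Proof.
move=> /convergentP[s [K [s0 h]]] hu hv [/= u0 v0].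
have [t1 t10 h1] := bnd_small_const hu u0 s0.
have [t2 t20 h2] := bnd_small_const hv v0 s0.
have t0 : 0 < Num.min t1 t2 by rewrite lt_min t10.
apply/convergentP; exists (Num.min t1 t2), K; split => //.
apply: (bnd_pscomp (ltW s0) (ltW t0) h); [apply: h1|apply: h2].
  by rewrite (ltW t0) ge_min lexx.
by rewrite (ltW t0) ge_min lexx orbT.
Qed.

(** ** Values of germs near the origin *)

Lemma near0_le (P : C2 R -> Prop) (e : R) : 0 < e ->
  (forall x y, nm x <= e -> nm y <= e -> P (x, y)) -> \forall p \near (0 : C2 R), P p.
Proof. by move=> e0 h; apply/near0_C2; exists e => // x y /ltW hx /ltW hy; exact: h. Qed.

Lemma near_pseval_linear c a b : convergent a -> convergent b ->
  \forall p \near (0 : C2 R),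
    pseval (a + c *: b) p.1 p.2 = pseval a p.1 p.2 + c * pseval b p.1 p.2.
Proof.
move=> ha hb; have [s [K [s0 K0 h1 h2]]] := convergent_common_bnd ha hb.
apply: (@near0_le _ (s / 2)) => [|x y hx hy]; first by rewrite divr_gt0.
exact: (pseval_linear c (ltW s0) h1 h2).
Qed.

Lemma near_pseval_psmul a b : convergent a -> convergent b ->
  \forall p \near (0 : C2 R),
    pseval (psmul a b) p.1 p.2 = pseval a p.1 p.2 * pseval b p.1 p.2.
Proof.
move=> ha hb; have [s [K [s0 K0 h1 h2]]] := convergent_common_bnd ha hb.
have s20 : 0 < s / 2 by rewrite divr_gt0.
have sE : 2 * (s / 2) = s by field.
apply: (@near0_le _ (s / 2 / 2)) => [|x y hx hy]; first by rewrite divr_gt0.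
by apply: (@pseval_psmul _ (s / 2) K K) => //; rewrite ?sE// ltW.
Qed.

Lemma near_pseval_psconj a : convergent a ->
  \forall p \near (0 : C2 R),
    pseval (psconj a) p.1 p.2 = (pseval a (p.2^*) (p.1^*))^*.
Proof.
move=> /convergentP[s [K [s0 h]]].
apply: (@near0_le _ (s / 2)) => [|x y hx hy]; first by rewrite divr_gt0.
exact: (pseval_psconj (ltW s0) h).
Qed.

Lemma near_pseval_pscomp a u v : convergent a -> convergent u -> convergent v ->
  fixes0 (u, v) -> \forall p \near (0 : C2 R),
    pseval (pscomp a u v) p.1 p.2 = pseval a (pseval u p.1 p.2) (pseval v p.1 p.2).
Proof.
move=> /convergentP[s [K [s0 h]]] hu hv [/= u0 v0].
have s4 : 0 < s / 2 / 2 by rewrite !divr_gt0.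
have [t1 t10 h1] := bnd_small_const hu u0 s4.
have [t2 t20 h2] := bnd_small_const hv v0 s4.
set t := Num.min t1 t2.
have t0 : 0 < t by rewrite lt_min t10.
have tE : 2 * (t / 2) = t by field.
apply: (@near0_le _ (t / 2 / 2)) => [|x y hx hy]; first by rewrite !divr_gt0.
apply: (@pseval_pscomp _ (s / 2) (t / 2) K) => //; rewrite ?divr_ge0 ?(ltW s0) ?(ltW t0)//.
- by rewrite (_ : 2 * (s / 2) = s)//; field.
- by rewrite tE; apply: h1; rewrite (ltW t0) ge_min lexx.
- by rewrite tE; apply: h2; rewrite (ltW t0) ge_min lexx orbT.
Qed.

Lemma pseval_lt u (e : R) : convergent u -> u 0%N 0%N = 0 -> 0 < e ->
  \forall p \near (0 : C2 R), nm (pseval u p.1 p.2) < e.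
Proof.
move=> hu u0 e0; have e2 : 0 < e / 2 by rewrite divr_gt0.
have [t t0 h] := bnd_small_const hu u0 e2.
apply: (@near0_le _ (t / 2)) => [|x y hx hy]; first by rewrite divr_gt0.
have ht : bnd t (e / 2) u by apply: h; rewrite lexx ltW.
rewrite (le_lt_trans (pseval_bound (ltW t0) ht hx hy))//; lra.
Qed.

Lemma near_mapeval F (P : C2 R -> Prop) : holo_germ F ->
  (\forall p \near (0 : C2 R), P p) -> \forall p \near (0 : C2 R), P (mapeval F p).
Proof.
case=> h1 h2 [f1 f2] /near0_C2[e e0 h].
have := pseval_lt h1 f1 e0; have := pseval_lt h2 f2 e0.
by apply: filterS2 => p p2 p1; apply: h.
Qed.

Lemma near_conj (P : C2 R -> Prop) : (\forall p \near (0 : C2 R), P p) ->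
  \forall z \near (0 : cplx R), P (z, z^*).
Proof.
case/near0_C2 => e e0 h; apply/nbhs_nm; exists e => // y; rewrite sub0r nmN => hy.
by apply: h; rewrite ?nm_conj.
Qed.

Lemma pseval00 a : convergent a -> pseval a 0 0 = a 0%N 0%N.
Proof.
move=> /convergentP[s [K [s0 h]]].
have h1 : nm (pseval a 0 0 - trunc_eval 1 a 0 0) <= 0 ^+ 1 * K.
  by apply: (pseval_tail 1 (ltW s0) _ h); rewrite ?nm0 ?mul0r ?lexx ?invr_ge0 ?ler0n.
apply/subr0_eq/nm_eq0/eqP; rewrite eq_le nm_ge0 andbT.
move: h1; rewrite expr1 mul0r; congr (nm (_ - _) <= 0).
by rewrite /trunc_eval /tri big_ord1 subn0 big_ord1 !expr0 !mulr1.
Qed.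

Lemma pseval_affine a : convergent a -> exists C r : R, [/\ 0 < r, 0 <= C &
  forall x y, nm x < r -> nm y < r ->
    nm (pseval a x y - (a 0%N 0%N + a 1%N 0%N * x + a 0%N 1%N * y)) <= C * (nm x + nm y) ^+ 2].
Proof.
move=> /convergentP[s [K [s0 h]]]; have K0 := bnd_ge0 (ltW s0) h.
exists (K / s ^+ 2), (s / 4); split; first by rewrite divr_gt0.
  by rewrite divr_ge0 ?exprn_ge0 ?(ltW s0).
move=> x y hx hy; set t := (nm x + nm y) / s.
have x0 := nm_ge0 x; have y0 := nm_ge0 y.
have tE : t * s = nm x + nm y by rewrite divfK// gt_eqF.
have := @pseval_tail _ s t K a 2 x y (ltW s0) _ h.
rewrite tE lerDl lerDr x0 y0 => /(_ _ isT isT).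
have -> : trunc_eval 2 a x y = a 0%N 0%N + a 1%N 0%N * x + a 0%N 1%N * y.
  rewrite /trunc_eval !tri_recr /tri !big_ord_recl !big_ord0 /= /bump /= !expr0 !expr1; ring.
have -> : t ^+ 2 * K = K / s ^+ 2 * (nm x + nm y) ^+ 2 by rewrite /t expr_div_n; ring.
apply; rewrite divr_ge0 ?(ltW s0) ?addr_ge0//= ler_pdivrMr//; lra.
Qed.

(** ** Uniqueness of coefficients *)

(** At z = 1 + i m the quotients z / zbar are pairwise distinct roots of the
   polynomial with coefficients c. *)
Lemma conj_form_eq0 n (c : nat -> cplx R) :
  (forall z : cplx R, z != 0 -> \sum_(k < n.+1) c k * z ^+ k * (z^*) ^+ (n - k) = 0) ->
  forall k, (k <= n)%N -> c k = 0.
Proof.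
move=> h.
pose p := \poly_(k < n.+1) c k.
pose w (m : nat) : cplx R := 1 + 'i * m%:R.
have wc m : (w m)^* = 1 - 'i * m%:R.
  by rewrite /w rmorphD rmorphM /= conjCi rmorph1 rmorph_nat mulNr.
have ww m : w m * (w m)^* = (1 + m ^ 2)%:R.
  rewrite wc /w mulrDl mulrBr mulrBr !mul1r mulr1 natrD natrX.
  have := @sqrCi (cplx R); rewrite expr2 => ii.
  have -> : 'i * m%:R * ('i * m%:R) = - (m%:R ^+ 2) :> cplx R.
    by rewrite mulrACA ii mulN1r expr2.
  by rewrite opprK addrA subrK.
have w0 m : w m != 0.
  by apply/negP => /eqP e; have /eqP := ww m; rewrite e mul0r eq_sym pnatr_eq0.
have wc0 m : (w m)^* != 0 by rewrite conjC_eq0.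
pose q m := w m / (w m)^*.
have rq m : root p (q m).
  apply/rootP; rewrite horner_poly.
  have := h (w m) (w0 m) => /(congr1 (fun z => z / (w m)^* ^+ n)).
  rewrite mul0r mulr_suml => hs; rewrite -[RHS]hs; apply: eq_bigr => -[k hk] _ /=.
  have kn : (k <= n)%N by [].
  have -> : (w m)^* ^+ n = (w m)^* ^+ k * (w m)^* ^+ (n - k) by rewrite -exprD subnKC.
  rewrite /q expr_div_n; move: (expf_neq0 k (wc0 m)) (expf_neq0 (n - k) (wc0 m)).
  move: (_ ^+ (n - k)) (_^* ^+ k) (w m ^+ k) => x y z x0 y0; by field; apply/andP; split.
have qI : injective q.
  move=> m m' /eqP; rewrite /q eqr_div// => /eqP e.
  have : (w m - (w m)^*) * (w m' + (w m')^*) = (w m + (w m)^*) * (w m' - (w m')^*).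
    apply/subr0_eq; transitivity (2 * (w m * (w m')^* - w m' * (w m)^*)); first by ring.
    by rewrite e subrr mulr0.
  have a m0 : w m0 + (w m0)^* = 2 by rewrite wc /w; ring.
  have b m0 : w m0 - (w m0)^* = 2 * 'i * m0%:R by rewrite wc /w; ring.
  rewrite !a !b mulrC => /(mulfI _) h2; have /eqP := h2 ltac:(by rewrite pnatr_eq0).
  rewrite -!mulrA (inj_eq (mulfI _)) ?pnatr_eq0// (inj_eq (mulfI _)) ?neq0Ci//.
  by rewrite eqr_nat => /eqP.
have p0 : p = 0.
  apply/eqP/negPn/negP => pn0.
  have us : uniq [seq q m | m <- iota 0 n.+1] by rewrite map_inj_uniq// iota_uniq.
  have ar : all (root p) [seq q m | m <- iota 0 n.+1] by apply/allP => z /mapP[m _ ->].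
  have := max_poly_roots pn0 ar us.
  by rewrite size_map size_iota ltnNge size_poly.
move=> k kn; have := congr1 (fun r : {poly cplx R} => r`_k) p0.
by rewrite coef_poly ltnS kn coef0.
Qed.

(** The leading homogeneous part of a would dominate along t z as t tends to 0,
   so it vanishes at every (z, zbar), hence identically. *)
Lemma pseval_conj_eq0 a : convergent a ->
  (\forall z \near (0 : cplx R), pseval a z (z^*) = 0) -> a = 0.
Proof.
move=> /convergentP[s [K [s0 h]]] /nbhs_nm[e e0 he].
have K0 := bnd_ge0 (ltW s0) h.
suff H n : ordp n a by apply: pserP => i j; apply: (H (i + j).+1).
elim: n => [|n IH] //; rewrite /ordp.
suff P z : z != 0 -> \sum_(k < n.+1) a k (n - k)%N * z ^+ k * (z^*) ^+ (n - k) = 0.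
  move=> i j; rewrite ltnS leq_eqVlt => /orP[/eqP ij|ij]; last exact: IH.
  have := @conj_form_eq0 n (fun k => a k (n - k)%N) P i.
  by rewrite -ij leq_addr addKn; apply.
move=> z0; set S := \sum_(k < _) _.
have nz := nm_gt0 z0.
(* On the point t z the terms of degree n add up to t^n S. *)
have key t : 0 < t -> t * nm z < e -> t * nm z <= s / 2 -> nm S <= t * (K * (nm z / s) ^+ n.+1).
  move=> t0 te1 ts.
  have zt : nm (ofreal t * z) = t * nm z by rewrite nmM nm_ofreal gtr0_norm.
  have ct : (ofreal t * z)^* = ofreal t * z^*.
    rewrite rmorphM /=; congr (_ * _).
    by apply/CrealP; rewrite realE -[0]/(ofreal 0) !ofreal_le (ltW t0).
  set w := t * nm z / s.
  have wE : w * s = t * nm z by rewrite divfK// gt_eqF.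
  have := @pseval_tail _ s w K a n.+1 (ofreal t * z) ((ofreal t * z)^*) (ltW s0) _ h.
  rewrite he ?sub0r ?nmN ?zt// nm_conj zt wE lexx => /(_ _ isT isT).
  have -> : trunc_eval n.+1 a (ofreal t * z) ((ofreal t * z)^*) = ofreal t ^+ n * S.
    rewrite /trunc_eval tri_recr [tri n _]big1 ?add0r; last first.
      move=> i _; rewrite big1// => j _; rewrite IH ?pser0E ?mul0r//.
      by have := ltn_ord i; have := ltn_ord j; lia.
    rewrite /S mulr_sumr; apply: eq_bigr => -[k hk] _ /=.
    have kn : (k <= n)%N by [].
    have -> : ofreal t ^+ n = ofreal t ^+ k * ofreal t ^+ (n - k) by rewrite -exprD subnKC.
    rewrite ct !exprMn; ring.
  rewrite nmM nmX nm_ofreal (gtr0_norm t0) => hw.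
  have : t ^+ n * nm S <= t ^+ n * (t * (K * (nm z / s) ^+ n.+1)).
    apply: le_trans (hw _) _.
      by rewrite divr_ge0 ?mulr_ge0 ?(ltW t0) ?(ltW s0) ?(ltW nz)//= ler_pdivrMr// (mulrC _ s).
    rewrite le_eqVlt; apply/orP; left; apply/eqP; rewrite /w -mulrA exprMn (exprS t); ring.
  by rewrite ler_pM2l ?exprn_gt0.
apply: nm_eq0; apply/eqP; rewrite eq_le nm_ge0 andbT; apply/ler_addgt0Pr => d d0; rewrite add0r.
set B := K * _ in key.
have B0 : 0 <= B by rewrite mulr_ge0 ?exprn_ge0 ?divr_ge0 ?(ltW s0) ?(ltW nz).
pose t := Num.min (Num.min (e / 2 / nm z) (s / 2 / nm z)) (d / (B + 1)).
have t0 : 0 < t by rewrite !lt_min !divr_gt0//; lra.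
have t1 : t * nm z <= e / 2 by rewrite -ler_pdivlMr// /t !ge_min lexx.
have t2 : t * nm z <= s / 2 by rewrite -ler_pdivlMr// /t !ge_min lexx orbT.
have t3 : t * (B + 1) <= d by rewrite -ler_pdivlMr ?/t ?ge_min ?lexx ?orbT//; lra.
have := key t t0 _ t2; rewrite -/B; nra.
Qed.

(** Consequently identities between convergent series, such as the equation of M
   in complexified form, may be checked on values. *)
Lemma pser_eq_conj a b : convergent a -> convergent b ->
  (\forall z \near (0 : cplx R), pseval a z (z^*) = pseval b z (z^*)) -> a = b.
Proof.
move=> ha hb h; apply/subr0_eq/pseval_conj_eq0; first exact: convergentB.
have := near_conj (near_pseval_linear (-1) ha hb).
by apply: filterS2 h => z /= e1 e2; move: e2; rewrite scaleN1r mulN1r e1 subrr.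
Qed.

Lemma pser_eq a b : convergent a -> convergent b ->
  (\forall p \near (0 : C2 R), pseval a p.1 p.2 = pseval b p.1 p.2) -> a = b.
Proof. by move=> ha hb /near_conj; apply: pser_eq_conj. Qed.

End Germs.

(** * The inverse function theorem *)

Section Inverse.
Variable R : realType.
Implicit Types (a b u v : pser R) (F G : pser R * pser R).

Definition jac F := F.1 1%N 0%N * F.2 0%N 1%N - F.1 0%N 1%N * F.2 1%N 0%N.

Lemma pscomp_linear_coef a u v n m : fixes0 (u, v) -> (n + m = 1)%N ->
  pscomp a u v n m = a 1%N 0%N * u n m + a 0%N 1%N * v n m.
Proof.
case=> /= u0 v0 nm1; pose w i j := psmul (psexp u i) (psexp v j) n m.
have -> : pscomp a u v n m = \sum_(i < 2) \sum_(j < 2) a i j * w i j by rewrite /pscomp nm1.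
have w00 : w 0%N 0%N = 0 by rewrite /w psmul1 /psexp /= /monom; case: (n) (m) nm1 => [|n'] [|m'].
have w01 : w 0%N 1%N = v n m by rewrite /w psmul1 psexp1.
have w10 : w 1%N 0%N = u n m by rewrite /w psmulC psmul1 psexp1.
have w11 : w 1%N 1%N = 0.
  by rewrite /w (psmul_ord (psexp_ord 1 u0) (psexp_ord 1 v0)) ?nm1.
move: w w00 w01 w10 w11 => w w00 w01 w10 w11.
rewrite !big_ord_recl !big_ord0 /= /bump /= w00 w01 w10 w11.
by rewrite !mulr0 !addr0 add0r addrC.
Qed.

Lemma jac_pscomp F G : fixes0 G ->
  jac (pscomp F.1 G.1 G.2, pscomp F.2 G.1 G.2) = jac F * jac G.
Proof.
move=> f0; have f0' : fixes0 (G.1, G.2) by [].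
rewrite /jac /= !(pscomp_linear_coef _ f0')//; ring.
Qed.

Lemma jac_id : jac (monom R 1 0, monom R 0 1) = 1.
Proof. by rewrite /jac /monom /= mulr1 mulr0 subr0. Qed.

(** Compositions need inner series without constant term, while a fixed point is
   sought among all series. *)
Definition drop_const a : pser R := fun i j => if (i + j == 0)%N then 0 else a i j.

Lemma drop_const_id a : a 0%N 0%N = 0 -> drop_const a = a.
Proof.
move=> a0; apply: pserP => i j; rewrite /drop_const; case: ifPn => //.
by rewrite addn_eq0 => /andP[/eqP-> /eqP->].
Qed.

Lemma agree_drop_const n a b : agree n a b -> agree n (drop_const a) (drop_const b).
Proof. by move=> h i j /h; rewrite /drop_const => ->. Qed.

Lemma bnd_drop_const s K a : 0 <= s -> bnd s K a -> bnd s K (drop_const a).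
Proof.
move=> s0; apply: bnd_dom => // i j; rewrite /drop_const.
by case: ifP => // _; rewrite nm0 nm_ge0.
Qed.

Definition nonlinear_part a : pser R := a - (a 1%N 0%N *: monom R 1 0 + a 0%N 1%N *: monom R 0 1).

Lemma higherE a : a = nonlinear_part a + a 1%N 0%N *: monom R 1 0 + a 0%N 1%N *: monom R 0 1.
Proof. by rewrite /nonlinear_part -addrA subrK. Qed.

Lemma nonlinear_part_ord a : a 0%N 0%N = 0 -> ordp 2 (nonlinear_part a).
Proof.
move=> a0 i j; rewrite /nonlinear_part pserBE pserDE !pserZE /monom.
case: i j => [|[|i]] [|[|j]] //= _; rewrite ?a0 ?mulr0n ?mulr1n !(mulr1, mulr0, addr0, add0r, subr0) ?subrr ?oppr0 ?pser0E; exact: erefl.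
Qed.

Lemma convergent_nonlinear_part a : convergent a -> convergent (nonlinear_part a).
Proof.
move=> ha; apply: convergentB => //; apply: convergent_add;
  apply: convergentZ; exact: convergent_monom.
Qed.

Lemma pscomp_nonlinear_part a u v : fixes0 (u, v) ->
  pscomp a u v = pscomp (nonlinear_part a) u v + a 1%N 0%N *: u + a 0%N 1%N *: v.
Proof.
move=> [/= u0 v0]; rewrite {1}(higherE a) !pscompD !pscomp_monom//.
by rewrite (psmulC (psexp u 1)) !psmul1 !psexp1.
Qed.

(** With L the linear part of F and Q the rest, the right inverse G is the fixed
   point of G = L^-1 (id - Q(G)); since Q has order two, the right-hand side
   gains a degree of precision and is small when G is. *)
Lemma right_inverse F : holo_germ F -> jac F != 0 ->
  exists G, [/\ holo_germ G, pscomp F.1 G.1 G.2 = monom R 1 0 &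
                pscomp F.2 G.1 G.2 = monom R 0 1].
Proof.
case: F => f g [/= cf cg [/= f0 g0]]; rewrite /jac /=.
set D := _ - _ => D0.
pose Q k := nonlinear_part (if k then f else g).
have Qo k : ordp 2 (Q k) by rewrite /Q; case: k; apply: nonlinear_part_ord.
pose X (k : bool) : pser R := if k then monom R 1 0 else monom R 0 1.
(* The inverse of the linear part; true and false index the two coordinates. *)
pose A (k l : bool) : cplx R := match k, l with
  | true, true => g 0%N 1%N / D | true, false => - f 0%N 1%N / D
  | false, true => - g 1%N 0%N / D | false, false => f 1%N 0%N / D end.
pose rest (psi : bool -> pser R) k := X k - pscomp (Q k) (drop_const (psi true)) (drop_const (psi false)).
pose T psi k := A k true *: rest psi true + A k false *: rest psi false.
have k00 a : drop_const a 0%N 0%N = 0 by [].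
have fk psi : fixes0 (drop_const (psi true), drop_const (psi false)) by [].
have cT n P P' : (forall k, agree n (P k) (P' k)) -> forall k, agree n.+1 (T P k) (T P' k).
  move=> h k; apply: agreeD; apply: agreeZ; apply: agreeD => //; apply: agreeN;
  by apply: agree_pscompS; rewrite ?Qo//; apply: agree_drop_const.
have [psi [Tpsi hb]] := causal_fix cT.
have rest00 P k : rest P k 0%N 0%N = 0.
  by rewrite /rest pserBE pscomp00// Qo// subr0 /X; case: k.
have psi00 k : psi k 0%N 0%N = 0.
  by rewrite -Tpsi /T pserDE !pserZE !rest00 !mulr0 addr0.
have cpsi : forall k, convergent (psi k).
  have [s [K [s0 K0 bf bg]]] := convergent_common_bnd (convergent_nonlinear_part cf) (convergent_nonlinear_part cg).
  have bQ k : bnd s K (Q k) by rewrite /Q; case: k.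
  pose M := 1 + (nm (A true true) + nm (A true false) + nm (A false true) + nm (A false false)).
  have At k l : 0 <= nm (A k l) by exact: nm_ge0.
  have M1 : 1 <= M by rewrite lerDl !addr_ge0.
  have M0 : 0 < M by apply: lt_le_trans M1.
  (* The norm tau s of G is preserved when M tau^2 K and M r are at most tau s / 2. *)
  pose tau := Num.min 1 (s / (2 * M * K)).
  have tau0 : 0 < tau by rewrite lt_min ltr01 divr_gt0// !mulr_gt0.
  have tau1 : tau <= 1 by rewrite ge_min lexx.
  have tauE : tau * (2 * M * K) <= s by rewrite -ler_pdivlMr ?mulr_gt0// ge_min lexx orbT.
  pose r := tau * s / (2 * M).
  have r0 : 0 < r by rewrite !divr_gt0 ?mulr_gt0.
  have rE : M * r = tau * s / 2 by rewrite /r; field; rewrite gt_eqF.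
  move=> k; apply/convergentP; exists r, (tau * s); split => //.
  apply: hb; first by rewrite mulr_ge0// ltW.
  move=> P hP l.
  have bX l' : bnd r r (X l').
    by rewrite /X; case: l'; rewrite -{2}(expr1 r); apply: bnd_monom; exact: ltW.
  have hrest l' : bnd r (r + tau ^+ 2 * K) (rest P l').
    apply: bndD (ltW r0) (bX _) _; apply: bndN (ltW r0) _.
    have hQ := bnd_small (t := tau) (ltW s0) _ (Qo l') (bQ l').
    apply: (bnd_pscomp _ (ltW r0) (hQ _)).
    - by rewrite mulr_ge0// ltW.
    - by rewrite (ltW tau0).
    - by apply: bnd_drop_const (ltW r0) _; exact: hP.
    - by apply: bnd_drop_const (ltW r0) _; exact: hP.
  apply: bndW (bndD (ltW r0) (bndZ (A l true) (ltW r0) (hrest _)) (bndZ (A l false) (ltW r0) (hrest _))); rewrite ?lexx ?(ltW r0)//.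
  have W0 : 0 <= r + tau ^+ 2 * K by rewrite addr_ge0 ?(ltW r0)// mulr_ge0 ?exprn_ge0 ?ltW.
  rewrite -mulrDl (@le_trans _ _ (M * (r + tau ^+ 2 * K)))//.
    rewrite ler_wpM2r// /M; have := (At true true, At true false, At false true, At false false).
    by case: l => -[[[]]]; lra.
  rewrite mulrDr rE; have : M * (tau ^+ 2 * K) <= tau * s / 2.
    rewrite (_ : M * (tau ^+ 2 * K) = tau * (tau * (2 * M * K)) / 2); last by field.
    by rewrite ler_pM2r ?invr_gt0// ler_pM2l.
  lra.
exists (psi true, psi false); split; rewrite /=.
- by split; [exact: cpsi..|split; exact: psi00].
all: have fpsi : fixes0 (psi true, psi false) by split; exact: psi00.
all: have psiE k i j : psi k i j =
    A k true * (X true i j - pscomp (Q true) (psi true) (psi false) i j) +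
    A k false * (X false i j - pscomp (Q false) (psi true) (psi false) i j).
1,3: by rewrite -[in LHS]Tpsi /T /rest !drop_const_id.
- apply: pserP => i j; rewrite (pscomp_nonlinear_part f fpsi) !(pserDE, pserZE) (psiE true) (psiE false).
  rewrite /A -[nonlinear_part f]/(Q true) -[monom R 1 0 i j]/(X true i j).
  move: (pscomp _ _ _ i j) (pscomp _ _ _ i j) (X _ i j) (X _ i j) => q1 q2 x y.
  by rewrite /D in D0 *; field.
- apply: pserP => i j; rewrite (pscomp_nonlinear_part g fpsi) !(pserDE, pserZE) (psiE true) (psiE false).
  rewrite /A -[nonlinear_part g]/(Q false) -[monom R 0 1 i j]/(X false i j).
  move: (pscomp _ _ _ i j) (pscomp _ _ _ i j) (X _ i j) (X _ i j) => q1 q2 x y.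
  by rewrite /D in D0 *; field.
Qed.

Definition inverse_germs F G := [/\ holo_germ F, holo_germ G,
  \forall p \near (0 : C2 R), mapeval G (mapeval F p) = p &
  \forall p \near (0 : C2 R), mapeval F (mapeval G p) = p].

Lemma inverse_germs_sym F G : inverse_germs F G -> inverse_germs G F.
Proof. by case. Qed.

Lemma right_inverse_near F : holo_germ F -> jac F != 0 ->
  exists G, [/\ holo_germ G, jac G != 0 & \forall p \near (0 : C2 R), mapeval F (mapeval G p) = p].
Proof.
move=> hF dF; have [G [hG e1 e2]] := right_inverse hF dF.
have [c1 c2 f0] := hF; have [d1 d2 g0] := hG; have g0' : fixes0 (G.1, G.2) by [].
exists G; split => //.
  by have := jac_pscomp F g0; rewrite e1 e2 jac_id => /esym/eqP; apply: contraTneq => ->; rewrite mulr0 eq_sym oner_eq0.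
have := near_pseval_pscomp c1 d1 d2 g0'; have := near_pseval_pscomp c2 d1 d2 g0'.
apply: filterS2 => -[x y] /=; rewrite e1 e2 !pseval_monom !expr0 !expr1 mulr1 mul1r.
by rewrite /mapeval /= => <- <-.
Qed.

(** A right inverse G of F has a right inverse H in turn, and H = F G H = F. *)
Theorem inverse_function F : holo_germ F -> jac F != 0 -> exists G, inverse_germs F G.
Proof.
move=> hF dF; have [G [hG dG FG]] := right_inverse_near hF dF.
have [H [hH _ GH]] := right_inverse_near hG dG.
exists G; split; [exact: hF|exact: hG| |exact: FG].
have FH : \forall p \near (0 : C2 R), mapeval F p = mapeval H p.
  have := near_mapeval hH FG; apply: filterS2 GH => p.
  by move: (mapeval H p) => q <-.
by apply: filterS2 FH GH => p ->.
Qed.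

Lemma pser_mapeval_eq F G : holo_germ F -> holo_germ G ->
  (\forall p \near (0 : C2 R), mapeval F p = mapeval G p) -> F = G.
Proof.
case: F G => f1 f2 [g1 g2] [/= cf1 cf2 _] [/= cg1 cg2 _] h; congr (_, _).
  by apply: pser_eq => //; apply: filterS h => p [].
by apply: pser_eq => //; apply: filterS h => p [].
Qed.

Definition mcomp F G := (pscomp F.1 G.1 G.2, pscomp F.2 G.1 G.2).

Lemma holo_mcomp F G : holo_germ F -> holo_germ G -> holo_germ (mcomp F G).
Proof.
move=> [c1 c2 [f1 f2]] [d1 d2 [g1 g2]]; split => /=; [exact: convergent_pscomp..|].
by split; rewrite /= pscomp00.
Qed.

Lemma near_mcomp F G : holo_germ F -> holo_germ G ->
  \forall p \near (0 : C2 R), mapeval (mcomp F G) p = mapeval F (mapeval G p).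
Proof.
move=> [c1 c2 _] [d1 d2 g0]; have g0' : fixes0 (G.1, G.2) by [].
have := near_pseval_pscomp c1 d1 d2 g0'; have := near_pseval_pscomp c2 d1 d2 g0'.
by apply: filterS2 => p; rewrite /mapeval /= => -> ->.
Qed.

Lemma mapeval_id p : mapeval (monom R 1 0, monom R 0 1) p = p.
Proof. by case: p => x y; rewrite /mapeval /= !pseval_monom !expr0 !expr1 mulr1 mul1r. Qed.

Lemma holo_id : holo_germ (monom R 1 0, monom R 0 1).
Proof. by split; [exact: convergent_monom..|]. Qed.

Lemma inverse_jac F G : inverse_germs F G -> jac F != 0.
Proof.
case=> hF hG _ FG.
have e : mcomp F G = (monom R 1 0, monom R 0 1).
  apply: pser_mapeval_eq; [exact: holo_mcomp|exact: holo_id|].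
  by apply: filterS2 (near_mcomp hF hG) FG => p -> ->; rewrite mapeval_id.
have [_ _ g0] := hG; have := jac_pscomp F g0; rewrite -/(mcomp F G) e jac_id.
by move=> /esym/eqP; apply: contraTneq => ->; rewrite mul0r eq_sym oner_eq0.
Qed.

Lemma inverse_mcomp F F' G G' : inverse_germs F F' -> inverse_germs G G' ->
  inverse_germs (mcomp F G) (mcomp G' F').
Proof.
move=> [hF hF' FF' F'F] [hG hG' GG' G'G].
have nFG := near_mcomp hF hG; have nGF := near_mcomp hG' hF'.
have hFG := holo_mcomp hF hG; have hGF := holo_mcomp hG' hF'.
split; [exact: hFG|exact: hGF| |].
- have h1 := near_mapeval hFG nGF; have h2 := near_mapeval hG FF'.
  have : \forall p \near (0 : C2 R), mapeval G' (mapeval F' (mapeval F (mapeval G p))) = p.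
    by apply: filterS2 h2 GG' => p -> ->.
  by apply: filterS3 nFG h1 => p e1 -> e2; rewrite e1.
- have h1 := near_mapeval hGF nFG; have h2 := near_mapeval hF' G'G.
  have : \forall p \near (0 : C2 R), mapeval F (mapeval G (mapeval G' (mapeval F' p))) = p.
    by apply: filterS2 h2 F'F => p -> ->.
  by apply: filterS3 nGF h1 => p e1 -> e2; rewrite e1.
Qed.

End Inverse.

(** * Multiplicities *)

Section Multiplicity.
Variable R : realType.
Implicit Types (a b u v rho : pser R) (F G T : pser R * pser R).

Lemma convergent_weight a s K : 0 < s -> (forall i j, weight s a i j <= K) -> convergent a.
Proof.
move=> s0 h; exists (ofreal s), (ofreal K); rewrite ofreal_lt; split => // i j.
by rewrite nmE -ofrealX -ofrealM ofreal_le; exact: h.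
Qed.

(** A unit divides every series: q / u is the fixed point of
   h = (q - h (u - u(0))) / u(0). *)
Lemma division_by_unit q u : convergent q -> convergent u -> u 0%N 0%N != 0 ->
  exists2 h, convergent h & psmul h u = q.
Proof.
move=> cq cu u0; set c := u 0%N 0%N in u0.
pose w : pser R := u - c *: monom R 0 0.
have w0 : w 0%N 0%N = 0 by rewrite /w pserBE pserZE /monom mulr1 subrr.
have cw : convergent w by apply: convergentB => //; apply: convergentZ; exact: convergent_monom.
pose T (h : unit -> pser R) (k : unit) : pser R := c^-1 *: (q - psmul (h k) w).
have cT n X Y : (forall k, agree n (X k) (Y k)) -> forall k, agree n.+1 (T X k) (T Y k).
  move=> h k; apply/agreeZ/agreeD => //; apply: agreeN.
  by apply: (@agree_psmul_ord _ n.+1 0 1); rewrite ?subn0 ?subn1//; exact: ordp1.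
have [h [hT hb]] := causal_fix cT.
have nc := nm_gt0 u0.
exists (h tt).
  (* On a polydisc where u varies by at most |u(0)| / 2 the norm of h is at most
     2 |q| / |u(0)|. *)
  have c2 : 0 < nm c / 2 by rewrite divr_gt0.
  have [t t0 ht] := bnd_small_const cw w0 c2.
  have [s [K [s0 hq]]] := (convergentP q).1 cq.
  have K0 := bnd_ge0 (ltW s0) hq.
  pose r := Num.min s t; have r0 : 0 < r by rewrite lt_min s0.
  have r1 := ltW r0.
  apply/convergentP; exists r, (2 * K / nm c); split => //; apply: hb.
    by rewrite !mulr_ge0 ?invr_ge0 ?nm_ge0.
  move=> X hX k.
  have bq : bnd r K q by apply: bndW hq; rewrite ?ge_min ?lexx.
  have bw : bnd r (nm c / 2) w by apply: ht; rewrite r1 ge_min lexx orbT.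
  apply: bndW (bndZ c^-1 r1 (bndD r1 bq (bndN r1 (bnd_psmul r1 (hX k) bw)))) => //.
  rewrite nm_inv le_eqVlt; apply/orP; left; apply/eqP; field; rewrite gt_eqF//.
have E : c *: h tt = q - psmul (h tt) w.
  by rewrite -[in LHS]hT /T scalerA mulfV// scale1r.
have uE : u = w + c *: monom R 0 0 by rewrite /w subrK.
by rewrite {1}uE psmulDr (psmulC _ (monom R 0 0)) psmul1 E addrC subrK.
Qed.

(** ** Transport under local biholomorphisms *)

Lemma pscomp0 u v : pscomp 0 u v = 0 :> pser R.
Proof.
by apply: pserP => n m; rewrite /pscomp big1// => i _; rewrite big1// => j _; rewrite pser0E mul0r.
Qed.

Lemma pscompB_sum n x (c : 'I_n -> cplx R) (b : 'I_n -> pser R) u v :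
  pscomp (x - \sum_(k < n) c k *: b k) u v =
  pscomp x u v - \sum_(k < n) c k *: pscomp (b k) u v.
Proof.
rewrite -scaleN1r pscompD scaleN1r; congr (_ - _).
have D a a' : pscomp (a + a') u v = pscomp a u v + pscomp a' u v.
  by have := pscompD 1 a a' u v; rewrite !scale1r.
rewrite (big_morph (fun a => pscomp a u v) D (pscomp0 u v)); apply: eq_bigr => k _.
by have := pscompD (c k) 0 (b k) u v; rewrite pscomp0 !add0r.
Qed.

Lemma pscomp_psmul a b T : convergent a -> convergent b -> holo_germ T ->
  pscomp (psmul a b) T.1 T.2 = psmul (pscomp a T.1 T.2) (pscomp b T.1 T.2).
Proof.
move=> ca cb hT; have [c1 c2 f0] := hT; have f0' : fixes0 (T.1, T.2) by [].
have cca := convergent_pscomp ca c1 c2 f0'; have ccb := convergent_pscomp cb c1 c2 f0'.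
apply: pser_eq.
- exact: convergent_pscomp (convergent_psmul ca cb) c1 c2 f0'.
- exact: convergent_psmul.
have h1 := near_pseval_pscomp (convergent_psmul ca cb) c1 c2 f0'.
have h2 := near_pseval_psmul cca ccb.
have h3 := near_pseval_pscomp ca c1 c2 f0'.
have h4 := near_pseval_pscomp cb c1 c2 f0'.
have h5 := near_mapeval hT (near_pseval_psmul ca cb).
have h34 : \forall p \near (0 : C2 R),
    pseval (psmul (pscomp a T.1 T.2) (pscomp b T.1 T.2)) p.1 p.2 =
    pseval a (mapeval T p).1 (mapeval T p).2 * pseval b (mapeval T p).1 (mapeval T p).2.
  by apply: filterS3 h2 h3 h4 => p -> -> ->.
by apply: filterS3 h1 h34 h5 => p e1 e2 e3; rewrite e1 e2; exact: e3.
Qed.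

Lemma pscompK a T T' : convergent a -> inverse_germs T T' ->
  pscomp (pscomp a T.1 T.2) T'.1 T'.2 = a.
Proof.
move=> ca [hT hT' _ TT'].
have [c1 c2 f0] := hT; have f0' : fixes0 (T.1, T.2) by [].
have [d1 d2 g0] := hT'; have g0' : fixes0 (T'.1, T'.2) by [].
have cca := convergent_pscomp ca c1 c2 f0'.
apply: pser_eq => //; first exact: convergent_pscomp.
have h1 := near_pseval_pscomp cca d1 d2 g0'.
have h2 := near_mapeval hT' (near_pseval_pscomp ca c1 c2 f0').
by apply: filterS3 h1 h2 TT' => p -> -> /(congr1 (fun q => pseval a q.1 q.2)).
Qed.

Lemma ideal0_pscomp F T a : holo_germ F -> holo_germ T -> ideal0 F a ->
  ideal0 (mcomp F T) (pscomp a T.1 T.2).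
Proof.
move=> [cF1 cF2 _] hT [h1 [h2 [c1 c2 ->]]].
have [d1 d2 f0] := hT; have f0' : fixes0 (T.1, T.2) by [].
exists (pscomp h1 T.1 T.2), (pscomp h2 T.1 T.2); split.
- exact: convergent_pscomp.
- exact: convergent_pscomp.
have := pscompD 1 (psmul h1 F.1) (psmul h2 F.2) T.1 T.2.
by rewrite !scale1r => ->; rewrite !pscomp_psmul.
Qed.

Lemma mcompK F T T' : holo_germ F -> inverse_germs T T' -> mcomp (mcomp F T) T' = F.
Proof.
by case: F => f g [/= cf cg _] hT; rewrite /mcomp /= !(pscompK _ hT).
Qed.

(** Composition with T is an automorphism of O_0 that carries the ideal of F onto
   that of F o T. *)
Lemma mult0_mcomp F T T' n : holo_germ F -> inverse_germs T T' ->
  mult0 F (Some n) -> mult0 (mcomp F T) (Some n).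
Proof.
move=> hF TT' [b [cb hb]].
have [hT hT' _ _] := TT'; have T'T := inverse_germs_sym TT'.
have [c1 c2 f0] := hT; have f0' : fixes0 (T.1, T.2) by [].
have [d1 d2 g0] := hT'; have g0' : fixes0 (T'.1, T'.2) by [].
exists (fun k => pscomp (b k) T.1 T.2); split => [k|x cx].
  exact: convergent_pscomp (cb k) c1 c2 f0'.
have cx' : O0 (pscomp x T'.1 T'.2) by exact: convergent_pscomp cx d1 d2 g0'.
have [c [hc uc]] := hb _ cx'; exists c; split.
  by have := ideal0_pscomp hF hT hc; rewrite pscompB_sum (pscompK cx T'T).
move=> d hd; apply: uc; have := ideal0_pscomp (holo_mcomp hF hT) hT' hd.
rewrite (mcompK hF TT') pscompB_sum.
by under eq_bigr => k _ do rewrite (pscompK (cb k) TT').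
Qed.

(** ** The map (x, rho(x, y)) *)

Lemma psmul_row a b m : psmul a b 0%N m = \sum_(j < m.+1) a 0%N j * b 0%N (m - j)%N.
Proof. by rewrite /psmul big_ord1. Qed.

Lemma psmul_x_row a m : psmul a (monom R 1 0) 0%N m = 0.
Proof. by rewrite psmul_row big1// => j _; rewrite /monom mulr0. Qed.

Lemma sum_row_monom n (c : 'I_n -> cplx R) m :
  (\sum_(k < n) c k *: monom R 0 k) 0%N m = \sum_(k < n | (k : nat) == m) c k.
Proof.
rewrite !fct_sumE [RHS]big_mkcond; apply: eq_bigr => k _.
rewrite -[LHS]/(c k * monom R 0 k 0%N m) /monom /= eq_sym.
by case: ifP; rewrite ?mulr1 ?mulr0.
Qed.

Lemma sum_row_monom_lt n (c : 'I_n -> cplx R) (k : 'I_n) :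
  (\sum_(k < n) c k *: monom R 0 k) 0%N k = c k.
Proof.
by rewrite sum_row_monom (big_pred1 k).
Qed.

Lemma ideal_x_row rho a m : (forall j, (j <= m)%N -> rho 0%N j = 0) ->
  ideal0 (monom R 1 0, rho) a -> a 0%N m = 0.
Proof.
move=> r0 [h1 [h2 [_ _ ->]]]; rewrite pserDE /= psmul_x_row add0r psmul_row big1// => j _.
by rewrite r0 ?mulr0 ?leq_subr.
Qed.

(** Modulo x only the restriction to the line x = 0 matters, where rho is y^k
   times a unit. *)
Lemma mult0_graph rho k : convergent rho -> (forall j, (j < k)%N -> rho 0%N j = 0) ->
  rho 0%N k != 0 -> mult0 (monom R 1 0, rho) (Some k).
Proof.
move=> cr r0 rk; exists (fun j : 'I_k => monom R 0 j); split => [j|x cx].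
  exact: convergent_monom.
pose c : {ffun 'I_k -> cplx R} := [ffun j : 'I_k => x 0%N j].
exists c; split; last first.
  move=> d hd; apply/ffunP => j; rewrite ffunE.
  have := ideal_x_row (m := j) _ hd; rewrite pserBE sum_row_monom_lt.
  move=> /(_ _)/subr0_eq -> // i ij; apply: r0; exact: leq_ltn_trans ij (ltn_ord j).
pose shift a : pser R := fun i j => if i == 0%N then a 0%N (k + j)%N else 0.
have cshift a : convergent a -> convergent (shift a).
  move=> /convergentP[s [K [s0 h]]]; apply: (@convergent_weight _ s (K / s ^+ k)) => // i j.
  have K0 := bnd_ge0 (ltW s0) h.
  rewrite /weight /shift; case: eqP => [->|_]; last by rewrite nm0 mul0r divr_ge0// exprn_ge0// ltW.
  rewrite ler_pdivlMr ?exprn_gt0// -mulrA -exprD add0n (addnC j k).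
  exact: (bnd_coef 0 (k + j) (ltW s0) h).
have sr0 : shift rho 0%N 0%N != 0 by rewrite /shift addn0.
have [h ch hE] := division_by_unit (cshift _ cx) (cshift _ cr) sr0.
pose y := x - \sum_(j < k) c j *: monom R 0 j.
pose z := y - psmul h rho.
have cy : convergent y.
  apply: convergentB => //; apply: (big_ind (@convergent R)).
  - exact: convergent0.
  - by move=> a b ca cb; apply: convergent_add.
  - by move=> j _; apply: convergentZ; exact: convergent_monom.
have cz : convergent z by apply: convergentB => //; exact: convergent_psmul.
have z0 m : z 0%N m = 0.
  rewrite /z pserBE psmul_row /y pserBE.
  have [mk|km] := ltnP m k.
    rewrite (sum_row_monom_lt c (Ordinal mk)) ffunE /= subrr sub0r big1 ?oppr0// => j _.
    by rewrite r0 ?mulr0// (leq_ltn_trans (leq_subr _ _)).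
  rewrite sum_row_monom big1 ?subr0; last by move=> j /eqP jm; have := ltn_ord j; lia.
  have := congr1 (fun a : pser R => a 0%N (m - k)%N) hE.
  rewrite psmul_row /shift /= subnKC// => <-; apply/eqP; rewrite subr_eq0; apply/eqP.
  have mk1 : ((m - k).+1 <= m.+1)%N by lia.
  rewrite (big_ord_widen m.+1 (fun j => h 0%N j * rho 0%N (k + (m - k - j))%N) mk1).
  rewrite big_mkcond; apply: eq_bigr => -[j hj] _ /=; case: ifPn => jm.
    by rewrite (_ : (k + (m - k - j) = m - j)%N)//; lia.
  by rewrite r0 ?mulr0//; lia.
exists (fun i j => z i.+1 j), h; split => //.
  have [s [K [s0 hz]]] := (convergentP z).1 cz.
  apply: (@convergent_weight _ s (K / s)) => // i j.
  by rewrite ler_pdivlMr// /weight -mulrA -exprSr; exact: (bnd_coef i.+1 j (ltW s0) hz).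
rewrite -/y /= -[y](subrK (psmul h rho)) -/z; congr (_ + _).
apply: pserP => i j; rewrite psmulC psmul_monom /= subn0.
by case: i => [|i]; rewrite ?z0//= subn1.
Qed.

(** The ideal consists of series that vanish on x = 0, so 1, y, .., y^n are
   independent modulo it; expressing them by n generators would factor the
   identity matrix of size n + 1 through a space of dimension n. *)
Lemma not_finite_graph rho n : (forall j, rho 0%N j = 0) ->
  ~ mult0 (monom R 1 0, rho) (Some n).
Proof.
move=> r0 [b [cb hb]].
have ex (i : 'I_n.+1) : exists c : {ffun 'I_n -> cplx R}, forall m,
    (monom R 0 i) 0%N m = \sum_(k < n) c k * b k 0%N m.
  have [c [hc _]] := hb _ (convergent_monom R 0 i); exists c => m.
  have := ideal_x_row (m := m) (fun j _ => r0 j) hc; rewrite pserBE => /subr0_eq ->.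
  by rewrite !fct_sumE.
have [C hC] := choice ex.
pose A := \matrix_(i < n.+1, k < n) C i k.
pose B := \matrix_(k < n, m < n.+1) b k 0%N m.
have AB : A *m B = 1%:M.
  apply/matrixP => i m; rewrite !mxE.
  under eq_bigr => k _ do rewrite !mxE.
  by rewrite -hC /monom /= eq_sym.
have := mxrankM_maxl A B; rewrite AB mxrank1 => h.
by have := leq_trans h (rank_leq_col A); rewrite ltnn.
Qed.

End Multiplicity.

(** * The order of rho(0, zbar) is invariant *)

Section OrderTransfer.
Variable R : realType.
Implicit Types (a b u v rho : pser R) (F G : pser R * pser R).

(** The order in y of the restriction to the line x = 0. *)
Definition row_ord d a := forall m, (m < d)%N -> a 0%N m = 0.

Lemma row_ord_psmul d e a b : row_ord d a -> row_ord e b -> row_ord (d + e) (psmul a b).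
Proof.
move=> ha hb m hm; rewrite psmul_row big1// => -[j hj] _ /=.
have [h|h] := ltnP j d; first by rewrite ha// mul0r.
by rewrite hb ?mulr0//; lia.
Qed.

Lemma psmul_row_lead d e a b : row_ord d a -> row_ord e b ->
  psmul a b 0%N (d + e)%N = a 0%N d * b 0%N e.
Proof.
move=> ha hb; have hd : (d < (d + e).+1)%N by lia.
rewrite psmul_row (bigD1 (Ordinal hd))//= addKn big1 ?addr0// => -[j hj] /negP jd /=.
have [h|h] := ltnP j d; first by rewrite ha// mul0r.
rewrite hb ?mulr0//; have : j != d by apply/negP => /eqP e'; apply: jd; apply/eqP/val_inj.
lia.
Qed.

Lemma row_ord_psexp d a n : row_ord d a -> row_ord (d * n) (psexp a n).
Proof. by move=> h; elim: n => [|n IH]; rewrite ?muln0// mulnS; apply: row_ord_psmul. Qed.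

Arguments row_ord_psexp [d a] n _.

Lemma psexp_row_lead d a n : row_ord d a -> psexp a n 0%N (d * n)%N = a 0%N d ^+ n.
Proof.
move=> h; elim: n => [|n IH]; first by rewrite muln0 expr0.
by rewrite mulnS exprS -IH; apply: psmul_row_lead => //; exact: row_ord_psexp.
Qed.

Lemma row_x_psexp i d : (0 < i)%N -> row_ord d (psexp (monom R 1 0) i).
Proof.
move=> i0 m md; apply: (@row_ord_psexp m.+1 _ i) => //.
by rewrite mulSn; case: i i0 => // i _; lia.
Qed.

(** The powers rho^j with j > 1 have order at least 2 k on x = 0. *)
Lemma row_pscomp_graph a rho k m : row_ord k rho -> a 0%N 0%N = 0 -> (m <= k)%N -> (0 < k)%N ->
  pscomp a (monom R 1 0) rho 0%N m = a 0%N 1%N * rho 0%N m.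
Proof.
move=> hr a0 mk k0; rewrite /pscomp add0n.
have [->|m0] := posnP m.
  by rewrite !big_ord1 a0 mul0r hr ?mulr0.
rewrite (@box_single _ _ _ (fun i j => a i j * psmul (psexp (monom R 1 0) i) (psexp rho j) 0%N m) 0%N 1%N)//.
  by rewrite psmul1 psexp1.
move=> [|i] j hi hj ij; last first.
  have := row_ord_psmul (@row_x_psexp i.+1 m.+1 isT) (@row_ord_psexp 0 rho j (fun m (h : (m < 0)%N) => ltac:(by []))).
  by move=> ->; rewrite ?mulr0//; lia.
case: j hj ij => [|[|j]] hj ij //; first by rewrite a0 mul0r.
by rewrite psmul1 (row_ord_psexp j.+2 hr) ?mulr0//; rewrite !mulnS; lia.
Qed.

(** A term u^i v^j with i > 0 has order at least k i + j on x = 0, which is k only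
   for i = 1, j = 0, where a has no coefficient. *)
Lemma row_pscomp_target a u v k : row_ord k u -> row_ord 1 v -> row_ord k a ->
  a 1%N 0%N = 0 -> (0 < k)%N ->
  pscomp a u v 0%N k = a 0%N k * v 0%N 1%N ^+ k.
Proof.
move=> hu hv ha a10 k0; rewrite /pscomp add0n.
rewrite (@box_single _ _ _ (fun i j => a i j * psmul (psexp u i) (psexp v j) 0%N k) 0%N k)//.
  by rewrite psmul1 -(psexp_row_lead k hv) mul1n.
move=> i j hi hj ij.
have W := row_ord_psmul (row_ord_psexp i hu) (row_ord_psexp j hv).
case: i hi ij W => [|i] hi ij W.
  rewrite ha ?mul0r//; have : j != k by apply: contraNneq ij => ->.
  by lia.
case: i hi ij W => [|i] hi ij W; last by rewrite W ?mulr0// mul1n !mulnS; lia.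
case: j hj ij W => [|j] hj ij W; first by rewrite a10 mul0r.
by rewrite W ?mulr0// mul1n muln1; lia.
Qed.

(** For a formal map F, that F sends the surface w = rho into w = rho' can only
   be expressed as this identity between series in z and zbar. *)
Definition transforms F rho rho' := [/\ fixes0 F, jac F != 0 &
  let f := pscomp F.1 (monom R 1 0) rho in
  pscomp F.2 (monom R 1 0) rho = pscomp rho' f (psconj f)].

(** On z = 0 the equation F2(z, rho) = rho'(f, fbar) reads
   c rho(0, zbar) + ... = rho'(0, abar zbar) + ..., where the remaining terms
   vanish to a larger order: f(0, zbar) = F1(0, rho(0, zbar)) is as small as
   rho(0, zbar), and rho' has no linear term. *)
Lemma order_transfer F rho rho' : vanishes2 rho -> vanishes2 rho' -> transforms F rho rho' ->
  exists a c : cplx R, [/\ a != 0, c != 0 &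
    forall k, row_ord k rho -> row_ord k rho' /\ rho' 0%N k * a ^+ k = c * rho 0%N k].
Proof.
move=> r2 r2' [f0 jF]; set f := pscomp _ _ _ => /= E.
have [F10 F20] := f0.
have r00 : rho 0%N 0%N = 0 by apply: r2.
have fx : fixes0 (monom R 1 0, rho) by [].
have f00 : f 0%N 0%N = 0 by rewrite /f pscomp00.
have fc : fixes0 (f, psconj f) by split => //=; rewrite /psconj f00 conjC0.
have F2x : F.2 1%N 0%N = 0.
  have := congr1 (fun a : pser R => a 1%N 0%N) E.
  rewrite (pscomp_linear_coef _ fx)// (pscomp_linear_coef _ fc)//.
  by rewrite (r2' 1%N 0%N)// (r2' 0%N 1%N)// (r2 1%N 0%N)// /monom /= mulr1 mulr0 !mul0r !addr0.
have f10 : f 1%N 0%N = F.1 1%N 0%N.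
  by rewrite /f (pscomp_linear_coef _ fx)// (r2 1%N 0%N)// /monom /= mulr1 mulr0 addr0.
have := jF; rewrite /jac F2x mulr0 subr0 mulf_eq0 negb_or => /andP[a0 c0].
exists ((F.1 1%N 0%N)^*), (F.2 0%N 1%N); split => //; first by rewrite conjC_eq0.
have cv : row_ord 1 (psconj f) by move=> [|m] // _; rewrite /psconj f00 conjC0.
have cv1 : psconj f 0%N 1%N = (F.1 1%N 0%N)^* by rewrite /psconj f10.
elim=> [|k IH] hr.
  by split => //; rewrite (r2' 0%N 0%N)// r00 mul0r mulr0.
have [hr' e'] : row_ord k rho' /\ rho' 0%N k * (F.1 1%N 0%N)^* ^+ k = F.2 0%N 1%N * rho 0%N k.
  by apply: IH => m mk; apply: hr; apply: leq_trans mk _.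
have hr1 : row_ord k.+1 rho'.
  move=> m; rewrite ltnS leq_eqVlt => /orP[/eqP ->|]; last exact: hr'.
  move: e'; rewrite hr// mulr0 => /eqP; rewrite mulf_eq0 => /orP[/eqP//|].
  by rewrite expf_eq0 conjC_eq0 (negbTE a0) andbF.
split => //.
have := congr1 (fun a : pser R => a 0%N k.+1) E; rewrite (row_pscomp_graph hr)// => ->.
rewrite -cv1 (row_pscomp_target _ cv hr1)//; last exact: r2'.
move=> m mk; rewrite /f (row_pscomp_graph hr)//; last exact: ltnW.
by rewrite hr// mulr0.
Qed.

Lemma transforms_row0 F rho rho' : vanishes2 rho -> vanishes2 rho' -> transforms F rho rho' ->
  (forall j, rho 0%N j = 0) <-> (forall j, rho' 0%N j = 0).
Proof.
move=> r2 r2' /(order_transfer r2 r2')[a [c [a0 c0 h]]]; split => [h0 j|h0].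
  by have [+ _] := h j.+1 (fun m _ => h0 m); apply.
suff H k : row_ord k rho by move=> j; apply: (H j.+1).
elim: k => [|k IH] // m; rewrite ltnS leq_eqVlt => /orP[/eqP ->|]; last exact: IH.
have [_] := h k IH; rewrite h0 mul0r => /esym/eqP; rewrite mulf_eq0 (negbTE c0).
by move/eqP.
Qed.

Lemma transforms_order F rho rho' k : vanishes2 rho -> vanishes2 rho' -> transforms F rho rho' ->
  row_ord k rho' -> rho' 0%N k != 0 -> row_ord k rho /\ rho 0%N k != 0.
Proof.
move=> r2 r2' /(order_transfer r2 r2')[a [c [a0 c0 h]]] hk rk.
have hr : row_ord k rho.
  have H l : (l <= k)%N -> row_ord l rho.
    elim: l => [|l IH] // lk m; rewrite ltnS leq_eqVlt => /orP[/eqP ->|]; last exact/IH/ltnW.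
    have [_] := h l (IH (ltnW lk)); rewrite hk// mul0r => /esym/eqP.
    by rewrite mulf_eq0 (negbTE c0) => /eqP.
  exact: H.
split => //; have [_ e] := h k hr; apply: contra_neq rk => r0; move: e.
by rewrite r0 mulr0 => /eqP; rewrite mulf_eq0 expf_eq0 (negbTE a0) andbF orbF => /eqP.
Qed.

Lemma formal_equiv_transforms rho rho' : formal_equiv rho rho' ->
  exists F, transforms F rho rho'.
Proof.
case=> F [[f0 [G [g0 [e1 e2] _]]] E]; exists F; split => //.
have := jac_pscomp G f0; rewrite e1 e2 jac_id => /esym/eqP.
by apply: contraTneq => ->; rewrite mulr0 eq_sym oner_eq0.
Qed.

Lemma biholo_germ_inverse F : biholo_germ F -> exists G, inverse_germs F G.
Proof.
case=> hF [G [hG h]]; exists G; split; [exact: hF|exact: hG| |].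
  by apply: filterS h => p [].
by apply: filterS h => p [].
Qed.

Lemma holo_graph rho : convergent rho -> vanishes2 rho -> holo_germ (monom R 1 0, rho).
Proof. by move=> cr r2; split => //; [exact: convergent_monom|split => //=; exact: r2]. Qed.

Lemma mapeval_graph rho x y : mapeval (monom R 1 0, rho) (x, y) = (x, pseval rho x y).
Proof. by rewrite /mapeval /= pseval_monom expr1 expr0 mulr1. Qed.

Lemma biholo_equiv_transforms (M : set (C2 R)) rho rho' : convergent rho -> convergent rho' ->
  vanishes2 rho -> vanishes2 rho' -> germ_eq M (graph rho) ->
  biholo_equiv M (graph rho') -> exists F, transforms F rho rho'.
Proof.
move=> cr cr' r2 r2' gM [F [bF FM]]; exists F.
have [G FG] := biholo_germ_inverse bF; have jF := inverse_jac FG.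
have [[c1 c2 f0] _] := bF; split => //=.
have hX := holo_graph cr r2; have [cX _ gX] := hX.
set f := pscomp F.1 _ _.
have cf : convergent f by exact: convergent_pscomp.
have f00 : f 0%N 0%N = 0 by rewrite /f pscomp00//; [case: f0|exact: r2].
have fc : fixes0 (f, psconj f) by split => //=; rewrite /psconj f00 conjC0.
have ccf := convergent_psconj cf.
apply: pser_eq_conj; [exact: convergent_pscomp|exact: convergent_pscomp|].
have h1 := near_conj (near_mapeval hX gM).
have h2 := near_conj (near_mapeval hX FM).
have h3 := near_conj (near_pseval_pscomp c1 cX cr gX).
have h4 := near_conj (near_pseval_pscomp c2 cX cr gX).
have h5 := near_conj (near_pseval_psconj cf).
have h6 := near_conj (near_pseval_pscomp cr' cf ccf fc).
(* On M near 0 the second component of F is rho' of the first. *)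
have h12 : \forall z \near (0 : cplx R),
    pseval F.2 z (pseval rho z z^*) = pseval rho' (pseval F.1 z (pseval rho z z^*))
      (pseval F.1 z (pseval rho z z^*))^*.
  apply: filterS2 h1 h2 => z; rewrite mapeval_graph => k1 k2.
  exact: (k2.1 (k1.2 erefl)).
have X1 z : pseval (monom R 1 0) z z^* = z by rewrite pseval_monom expr1 expr0 mulr1.
have lhs : \forall z \near (0 : cplx R),
    pseval (pscomp F.2 (monom R 1 0) rho) z z^* = pseval F.2 z (pseval rho z z^*).
  by apply: filterS h4 => z /= ->; rewrite X1.
have fz : \forall z \near (0 : cplx R), pseval f z z^* = pseval F.1 z (pseval rho z z^*).
  by apply: filterS h3 => z /= ->; rewrite X1.
have rhs : \forall z \near (0 : cplx R),
    pseval (pscomp rho' f (psconj f)) z z^* = pseval rho' (pseval f z z^*) (pseval f z z^*)^*.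
  by apply: filterS2 h6 h5 => z /= -> ->; rewrite conjCK.
have rhs' : \forall z \near (0 : cplx R), pseval (pscomp rho' f (psconj f)) z z^* =
    pseval rho' (pseval F.1 z (pseval rho z z^*)) (pseval F.1 z (pseval rho z z^*))^*.
  by apply: filterS2 rhs fz => z -> ->.
by apply: filterS3 lhs h12 rhs' => z -> -> ->.
Qed.

Lemma M0_graph : M0 R = graph (monom R 1 1).
Proof.
by apply/seteqP; split => -[x y] /=; rewrite /M0 /graph /= pseval_monom !expr1 normCK.
Qed.

End OrderTransfer.

(** * Real derivatives *)

Section RealDerivatives.
Variable R : realType.

Lemma is_derive_quadratic (h : R -> R) (l C r : R) : 0 < r ->
  (forall t, `|t| < r -> `|h t - h 0 - t * l| <= C * t ^+ 2) ->
  is_derive (0 : R) (1 : R) h l.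
Proof.
move=> r0 hq.
have hc : (fun t => t^-1 *: ((h \o shift 0) (t *: 1) - h 0)) @ 0^' --> l.
  apply/cvgrPdist_le => e e0.
  have C0 : 0 < `|C| + 1 by rewrite ltr_wpDl.
  near=> t.
  have t0 : t != 0 by near: t; exact: nbhs_dnbhs_neq.
  have tr : `|t| < r by near: t; apply: dnbhs0_lt.
  have tle : `|t| < e / (`|C| + 1) by near: t; apply: dnbhs0_lt; rewrite divr_gt0.
  rewrite /= /shift /= addr0 -[t *: 1]/(t * 1) mulr1 -[_ *: _]/(t^-1 * _).
  have -> : l - t^-1 * (h t - h 0) = - (t^-1 * (h t - h 0 - t * l)) by field.
  rewrite normrN normrM normfV ler_pdivrMl ?normr_gt0//.
  rewrite (le_trans (hq t tr))// (@le_trans _ _ ((`|C| + 1) * `|t| ^+ 2))//.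
    by rewrite real_normK ?num_real// ler_wpM2r ?sqr_ge0// ler_wpDr// ler_norm.
  rewrite expr2 mulrCA ler_wpM2l// mulrC -ler_pdivlMr//; exact: ltW.
apply: DeriveDef; first by apply/cvg_ex; exists l.
exact: cvg_lim hc.
Unshelve. all: by end_near.
Qed.

Lemma path_deriv_quadratic (g : R -> cplx R) (L : cplx R) (C r : R) : 0 < r ->
  (forall t, `|t| < r -> nm (g t - g 0 - ofreal t * L) <= C * t ^+ 2) ->
  path_deriv g L.
Proof.
move=> r0 h; split; apply: (is_derive_quadratic (C := C) r0) => t /h hC.
  by rewrite (le_trans _ hC)// (le_trans _ (Re_le_nm _))// !(ReD, ReN) ReZ.
by rewrite (le_trans _ hC)// (le_trans _ (Im_le_nm _))// !(ImD, ImN) ImZ.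
Qed.

Lemma is_derive_shift (h : R -> R) (t l : R) :
  is_derive (0 : R) (1 : R) (fun s => h (t + s)) l -> is_derive t (1 : R) h l.
Proof.
case=> dh e.
have E : (fun k => k^-1 *: (((fun s => h (t + s)) \o shift 0) (k *: 1) - h (t + 0)))
       = (fun k => k^-1 *: ((h \o shift t) (k *: 1) - h t)).
  by apply/funext => k; rewrite /= /shift /= !addr0 (addrC t).
move: dh e; rewrite /derivable /derive E => dh e; exact: DeriveDef.
Qed.

Lemma mvt_bound (h h' : R -> R) (C a b : R) : a <= b ->
  (forall t, a <= t <= b -> is_derive t (1 : R) h (h' t) /\ `|h' t| <= C) ->
  `|h b - h a| <= C * (b - a).
Proof.
move=> ab H.
have [||c cab ->] := @MVT_segment _ h h' a b ab.
- by move=> x; rewrite in_itv /= => /andP[/ltW ax /ltW xb]; apply: (H x _).1; rewrite ax.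
- apply: derivable_within_continuous => x; rewrite in_itv /= => xab.
  by have [[]] := H x xab.
rewrite normrM (ger0_norm (_ : 0 <= b - a)) ?subr_ge0// ler_wpM2r ?subr_ge0//.
by apply: (H c _).2; move: cab; rewrite in_itv.
Qed.

Lemma path_mvt (g dg : R -> cplx R) (C s : R) :
  (forall t, `|t| <= `|s| -> path_deriv (fun k => g (t + k)) (dg t) /\ nm (dg t) <= C) ->
  nm (g s - g 0) <= 2 * C * `|s|.
Proof.
move=> H.
have main (h h' : R -> R) : (forall t, `|t| <= `|s| -> is_derive t (1 : R) h (h' t) /\ `|h' t| <= C) ->
    `|h s - h 0| <= C * `|s|.
  move=> hh; have [s0|s0] := leP 0 s.
    rewrite -[X in C * X]subr0 (ger0_norm s0); apply: (mvt_bound s0) => t /andP[t0 ts].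
    by apply: hh; rewrite !ger0_norm.
  rewrite distrC (ltr0_norm s0) -[X in C * X]sub0r; apply: (mvt_bound (ltW s0)) => t /andP[t0 ts].
  by apply: hh; rewrite !ler0_norm ?lerN2// ltW.
rewrite (le_trans (nm_le_ReIm _))// -mulrA mulr_natl mulr2n lerD// ?(ReD, ImD, ReN, ImN).
  apply: (main (fun t => complex.Re (g t)) (fun t => complex.Re (dg t))) => t /H[[dr _] b].
  by split; [exact: is_derive_shift|exact: le_trans (Re_le_nm _) b].
apply: (main (fun t => complex.Im (g t)) (fun t => complex.Im (dg t))) => t /H[[_ dr] b].
by split; [exact: is_derive_shift|exact: le_trans (Im_le_nm _) b].
Qed.



(** The mean value theorem is applied along the four real coordinate directions
   in turn. *)
Lemma C1_lipschitz (V : set (C2 R)) (g : C2 R -> cplx R) : open_nbhs (0 : C2 R) V -> Ck_on V 1 g ->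
  exists C, \forall p \near (0 : C2 R), nm (g p - g 0) <= C * (nm p.1 + nm p.2).
Proof.
move=> [oV V0] [_ dg].
have loc v : exists (d : C2 R -> cplx R) (C e : R), [/\ 0 < e, 0 <= C &
    forall x y, nm x < e -> nm y < e ->
    path_deriv (fun t => g ((x, y) + ofreal t *: v)) (d (x, y)) /\ nm (d (x, y)) <= C].
  have [d [hd [cd _]]] := dg v; exists d, (nm (d 0) + 1).
  have n1 : \forall p \near (0 : C2 R), V p by exact: open_nbhs_nbhs.
  have n2 : \forall p \near (0 : C2 R), nm (d 0 - d p) < 1.
    have := cd 0 V0 => /(_ [set y | nm (d 0 - y) < 1]); apply.
    by apply/nbhs_nm; exists 1.
  have : \forall p \near (0 : C2 R), path_deriv (fun t => g (p + ofreal t *: v)) (d p) /\ nm (d p) <= nm (d 0) + 1.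
    apply: filterS2 n1 n2 => p Vp dp; split; first exact: hd.
    have := nm_dist (d p) (d 0) 0; rewrite !subr0 nmC => /le_trans; apply.
    by rewrite addrC lerD2l ltW.
  case/near0_C2 => e e0 h; exists e; split => //.
  by rewrite addr_ge0 ?nm_ge0.
have [d1 [K1 [e1 [e10 K10 h1]]]] := loc (1, 0).
have [d2 [K2 [e2 [e20 K20 h2]]]] := loc ('i, 0).
have [d3 [K3 [e3 [e30 K30 h3]]]] := loc (0, 1).
have [d4 [K4 [e4 [e40 K40 h4]]]] := loc (0, 'i).
pose e := Num.min (Num.min e1 e2) (Num.min e3 e4).
have e0 : 0 < e by rewrite !lt_min e10 e20 e30.
have le1 : e <= e1 by rewrite /e !ge_min lexx.
have le2 : e <= e2 by rewrite /e !ge_min lexx orbT.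
have le3 : e <= e3 by rewrite /e !ge_min lexx !orbT.
have le4 : e <= e4 by rewrite /e !ge_min lexx !orbT.
exists (2 * (K1 + K2 + K3 + K4)); apply/near0_C2; exists (e / 2); first by rewrite divr_gt0.
move=> x y hx hy /=.
have segment (d : C2 R -> cplx R) (C eps : R) (x0 y0 : cplx R) (v : C2 R) (s : R) : e <= eps ->
    (forall x y, nm x < eps -> nm y < eps ->
    path_deriv (fun t => g ((x, y) + ofreal t *: v)) (d (x, y)) /\ nm (d (x, y)) <= C) ->
    (forall t, `|t| <= `|s| -> nm (x0 + ofreal t * v.1) < e /\ nm (y0 + ofreal t * v.2) < e) ->
    nm (g (x0 + ofreal s * v.1, y0 + ofreal s * v.2) - g (x0, y0)) <= 2 * C * `|s|.
  move=> lee hd hb.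
  have := @path_mvt (fun t => g (x0 + ofreal t * v.1, y0 + ofreal t * v.2))
    (fun t => d (x0 + ofreal t * v.1, y0 + ofreal t * v.2)) C s.
  rewrite -[ofreal 0]/(0 : cplx R) !mul0r !addr0; apply=> t /hb[b1 b2].
  have [p1 p2] := hd _ _ (lt_le_trans b1 lee) (lt_le_trans b2 lee).
  split => //; move: p1; congr (path_deriv _ _); apply/funext => k; congr (g _).
  by rewrite ofrealD !mulrDl !addrA.
have Rx := Re_le_nm x; have Ix := Im_le_nm x; have Ry := Re_le_nm y; have Iy := Im_le_nm y.
have small z a b : nm z < e / 2 -> `|a| <= `|complex.Re z| -> `|b| <= `|complex.Im z| ->
    nm (ofreal a + ofreal b * 'i) < e.
  move=> hz ha hb; rewrite (le_lt_trans (nmD _ _))// nmM nmi mulr1 !nm_ofreal.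
  by have := Re_le_nm z; have := Im_le_nm z; lra.
have z0 : nm (0 : cplx R) < e by rewrite nm0.
have xE : x = ofreal (complex.Re x) + ofreal (complex.Im x) * 'i by rewrite {1}(complexE x) (mulrC 'i).
have yE : y = ofreal (complex.Re y) + ofreal (complex.Im y) * 'i by rewrite {1}(complexE y) (mulrC 'i).
have o0 : ofreal 0 = 0 :> cplx R by [].
have s1 := segment d1 K1 e1 0 0 (1, 0) (complex.Re x) le1 h1.
have s2 := segment d2 K2 e2 (ofreal (complex.Re x)) 0 ('i, 0) (complex.Im x) le2 h2.
have s3 := segment d3 K3 e3 x 0 (0, 1) (complex.Re y) le3 h3.
have s4 := segment d4 K4 e4 x (ofreal (complex.Re y)) (0, 'i) (complex.Im y) le4 h4.
rewrite /= !(mulr0, mulr1, addr0, add0r) -?xE -?yE in s1 s2 s3 s4.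
have xe : nm x < e by rewrite (lt_trans hx)//; lra.
have {}s1 : nm (g (ofreal (complex.Re x), 0) - g (0, 0)) <= 2 * K1 * `|complex.Re x|.
  apply: s1 => t ht; rewrite !(mulr0, mulr1, addr0, add0r); split => //.
  by have := small x t 0 hx ht; rewrite o0 mul0r addr0; apply; rewrite normr0.
have {}s2 : nm (g (x, 0) - g (ofreal (complex.Re x), 0)) <= 2 * K2 * `|complex.Im x|.
  apply: s2 => t ht; rewrite !(mulr0, mulr1, addr0, add0r); split => //.
  exact: (small x _ _ hx (lexx _) ht).
have {}s3 : nm (g (x, ofreal (complex.Re y)) - g (x, 0)) <= 2 * K3 * `|complex.Re y|.
  apply: s3 => t ht; rewrite !(mulr0, mulr1, addr0, add0r); split => //.
  by have := small y t 0 hy ht; rewrite o0 mul0r addr0; apply; rewrite normr0.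
have {}s4 : nm (g (x, y) - g (x, ofreal (complex.Re y))) <= 2 * K4 * `|complex.Im y|.
  apply: s4 => t ht; rewrite !(mulr0, mulr1, addr0, add0r); split => //.
  exact: (small y _ _ hy (lexx _) ht).
rewrite -[g 0]/(g (0, 0)).
have t1 := nm_dist (g (x, y)) (g (x, ofreal (complex.Re y))) (g (0, 0)).
have t2 := nm_dist (g (x, ofreal (complex.Re y))) (g (x, 0)) (g (0, 0)).
have t3 := nm_dist (g (x, 0)) (g (ofreal (complex.Re x), 0)) (g (0, 0)).
have a1 := normr_ge0 (complex.Re x); have a2 := normr_ge0 (complex.Im x).
have a3 := normr_ge0 (complex.Re y); have a4 := normr_ge0 (complex.Im y).
have m1 : K1 * `|complex.Re x| <= K1 * nm x by rewrite ler_wpM2l.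
have m2 : K2 * `|complex.Im x| <= K2 * nm x by rewrite ler_wpM2l.
have m3 : K3 * `|complex.Re y| <= K3 * nm y by rewrite ler_wpM2l.
have m4 : K4 * `|complex.Im y| <= K4 * nm y by rewrite ler_wpM2l.
have b1 : 0 <= K1 * nm y by rewrite mulr_ge0 ?nm_ge0.
have b2 : 0 <= K2 * nm y by rewrite mulr_ge0 ?nm_ge0.
have b3 : 0 <= K3 * nm x by rewrite mulr_ge0 ?nm_ge0.
have b4 : 0 <= K4 * nm x by rewrite mulr_ge0 ?nm_ge0.
move: s1 s2 s3 s4 t1 t2 t3 m1 m2 m3 m4 b1 b2 b3 b4.
by rewrite mulrDr !mulrDl -!mulrA; lra.
Qed.

End RealDerivatives.

(** * From a finite parametrization to the map (x, rho(x, y)) *)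

Section Parametrization.
Variable R : realType.
Implicit Types (a f rho : pser R) (F G phi : pser R * pser R) (M N : set (C2 R)).

Definition par phi (t : cplx R) : C2 R := mapeval phi (t, t^*).

(** The differential at 0 of the parametrization. *)
Definition dpar phi (v : cplx R) : C2 R :=
  (phi.1 1%N 0%N * v + phi.1 0%N 1%N * v^*, phi.2 1%N 0%N * v + phi.2 0%N 1%N * v^*).

Lemma conj_ofreal (t : R) : (ofreal t)^* = ofreal t.
Proof.
apply/CrealP; rewrite realE -[0]/(ofreal 0) !ofreal_le; exact: le_total.
Qed.

Lemma near_line (P : cplx R -> Prop) (v : cplx R) : (\forall z \near (0 : cplx R), P z) ->
  exists2 r : R, 0 < r & forall t, `|t| < r -> P (ofreal t * v).
Proof.
case/nbhs_nm => e e0 h; exists (e / (nm v + 1)).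
  by rewrite divr_gt0// ltr_wpDl ?nm_ge0.
move=> t; rewrite ltr_pdivlMr ?ltr_wpDl ?nm_ge0// => ht; apply: h.
rewrite sub0r nmN nmM nm_ofreal (le_lt_trans _ ht)// mulrDr mulr1 lerDl.
exact: normr_ge0.
Qed.

Lemma near_line_real (P : cplx R -> Prop) (v : cplx R) : (\forall z \near (0 : cplx R), P z) ->
  \forall t \near (0 : R), P (ofreal t * v).
Proof.
case/(near_line v) => r r0 h; apply/nbhs_ballP; exists r => //= t.
by rewrite -ball_normE /= sub0r normrN => /h.
Qed.

(** The second order remainder is uniform in t, so it serves both to
   differentiate curves and to compare them with their tangents. *)
Lemma pseval_line a v : convergent a -> a 0%N 0%N = 0 -> exists C r : R, 0 < r /\
  forall t, `|t| < r ->
    nm (pseval a (ofreal t * v) ((ofreal t * v)^*) -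
        ofreal t * (a 1%N 0%N * v + a 0%N 1%N * v^*)) <= C * t ^+ 2.
Proof.
move=> ca a0; have [C [r [r0 C0 h]]] := pseval_affine ca.
have [|d d0 hd] := near_line (P := fun z => nm z < r) v.
  by apply/nbhs_nm; exists r => // y; rewrite sub0r nmN.
exists (C * (2 * nm v) ^+ 2), d; split => // t /hd ht.
have := h (ofreal t * v) ((ofreal t * v)^*); rewrite nm_conj => /(_ ht ht).
rewrite a0 add0r rmorphM /= conj_ofreal.
have -> : nm (ofreal t * v) + nm (ofreal t * v) = 2 * nm v * `|t|.
  by rewrite nmM nm_ofreal; ring.
rewrite exprMn real_normK ?num_real// mulrA; congr (nm (_ - _) <= _); ring.
Qed.

Lemma tangent_par phi N v : holo_germ phi ->
  (\forall t \near (0 : cplx R), N (par phi t)) -> tangent N 0 (dpar phi v).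
Proof.
move=> [c1 c2 [f1 f2]] hN; exists (fun t : R => par phi (ofreal t * v)).
have p0 a : convergent a -> a 0%N 0%N = 0 -> pseval a (ofreal 0 * v) ((ofreal 0 * v)^*) = 0.
  by move=> ca a0; rewrite -[ofreal 0]/(0 : cplx R) mul0r conjC0 pseval00.
split.
- by rewrite /par /mapeval /= !p0.
- exact: near_line_real hN.
- have [C [r [r0 h]]] := pseval_line v c1 f1.
  by apply: (path_deriv_quadratic (C := C) r0) => t /h; rewrite /par /mapeval /= p0// subr0.
- have [C [r [r0 h]]] := pseval_line v c2 f2.
  by apply: (path_deriv_quadratic (C := C) r0) => t /h; rewrite /par /mapeval /= p0// subr0.
Qed.

(** A complex vector annihilated by the complexified differential would give a
   complex line inside the tangent plane. *)
Lemma totally_real_jac phi N : holo_germ phi ->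
  (forall v, dpar phi v = 0 -> v = 0) ->
  (\forall t \near (0 : cplx R), N (par phi t)) -> totally_real_germ N -> jac phi != 0.
Proof.
move=> hphi imm hN tr; have [c1 c2 [f1 f2]] := hphi; apply/negP => /eqP j0.
have N0 : N 0.
  have := nbhs_singleton hN; rewrite /par /mapeval /= conjC0 !pseval00//.
  by rewrite f1 f2.
have T0 := nbhs_singleton tr N0.
set A1 := phi.1 1%N 0%N in imm j0; set B1 := phi.1 0%N 1%N in imm j0.
set A2 := phi.2 1%N 0%N in imm j0; set B2 := phi.2 0%N 1%N in imm j0.
rewrite /jac -/A1 -/B1 -/A2 -/B2 in j0.
have [x [y [e1 e2 xy]]] : exists x y : cplx R, [/\ A1 * x + B1 * y = 0, A2 * x + B2 * y = 0 &
    x = 0 -> y = 0 -> False].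
  have [B10|B10] := eqVneq B1 0; last first.
    exists B1, (- A1); split; [by ring| |by move=> b0; rewrite b0 eqxx in B10].
    by rewrite -[RHS]oppr0 -j0; ring.
  have [A10|A10] := eqVneq A1 0; last first.
    exists B1, (- A1); split; [by ring| |].
      by rewrite -[RHS]oppr0 -j0; ring.
    by move=> _ /eqP; rewrite oppr_eq0 => /eqP a0; rewrite a0 eqxx in A10.
  have [B20|B20] := eqVneq B2 0; last first.
    exists B2, (- A2); split; [by rewrite A10 B10 !mul0r addr0|by ring|].
    by move=> b0; rewrite b0 eqxx in B20.
  exists 0, 1; split; [by rewrite B10 mulr0 mul0r addr0|by rewrite B20 mulr0 mul0r addr0|].
  by move=> _ /eqP; rewrite oner_eq0.
(* Since (x, y) is in the kernel, the image of v is i times that of w. *)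
pose v := x + y^*; pose w := 'i * (x - y^*).
have vc : v^* = x^* + y by rewrite /v rmorphD /= conjCK.
have wc : w^* = - ('i * (x^* - y)) by rewrite /w rmorphM rmorphB /= conjCK conjCi mulNr.
have ii (z : cplx R) : 'i * ('i * z) = - z by rewrite mulrA -expr2 sqrCi mulN1r.
have key (a b : cplx R) : a * x + b * y = 0 -> a * v + b * v^* = 'i * (a * w + b * w^*).
  move=> h; rewrite vc wc /v /w (_ : 'i * _ = a * ('i * ('i * (x - y^*))) - b * ('i * ('i * (x^* - y)))); last by ring.
  rewrite !ii; apply/subr0_eq; transitivity (2 * (a * x + b * y)); first by ring.
  by rewrite h mulr0.
have dvw : dpar phi v = 'i *: dpar phi w.
  by rewrite /dpar /GRing.scale /= -/A1 -/B1 -/A2 -/B2 (key _ _ e1) (key _ _ e2).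
have dv0 : dpar phi v = 0.
  have : (tangent N 0 `&` [set 'i *: v | v in tangent N 0]) (dpar phi v).
    split; first exact: tangent_par.
    by exists (dpar phi w); [exact: tangent_par|rewrite dvw].
  by rewrite T0.
have dw0 : dpar phi w = 0.
  have : 'i *: ('i *: dpar phi w) = 0 by rewrite -dvw dv0 scaler0.
  by rewrite scalerA -expr2 sqrCi scaleN1r => /eqP; rewrite oppr_eq0 => /eqP.
have v0 := imm _ dv0.
have /eqP := imm _ dw0; rewrite /w mulf_eq0 (negbTE (neq0Ci _)) /= => /eqP u0.
have x0 : x = 0.
  have : 2 * x = v + (x - y^*) by rewrite /v; ring.
  by rewrite v0 u0 addr0 => /eqP; rewrite mulf_eq0 pnatr_eq0 => /eqP.
apply: xy => //; move: u0; rewrite x0 sub0r => /eqP.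
by rewrite oppr_eq0 conjC_eq0 => /eqP.
Qed.

(** The two linear coefficients A and B of f have the same modulus, so - A / B,
   which has modulus 1, is of the form vbar / v. *)
Lemma jac_conj_kernel f : jac (f, psconj f) = 0 ->
  exists2 v, v != 0 & f 1%N 0%N * v + f 0%N 1%N * v^* = 0.
Proof.
rewrite /jac /= /psconj; set A := f 1%N 0%N; set B := f 0%N 1%N => /subr0_eq j0.
have [B0|B0] := eqVneq B 0.
  exists 1; first exact: oner_neq0.
  move: j0; rewrite B0 !mul0r addr0 => /eqP; rewrite mulf_eq0 conjC_eq0 orbb => /eqP ->.
  by rewrite mul0r.
pose u := - A / B.
have Bu : B * u = - A by rewrite /u mulrC divfK.
have uu : u * u^* = 1.
  rewrite /u rmorphM fmorphV rmorphN /= mulrACA mulrNN j0 -invfM divff//.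
  by rewrite mulf_neq0 ?conjC_eq0.
have [u1|u1] := eqVneq u (-1).
  exists 'i; first exact: neq0Ci.
  by rewrite conjCi mulrN -mulNr -mulrDl -mulrN1 -u1 Bu subrr mul0r.
exists (1 + u^*).
  by rewrite -conjC_eq0 rmorphD /= conjCK rmorph1 addrC addr_eq0.
rewrite rmorphD /= conjCK rmorph1 !mulrDr mulr1 Bu.
have -> : B * 1 = A * - u^* by rewrite mulrN -mulNr -Bu -mulrA uu.
by ring.
Qed.

(** The inverse of a diffeomorphism is Lipschitz at 0, hence a direction in which
   the image is stationary is one in which the parametrization is. *)
Lemma diffeo_kernel phi f g (Gs : C2 R -> C2 R) V v : holo_germ phi ->
  convergent f -> f 0%N 0%N = 0 -> convergent g -> vanishes2 g ->
  open_nbhs (0 : C2 R) V -> smooth_on V Gs ->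
  (\forall t \near (0 : cplx R), Gs (pseval f t (t^*), pseval g t (t^*)) = par phi t) ->
  f 1%N 0%N * v + f 0%N 1%N * v^* = 0 -> dpar phi v = 0.
Proof.
move=> hphi cf f00 cg g2 hV sG GE fv; have [c1 c2 [p1 p2]] := hphi.
have hfg : holo_germ (f, g) by split => //; split => //; exact: g2.
have G0 : Gs 0 = 0.
  have := nbhs_singleton GE; rewrite /par /mapeval /= conjC0 !pseval00// f00 p1 p2.
  by rewrite (g2 0%N 0%N).
suff main a (h : C2 R -> cplx R) : convergent a -> a 0%N 0%N = 0 -> Ck_on V 1 h -> h 0 = 0 ->
    (\forall t \near (0 : cplx R), h (pseval f t (t^*), pseval g t (t^*)) = pseval a t (t^*)) ->
    a 1%N 0%N * v + a 0%N 1%N * v^* = 0.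
  have [s1 s2] := sG 1%N; rewrite /dpar.
  rewrite (main _ _ c1 p1 s1) ?(main _ _ c2 p2 s2) ?G0//.
    by apply: filterS GE => t ->.
  by apply: filterS GE => t ->.
move=> ca a0 hC h0 hE; set L := _ + _.
have [C lipC] := C1_lipschitz hV hC.
have [r1 r10 hr1] := near_line v hE.
have [r2 r20 hr2] := near_line v (near_conj (near_mapeval hfg lipC)).
have [Ka [r3 [r30 hr3]]] := pseval_line v ca a0.
have [Kf [r4 [r40 hr4]]] := pseval_line v cf f00.
have g00 : g 0%N 0%N = 0 by exact: g2.
have [Kg [r5 [r50 hr5]]] := pseval_line v cg g00.
pose r := Num.min (Num.min r1 (Num.min r2 r3)) (Num.min r4 r5).
have r0 : 0 < r by rewrite !lt_min r10 r20 r30 r40 r50.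
pose K := `|Ka| + `|C| * (`|Kf| + `|Kg|).
have K0 : 0 <= K by rewrite !addr_ge0 ?mulr_ge0 ?addr_ge0.
have step t : 0 < t -> t < r -> nm L <= K * t.
  move=> t0; have tE : `|t| = t by rewrite gtr0_norm.
  rewrite !lt_min -tE => /andP[/andP[/hr1 e1 /andP[/hr2 e2 /hr3 e3]] /andP[/hr4 e4 /hr5 e5]].
  have {}e4 : nm (pseval f (ofreal t * v) ((ofreal t * v)^*)) <= Kf * t ^+ 2.
    by move: e4; rewrite fv mulr0 subr0.
  have {}e5 : nm (pseval g (ofreal t * v) ((ofreal t * v)^*)) <= Kg * t ^+ 2.
    by move: e5; rewrite (g2 1%N 0%N)// (g2 0%N 1%N)// !mul0r addr0 mulr0 subr0.
  move: e2; rewrite /mapeval /= e1 h0 subr0 => e2.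
  have e6 : nm (ofreal t * L) <= K * t ^+ 2.
    rewrite -[ofreal t * L](subKr (pseval a (ofreal t * v) ((ofreal t * v)^*))).
    rewrite (le_trans (nmB _ _))// /K mulrDl addrC lerD//.
      by rewrite (le_trans e3)// ler_wpM2r ?sqr_ge0// ler_norm.
    rewrite (le_trans e2)// -mulrA.
    have Z0 : 0 <= (`|Kf| + `|Kg|) * t ^+ 2 by rewrite mulr_ge0 ?addr_ge0 ?sqr_ge0.
    apply: le_trans (ler_wpM2r _ (ler_norm C)) _; first by rewrite addr_ge0 ?nm_ge0.
    rewrite ler_wpM2l// mulrDl lerD//.
      by rewrite (le_trans e4)// ler_wpM2r ?sqr_ge0// ler_norm.
    by rewrite (le_trans e5)// ler_wpM2r ?sqr_ge0// ler_norm.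
  move: e6; rewrite nmM nm_ofreal tE expr2 mulrCA [_ * nm L]mulrC mulrC.
  by rewrite ler_pM2l.
apply: nm_eq0; apply/eqP; rewrite eq_le nm_ge0 andbT; apply/ler_addgt0Pr => e e0; rewrite add0r.
pose t := Num.min (r / 2) (e / (K + 1)).
have t0 : 0 < t by rewrite lt_min !divr_gt0// ltr_wpDl.
have tr : t < r by rewrite gt_min ltr_pdivrMr// mulr_natr mulr2n ltrDl r0.
have tle : t * (K + 1) <= e by rewrite -ler_pdivlMr ?ltr_wpDl// ge_min lexx orbT.
rewrite (le_trans (step t t0 tr))// (le_trans _ tle)// mulrC ler_pM2l//; lra.
Qed.

Lemma nbhs_open_par (U : set (C2 R)) phi : holo_germ phi -> open_nbhs (0 : C2 R) U ->
  \forall t \near (0 : cplx R), U (par phi t).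
Proof. by move=> hphi /open_nbhs_nbhs hU; exact: near_conj (near_mapeval hphi hU). Qed.

(** Both the parametrization of N and its image under F, complexified, are local
   biholomorphisms, and they transform F into (x, rho(x, y)). *)
Theorem finite_parametrization_normal_form N F M rho :
  convergent rho -> vanishes2 rho -> germ_eq M (graph rho) ->
  finite_parametrization N F M ->
  exists T T', inverse_germs T T' /\ mcomp F T = (monom R 1 0, rho).
Proof.
move=> cr r2 gM [[phi /= [hphi imm [V [U [psi [oV oU parE _ _]]]]]] tr hF _ dF].
case: dF => U' [V' [Gs [oU' oV' imE GF sG]]].
have hN : \forall t \near (0 : cplx R), N (par phi t).
  apply: filterS (open_nbhs_nbhs oV) => t Vt.
  have : ([set mapeval phi (s, s^*) | s in V]) (par phi t) by exists t.
  by rewrite parE => -[].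
have imm' v : dpar phi v = 0 -> v = 0 by case=> e1 e2; exact: imm.
have jphi := totally_real_jac hphi imm' hN tr.
have [phi' phiphi'] := inverse_function hphi jphi.
have nFphi := near_mcomp hF hphi; have := holo_mcomp hF hphi.
case fE : (mcomp F phi) nFphi => [f g] nFphi hfg.
have [/= cf cg [/= f0 g0]] := hfg.
have fc : fixes0 (f, psconj f) by split => //=; rewrite /psconj f0 conjC0.
have ccf := convergent_psconj cf.
have hU' := nbhs_open_par hphi oU'.
have n2 := near_conj nFphi.
have hM : \forall t \near (0 : cplx R), M (mapeval F (par phi t)).
  apply: filterS2 hN hU' => t Nt Ut.
  have : (mapeval F @` (N `&` U')) (mapeval F (par phi t)) by exists (par phi t).
  by rewrite imE => -[].
have gE : g = pscomp rho f (psconj f).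
  apply: pser_eq_conj => //; first exact: convergent_pscomp.
  have h1 := near_conj (near_pseval_pscomp cr cf ccf fc).
  have h2 := near_conj (near_pseval_psconj cf).
  have h3 := near_conj (near_mapeval hfg gM).
  have h4 : \forall t \near (0 : cplx R), M (mapeval (f, g) (t, t^*)).
    by apply: filterS2 n2 hM => t ->.
  have h5 : \forall t \near (0 : cplx R), pseval g t (t^*) = pseval rho (pseval f t (t^*)) (pseval f t (t^*))^*.
    by apply: filterS2 h3 h4 => t e3 /e3.
  by apply: filterS3 h1 h2 h5 => t /= -> -> ->; rewrite conjCK.
have g2 : vanishes2 g.
  move=> i j ij; rewrite gE; have [i0|n1] := posnP (i + j).
    by move: i0 => /eqP; rewrite addn_eq0 => /andP[/eqP-> /eqP->]; rewrite pscomp00 ?r2//; case: fc.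
  rewrite (pscomp_linear_coef _ fc); last by lia.
  by rewrite !r2// !mul0r addr0.
pose chi := (f, psconj f).
have hchi : holo_germ chi by split.
have jchi : jac chi != 0.
  apply/negP => /eqP /jac_conj_kernel[v v0 fv].
  move: v0; rewrite (imm' v) ?eqxx//.
  apply: (diffeo_kernel hphi cf f0 cg g2 oV' sG _ fv).
  near=> t.
  rewrite -[(pseval _ _ _, _)]/(mapeval (f, g) (t, t^*)) (near n2 t)//; apply: GF.
    by near: t.
  by near: t.
have [chi' chichi'] := inverse_function hchi jchi.
exists (mcomp phi chi'), (mcomp chi phi').
have inv := inverse_mcomp phiphi' (inverse_germs_sym chichi').
split; first exact: inv.
have [hT _ _ _] := inv; have [_ hchi' _ chiK] := chichi'.
have hX := holo_graph cr r2.
apply: pser_mapeval_eq; [exact: holo_mcomp|exact: hX|].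
have n1 := near_mcomp hF hT.
have n5 := near_mcomp hphi hchi'.
have n3 := near_mapeval hchi' nFphi.
have n4 := near_mapeval hchi' (near_pseval_pscomp cr cf ccf fc).
have n6 : \forall p \near (0 : C2 R),
    mapeval (mcomp F (mcomp phi chi')) p = mapeval (f, g) (mapeval chi' p).
  by apply: filterS3 n1 n5 n3 => p -> -> ->.
have n7 : \forall p \near (0 : C2 R), mapeval (f, g) (mapeval chi' p) = mapeval (monom R 1 0, rho) p.
  apply: filterS2 n4 chiK => p e k; rewrite -[in RHS]k.
  by rewrite {1}/mapeval /= gE e /chi /mapeval /= pseval_monom expr1 expr0 mulr1.
by apply: filterS2 n6 n7 => p ->.
Unshelve. all: by end_near.
Qed.

End Parametrization.

(** * The parametrization by {w = zbar} *)

Section AntiDiagonal.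
Variable R : realType.
Implicit Types (rho : pser R) (M : set (C2 R)).

Definition antidiag : set (C2 R) := [set p | p.2 = p.1^*].

Lemma Re_conj (z : cplx R) : complex.Re (z^*) = complex.Re z.
Proof. by case: z. Qed.

Lemma Im_conj (z : cplx R) : complex.Im (z^*) = - complex.Im z.
Proof. by case: z. Qed.

Lemma conj_continuous : continuous (fun z : cplx R => z^*).
Proof.
move=> z A /nbhs_nm[e e0 h]; apply/nbhs_nm; exists e => // y hy; apply: h.
by rewrite -rmorphB nm_conj.
Qed.

Lemma path_deriv_conj (g : R -> cplx R) v : path_deriv g v -> path_deriv (fun t => (g t)^*) (v^*).
Proof.
case=> d1 d2; split.
  by rewrite Re_conj; under eq_fun do rewrite Re_conj.
rewrite Im_conj; under eq_fun do rewrite Im_conj.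
exact: is_deriveN.
Qed.

Lemma path_deriv_uniq (g h : R -> cplx R) v w : path_deriv g v -> path_deriv h w ->
  (\forall t \near (0 : R), g t = h t) -> v = w.
Proof.
move=> [d1 d2] [e1 e2] gh.
have u (k l : R -> R) (a b : R) : is_derive (0 : R) (1 : R) k a -> is_derive (0 : R) (1 : R) l b ->
    (\forall t \near (0 : R), k t = l t) -> a = b.
  by move=> [_ <-] [_ <-] kl; exact: near_eq_derive.
rewrite (complexE v) (complexE w); congr (ofreal _ + 'i * ofreal _).
  by apply: (u _ _ _ _ d1 e1); apply: filterS gh => t ->.
by apply: (u _ _ _ _ d2 e2); apply: filterS gh => t ->.
Qed.

Lemma path_deriv_affine (a v : cplx R) : path_deriv (fun t => a + ofreal t * v) v.
Proof.
apply: (@path_deriv_quadratic _ _ _ 0 1) => // t _.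
by rewrite -[ofreal 0]/(0 : cplx R) mul0r addr0 (addrC a) addrK subrr nm0 mul0r.
Qed.

Lemma path_deriv_cst (a : cplx R) : path_deriv (fun=> a) 0.
Proof.
by have := path_deriv_affine a 0; congr (path_deriv _ _); apply/funext => t; rewrite mulr0 addr0.
Qed.

Lemma tangent_antidiag p v : tangent antidiag p v -> v.2 = v.1^*.
Proof.
case=> g [_ gN d1 d2]; exact: path_deriv_uniq d2 (path_deriv_conj d1) gN.
Qed.

(** Tangent vectors satisfy w = zbar, an equation that multiplication by i
   turns into w = - zbar. *)
Lemma antidiag_totally_real : totally_real_germ antidiag.
Proof.
apply: (@filterE _ (nbhs (0 : C2 R))) => p Np; apply/seteqP; split => [v [/tangent_antidiag v2 [w /tangent_antidiag w2 e]]|v ->].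
  move: v2; rewrite -e /= w2 -[_ *: _]/('i * _) -[_ *: w.1]/('i * _) rmorphM /= conjCi mulNr.
  move=> /eqP; rewrite -subr_eq0 opprK -mulr2n -mulr_natl mulf_eq0 pnatr_eq0 /= mulf_eq0.
  rewrite (negbTE (neq0Ci _)) /= conjC_eq0 => /eqP w10.
  by move: w2; rewrite w10 conjC0; case: (w) w10 => a b /= -> ->; rewrite scaler0.
have t0 : tangent antidiag p 0.
  exists (fun=> p); split => //; [|exact: path_deriv_cst..].
  exact: (@filterE _ (nbhs (0 : R))).

by split => //; exists 0 => //; rewrite scaler0.
Qed.

Lemma antidiag_surface : real_analytic_surface antidiag.
Proof.
exists (monom R 1 0, monom R 0 1); split; first exact: holo_id.
  by move=> v /=; rewrite /monom /= mul1r mul0r addr0.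
exists setT, setT, fst; split.
- by split; [exact: openT|].
- by split; [exact: openT|].
- apply/seteqP; split => [p [t _ <-]|[x y] [xy _]]; first by rewrite mapeval_id.
  by exists x => //; rewrite mapeval_id; move: xy; rewrite /antidiag /= => ->.
- by move=> t _; rewrite mapeval_id.
- by apply: continuous_subspaceT => p; exact: cvg_fst.
Qed.

Lemma Ck_cst V k (c : cplx R) : Ck_on V k (fun _ : C2 R => c).
Proof.
elim: k c => [|k IH] c; split => //; try by move=> p _; exact: cvg_cst.
move=> v; exists (fun=> 0); split; last exact: IH.
by move=> p _; exact: path_deriv_cst.
Qed.

Lemma Ck_real_linear V k (g : C2 R -> cplx R) : continuous g ->
  (forall p v t, g (p + ofreal t *: v) = g p + ofreal t * g v) -> Ck_on V k g.
Proof.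
move=> cg lg; case: k => [|k]; split => //; try by move=> p _; exact: cg.
move=> v; exists (fun=> g v); split; last exact: Ck_cst.
by move=> p _; under eq_fun do rewrite lg; exact: path_deriv_affine.
Qed.

Lemma open_nm (d e : R) : 0 < d -> 0 < e ->
  open_nbhs (0 : C2 R) [set p | nm p.1 < d /\ nm p.2 < e].
Proof.
move=> d0 e0; split; last by rewrite /= nm0.
rewrite openE => p [/= pd pe]; apply/nbhs_C2.
exists (Num.min (d - nm p.1) (e - nm p.2)) => [|q]; first by rewrite lt_min !subr_gt0 pd.
rewrite !lt_min => /andP[h1 _] /andP[_ h2]; split => /=.
  by have := nm_dist q.1 p.1 0; rewrite !subr0 nmC; move: h1; lra.
by have := nm_dist q.2 p.2 0; rewrite !subr0 nmC; move: h2; lra.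
Qed.

Lemma antidiag_diffeo M rho : convergent rho -> vanishes2 rho -> germ_eq M (graph rho) ->
  diffeo_onto (monom R 1 0, rho) antidiag M.
Proof.
move=> cr r2 /near0_C2[e e0 he].
have r00 : rho 0%N 0%N = 0 by exact: r2.
have /near0_C2[e' e'0 he'] := pseval_lt cr r00 e0.
pose d := Num.min e e'; have d0 : 0 < d by rewrite lt_min e0.
exists [set p | nm p.1 < d /\ nm p.2 < d], [set p | nm p.1 < d /\ nm p.2 < e],
  (fun p => (p.1, p.1^*)); split.
- exact: open_nm.
- exact: open_nm.
- have val x : nm x < d -> nm (pseval rho x x^*) < e.
    by rewrite lt_min => /andP[_ xe']; apply: (he' x x^*); rewrite ?nm_conj.
  apply/seteqP; split => [_ [[x y] [Np [/= xd _]] <-]|[x u] [Mx [/= xd ue]]].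
    have -> : y = x^* := Np.
    rewrite mapeval_graph; split; last exact: (conj xd (val x xd)).
    have xe : nm x < e by move: xd; rewrite lt_min => /andP[].
    exact: ((he _ _ xe (val x xd)).2 erefl).
  have xe : nm x < e by move: xd; rewrite lt_min => /andP[].
  have := (he _ _ xe ue).1 Mx; rewrite /graph /= => uE; rewrite uE.
  by exists (x, x^*); rewrite ?mapeval_graph//; split => //; split => //=; rewrite nm_conj.
- by move=> [x y] Np _; have -> : y = x^* := Np; rewrite mapeval_graph.
- have lin1 (p v : C2 R) (t : R) : (p + ofreal t *: v).1 = p.1 + ofreal t * v.1 by [].
  move=> k; split; apply: Ck_real_linear.
  + by move=> p; exact: cvg_fst.
  + by [].
  + move=> p A /(conj_continuous (x := p.1))/nbhs_nm[r r0' hA].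
    by apply/nbhs_C2; exists r => // q q1 _; exact: hA.
  + by move=> p v t; rewrite lin1 rmorphD rmorphM /= conj_ofreal.
Qed.

(** On w = zbar the map (x, rho(x, y)) is z -> (z, rho(z, zbar)), whose inverse is
   the restriction of the real-linear map (z, w) -> (z, zbar). *)
Theorem antidiag_parametrization M rho : convergent rho -> vanishes2 rho ->
  germ_eq M (graph rho) -> (exists j, rho 0%N j != 0) ->
  finite_parametrization antidiag (monom R 1 0, rho) M.
Proof.
move=> cr r2 gM ex; split.
- exact: antidiag_surface.
- exact: antidiag_totally_real.
- exact: holo_graph.
- case: (ex_minnP ex) => k rk min; exists k; apply: mult0_graph => // j jk.
  by apply/eqP/negPn/negP => /min; rewrite leqNgt jk.
- exact: antidiag_diffeo.
Qed.

End AntiDiagonal.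

(** * Surfaces with rho(0, zbar) = 0 *)

Section Quadric.
Variable R : realType.
Implicit Types (a b c u v rho : pser R) (F G : pser R * pser R).

(** ** Series in (z, zw) *)

(** As z^i w^j = z^(i - j) (zw)^j, these are the series in z and zw; on w = zbar
   the second argument is the coordinate w of M0. *)
Definition lower a := forall i j, (i < j)%N -> a i j = 0.

Definition unlower a : pser R := fun i j => a (i + j)%N j.

Lemma lower_psmul a b : lower a -> lower b -> lower (psmul a b).
Proof.
move=> ha hb n m nm; rewrite /psmul big1// => -[k hk] _; rewrite big1// => -[l hl] _ /=.
have [h|h] := ltnP k l; first by rewrite ha// mul0r.
by rewrite hb ?mulr0//; lia.
Qed.

Lemma lower_monom p q : (q <= p)%N -> lower (monom R p q).
Proof. by move=> pq i j ij; rewrite /monom (_ : _ && _ = false)//; lia. Qed.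

Lemma lower_psexp a n : lower a -> lower (psexp a n).
Proof. by move=> h; elim: n => [|n IH]; [exact: lower_monom|exact: lower_psmul]. Qed.

Lemma psexp_monom p q n : psexp (monom R p q) n = monom R (p * n) (q * n).
Proof.
elim: n => [|n IH]; first by rewrite !muln0.
by rewrite !mulnS -psmul_monom_monom -IH.
Qed.

Lemma unlowerE a : lower a -> pscomp (unlower a) (monom R 1 0) (monom R 1 1) = a.
Proof.
move=> ha; apply: pserP => n m; rewrite /pscomp.
pose f i j := unlower a i j * psmul (psexp (monom R 1 0) i) (psexp (monom R 1 1) j) n m.
have fE i j : f i j = unlower a i j * ((n == i + j)%N && (m == j))%:R.
  by rewrite /f !psexp_monom psmul_monom_monom /monom !mul1n mul0n add0n.
rewrite -[LHS]/(\sum_(i < (n + m).+1) \sum_(j < (n + m).+1) f i j).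
have [mn|nm] := leqP m n; last first.
  rewrite ha// big1// => i _; rewrite big1// => j _; rewrite fE.
  by rewrite (_ : _ && _ = false) ?mulr0//; lia.
rewrite (@box_single _ _ _ f (n - m)%N m); [|lia|lia|].
  by rewrite fE subnK// !eqxx mulr1 /unlower subnK.
move=> i j hi hj; rewrite xpair_eqE fE => ij.
by rewrite (_ : _ && _ = false) ?mulr0//; lia.
Qed.

Lemma convergent_unlower a : convergent a -> convergent (unlower a).
Proof.
move=> /convergentP[s [K [s0 h]]].
pose t := Num.min 1 s; have t0 : 0 < t by rewrite lt_min ltr01.
have t1 : t <= 1 by rewrite ge_min lexx.
have ht : bnd t K a by apply: bndW h; rewrite ?(ltW t0)// ge_min lexx orbT.
apply: (@convergent_weight _ _ (t ^+ 2) K); first by rewrite exprn_gt0.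
move=> i j; apply: le_trans (bnd_coef (i + j) j (ltW t0) ht).
rewrite /weight /unlower ler_wpM2l ?nm_ge0// -exprM ler_wiXn2l// ?(ltW t0)//; lia.
Qed.

Lemma near_unlower a : convergent a -> lower a -> \forall p \near (0 : C2 R),
  pseval (unlower a) p.1 (p.1 * p.2) = pseval a p.1 p.2.
Proof.
move=> ca la; have cu := convergent_unlower ca.
have fx : fixes0 (monom R 1 0, monom R 1 1) by [].
have := near_pseval_pscomp cu (convergent_monom R 1 0) (convergent_monom R 1 1) fx.
rewrite (unlowerE la); apply: filterS => p e.
have e1 : pseval (monom R 1 0) p.1 p.2 = p.1 by rewrite pseval_monom expr0 expr1 mulr1.
have e2 : pseval (monom R 1 1) p.1 p.2 = p.1 * p.2 by rewrite pseval_monom !expr1.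
by rewrite e1 e2 in e; exact: esym e.
Qed.

(** ** Products and conjugates *)

Lemma psconj_psmul a b : psconj (psmul a b) = psmul (psconj a) (psconj b).
Proof.
apply: pserP => n m; rewrite /psconj /psmul exchange_big rmorph_sum /=.
apply: eq_bigr => i _; rewrite rmorph_sum; apply: eq_bigr => j _.
by rewrite rmorphM.
Qed.

Lemma psmulA a b c : convergent a -> convergent b -> convergent c ->
  psmul a (psmul b c) = psmul (psmul a b) c.
Proof.
move=> ca cb cc.
have h1 := near_pseval_psmul ca (convergent_psmul cb cc).
have h2 := near_pseval_psmul cb cc.
have h3 := near_pseval_psmul (convergent_psmul ca cb) cc.
have h4 := near_pseval_psmul ca cb.
have h5 : \forall p \near (0 : C2 R), pseval (psmul a (psmul b c)) p.1 p.2 =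
    pseval a p.1 p.2 * (pseval b p.1 p.2 * pseval c p.1 p.2).
  by apply: filterS2 h1 h2 => p -> ->.
apply: pser_eq; [exact/convergent_psmul/convergent_psmul|exact/convergent_psmul/cc/convergent_psmul|].
by apply: filterS3 h3 h4 h5 => p -> -> ->; rewrite mulrA.
Qed.

(** ** The fixed point equation *)

Definition upper_part a : pser R := fun i j => if (i < j)%N then a i j else 0.
Definition strictly_lower_part a : pser R := fun i j => if (j < i)%N then a i j else 0.

(** The unknown of the equation is A = 1 + X, with X strictly lower: the
   condition is that A A* (1 + k(zA, wA* )) is lower, and its strictly upper part
   is X* plus terms that are quadratic in X or involve k, hence are small.
   Solving for X* gives a fixed point equation. *)
Lemma flattening k : convergent k -> k 0%N 0%N = 0 -> exists X : pser R,
  let A := monom R 0 0 + X in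
  let alpha := psmul (monom R 1 0) A in
  [/\ convergent X, forall i j, (i <= j)%N -> X i j = 0 &
      lower (psmul (psmul A (psconj A)) (monom R 0 0 + pscomp k alpha (psconj alpha)))].
Proof.
move=> ck k0.
pose A (X : pser R) := monom R 0 0 + X.
pose alpha X := psmul (monom R 1 0) (A X).
pose K X := pscomp k (alpha X) (psconj (alpha X)).
pose Y X := psmul X (psconj X) + psmul (psmul (A X) (psconj (A X))) (K X).
pose T (X : unit -> pser R) (_ : unit) : pser R :=
  - psconj (upper_part (Y (strictly_lower_part (X tt)))).
have alpha0 X : alpha X 0%N 0%N = 0 by rewrite /alpha psmul_monom.
have falpha X : fixes0 (alpha X, psconj (alpha X)).
  by split => //=; rewrite /psconj alpha0 conjC0.
have K00 X : K X 0%N 0%N = 0 by have [? ?] := falpha X; rewrite /K pscomp00.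
have cT n X X' : (forall i, agree n (X i) (X' i)) -> forall i, agree n.+1 (T X i) (T X' i).
  move=> h i; apply/agreeN/agree_psconj.
  set x := strictly_lower_part (X tt); set x' := strictly_lower_part (X' tt).
  have hx : agree n x x' by move=> p q pq; rewrite /x /x' /strictly_lower_part (h tt).
  suff hY : agree n.+1 (Y x) (Y x') by move=> p q pq; rewrite /upper_part hY.
  have hxc := agree_psconj hx.
  have hA : agree n (A x) (A x') by apply: agreeD.
  have hAc := agree_psconj hA.
  have halpha : agree n.+1 (alpha x) (alpha x').
    by apply: (@agree_psmul_ord _ n.+1 1 0) => //; rewrite ?subn0 ?subn1//; exact: ordp1.
  have halphac := agree_psconj halpha.
  apply: agreeD.
    by apply: agree_psmulS => //; rewrite /psconj /x /x' /strictly_lower_part /= ?conjC0.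
  apply: (@agree_psmul_ord _ n.+1 0 1); rewrite ?subn0 ?subn1.
  - exact: agree_psmul.
  - exact: agree_pscomp.
  - exact: ordp1.
  - by [].
have [X [TX hb]] := causal_fix cT; set x := X tt.
have xE : x = - psconj (upper_part (Y (strictly_lower_part x))) by rewrite /x -{1}TX.
have xl i j : (i <= j)%N -> x i j = 0.
  by move=> ij; rewrite xE pserNE /psconj /upper_part ltnNge ij /= conjC0 oppr0.
have xp : strictly_lower_part x = x.
  apply: pserP => i j; rewrite /strictly_lower_part; case: ltnP => // ij.
  by rewrite xl.
rewrite xp in xE; exists x; split => /=.
- have [s [B [s0 hk]]] := (convergentP k).1 ck.
  have B0 := bnd_ge0 (ltW s0) hk.
  (* The norm 1/4 of X is preserved: 1/16 + (5/4)^2 / 10 <= 1/4. *)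
  pose tau := Num.min 1 (1 / (10 * (B + 1))).
  have B1 : 0 < 10 * (B + 1) by lra.
  have tau0 : 0 < tau by rewrite lt_min ltr01 divr_gt0.
  have tau1 : tau <= 1 by rewrite ge_min lexx.
  have tauB : tau * B <= 1 / 10.
    have : tau * (10 * (B + 1)) <= 1 by rewrite -ler_pdivlMr// ge_min lexx orbT.
    by have := tau0; lra.
  pose r := tau * s / 2; have r0 : 0 < r by rewrite divr_gt0// mulr_gt0.
  have r1 := ltW r0.
  apply/convergentP; exists r, (1 / 4); split => //.
  apply: (hb r (1 / 4)) => [|P hP i]; first by lra.
  have hx : bnd r (1 / 4) (strictly_lower_part (P tt)).
    apply: (bnd_dom r1 _ (hP tt)) => p q; rewrite /strictly_lower_part.
    by case: ifP => // _; rewrite nm0 nm_ge0.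
  set y := strictly_lower_part _ in hx *.
  have hy := bnd_psconj hx.
  have h1 : bnd r 1 (monom R 0 0) by have := bnd_monom 0 0 r1.
  have hA : bnd r (5 / 4) (A y).
    by apply: bndW (bndD r1 h1 hx) => //; lra.
  have hAc := bnd_psconj hA.
  have hm : bnd r r (monom R 1 0) by rewrite -{2}(expr1 r); exact: (bnd_monom 1 0 r1).
  have halpha : bnd r (tau * s) (alpha y).
    by apply: bndW (bnd_psmul r1 hm hA) => //; rewrite /r; have := mulr_gt0 tau0 s0; lra.
  have hk' : bnd (tau * s) (tau ^+ 1 * B) k.
    by apply: (bnd_small (ltW s0) _ (ordp1 k0) hk); rewrite (ltW tau0).
  have hK : bnd r (tau ^+ 1 * B) (K y).
    apply: (bnd_pscomp _ r1 hk' halpha (bnd_psconj halpha)).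
    by rewrite mulr_ge0 ?ltW.
  have hY : bnd r (1 / 4) (Y y).
    apply: bndW (bndD r1 (bnd_psmul r1 hx hy) (bnd_psmul r1 (bnd_psmul r1 hA hAc) hK)) => //.
    by rewrite expr1; lra.
  apply: (bndN r1 _); apply: bnd_psconj; apply: (bnd_dom r1 _ hY) => p q.
  by rewrite /upper_part; case: ifP => // _; rewrite nm0 nm_ge0.
- exact: xl.
- rewrite -/(A x) -/(alpha x) -/(K x) => i j ij.
  have add_psmul a b c : psmul a (b + c) = psmul a b + psmul a c.
    by have := psmulDr 1 b c a; rewrite !scale1r.
  have psmul_add a b c : psmul (b + c) a = psmul b a + psmul c a.
    by have := psmulDl 1 b c a; rewrite !scale1r.
  have psmulr1 a : psmul a (monom R 0 0) = a by rewrite psmulC psmul1.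
  have cA : psconj (A x) = monom R 0 0 + psconj x.
    by have := psconjD 1 (monom R 0 0) x; rewrite conjC1 !scale1r psconj_monom.
  have AA : psmul (A x) (psconj (A x)) = monom R 0 0 + psconj x + (x + psmul x (psconj x)).
    by rewrite cA /A psmul_add psmul1 add_psmul psmulr1.
  have -> : psmul (psmul (A x) (psconj (A x))) (monom R 0 0 + K x) =
      monom R 0 0 + psconj x + (x + psmul x (psconj x)) +
      psmul (psmul (A x) (psconj (A x))) (K x).
    by rewrite add_psmul psmulr1 -AA.
  have e : psconj x i j = - Y x i j.
    transitivity (((- psconj (upper_part (Y x))) j i)^*); first by rewrite -xE.
    by rewrite pserNE rmorphN /= /psconj conjCK /upper_part ij.
  rewrite !pserDE e /Y pserDE (xl i j (ltnW ij)).
  rewrite /monom (_ : _ && _ = false); last by lia.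
  by rewrite mulr0n !add0r -addrA addNr.
Qed.

(** ** The normal form *)

Lemma monom_psmulACA a b : convergent a -> convergent b ->
  psmul (psmul (monom R 1 0) a) (psmul (monom R 0 1) b) = psmul (monom R 1 1) (psmul a b).
Proof.
move=> ca cb; have cx := convergent_monom R 1 0; have cy := convergent_monom R 0 1.
have cyb := convergent_psmul cy cb; have cab := convergent_psmul ca cb.
rewrite -(psmulA cx ca cyb) (psmulA ca cy cb) (psmulC a) -(psmulA cy ca cb).
by rewrite (psmulA cx cy cab) psmul_monom_monom.
Qed.

(** Take alpha = zA with A given by flattening; then rho(alpha, alpha* ) is
   lower, so that alpha and rho(alpha, alpha* ) are functions of z and zw, the
   components of Phi. *)
Lemma quadric_parametrization rho : convergent rho -> vanishes2 rho ->
  (forall j, rho 0%N j = 0) -> rho 1%N 1%N != 0 -> exists alpha Phi,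
  [/\ convergent alpha /\ alpha 0%N 0%N = 0, jac (alpha, psconj alpha) != 0,
      holo_germ Phi, jac Phi != 0 & \forall p \near (0 : C2 R),
        mapeval Phi (p.1, p.1 * p.2) =
        (pseval alpha p.1 p.2, pseval rho (pseval alpha p.1 p.2) (pseval (psconj alpha) p.1 p.2))].
Proof.
move=> cr r2 r0; set be := rho 1%N 1%N => be0.
pose h : pser R := fun i j => be^-1 * rho i.+1 j.+1.
have ch : convergent h.
  have [s [K [s0 hr]]] := (convergentP rho).1 cr.
  apply: (@convergent_weight _ _ s (nm be^-1 * (K / s ^+ 2))) => // i j.
  rewrite /weight /h nmM -mulrA ler_wpM2l ?nm_ge0// ler_pdivlMr ?exprn_gt0//.
  rewrite -mulrA -exprD (_ : (i + j + 2)%N = (i.+1 + j.+1)%N); last by lia.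
  exact: bnd_coef (ltW s0) hr.
pose k := h - monom R 0 0.
have ck : convergent k by apply: convergentB => //; exact: convergent_monom.
have k0 : k 0%N 0%N = 0 by rewrite /k pserBE /h /monom /= mulVf// subrr.
pose g : pser R := fun i j => if j == 0%N then rho i 0%N else 0.
have rhoE : rho = g + be *: psmul (monom R 1 1) h.
  apply: pserP => i j; rewrite pserDE pserZE psmul_monom /g /h.
  case: i j => [|i] [|j] /=; rewrite ?r0 ?mulr0 ?addr0//.
  by rewrite add0r !subn1 /= mulVKf.
have [X /= [cX Xl]] := flattening ck k0.
set A := monom R 0 0 + X; set alpha := psmul (monom R 1 0) A; set C := psmul _ (_ + _) => lC.
have cA : convergent A by apply: convergent_add => //; exact: convergent_monom.
have lA : lower A.
  move=> i j ij; rewrite /A pserDE (lower_monom (leqnn 0) ij) add0r; apply: Xl; exact: ltnW.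
have calpha : convergent alpha by apply: convergent_psmul => //; exact: convergent_monom.
have lalpha : lower alpha by apply: lower_psmul => //; exact: lower_monom.
have al0 : alpha 0%N 0%N = 0 by rewrite /alpha psmul_monom.
have al10 : alpha 1%N 0%N = 1.
  by rewrite /alpha psmul_monom /= subnn /A pserDE Xl// addr0.
have al11 : alpha 1%N 1%N = 0.
  by rewrite /alpha psmul_monom /= subnn subn0 /A pserDE Xl// addr0.
have al01 : alpha 0%N 1%N = 0 by rewrite /alpha psmul_monom.
have fal : fixes0 (alpha, psconj alpha) by split => //=; rewrite /psconj al0 conjC0.
have ccal := convergent_psconj calpha; have ccA := convergent_psconj cA.
have chal : holo_germ (alpha, psconj alpha) by split.
pose S := pscomp rho alpha (psconj alpha).
have cS : convergent S by exact: convergent_pscomp.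
have SE : S = pscomp g alpha (psconj alpha) + be *: psmul (monom R 1 1) C.
  rewrite /S [in LHS]rhoE pscompD; congr (_ + _ *: _).
  rewrite (pscomp_psmul (convergent_monom R 1 1) ch chal) /=.
  rewrite pscomp_monom ?psexp1; [|by case: fal|by case: fal].
  have hE : pscomp h alpha (psconj alpha) = monom R 0 0 + pscomp k alpha (psconj alpha).
    have := pscompD (-1) h (monom R 0 0) alpha (psconj alpha).
    rewrite !scaleN1r -/k => ->; rewrite pscomp_monom ?psmul1; [|by case: fal|by case: fal].
    by rewrite -[psexp (psconj alpha) 0]/(monom R 0 0) addrC subrK.
  have aa : psmul alpha (psconj alpha) = psmul (monom R 1 1) (psmul A (psconj A)).
    by rewrite /alpha psconj_psmul psconj_monom; exact: monom_psmulACA.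
  rewrite hE aa.
  have c1 := convergent_add (convergent_monom R 0 0) (convergent_pscomp ck calpha ccal fal).
  by rewrite -(psmulA (convergent_monom R 1 1) (convergent_psmul cA ccA) c1).
have gE n m : pscomp g alpha (psconj alpha) n m =
    \sum_(i < (n + m).+1) rho i 0%N * psexp alpha i n m.
  have psmulr1 a : psmul a (psexp (psconj alpha) 0) = a by rewrite psmulC; exact: psmul1.
  rewrite /pscomp; apply: eq_bigr => i _; rewrite big_ord_recl [ord0 : nat]/= psmulr1.
  by rewrite big1 ?addr0// => j _; rewrite /g /= mul0r.
have lS : lower S.
  move=> i j ij; rewrite SE pserDE pserZE gE psmul_monom.
  rewrite big1 => [|l _]; last by rewrite (lower_psexp l lalpha) ?mulr0.
  rewrite add0r; case: ifP => ij1; last by rewrite mulr0.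
  by rewrite lC ?mulr0//; lia.
have al2 l m : (1 < l)%N -> psexp alpha l 1%N m = 0.
  case: l => [|[|l]] // _.
  have xo j : alpha 0%N j = 0 by rewrite /alpha psmul_monom.
  have z t : psexp alpha l.+1 0%N t = 0.
    by rewrite [LHS]psmul_row big1// => w _; rewrite xo mul0r.
  rewrite -[LHS]/(psmul alpha (psexp alpha l.+1) 1%N m).
  move: (psexp alpha l.+1) z => b z; rewrite /psmul big1// => -[[|[|p]] hp] _ //; rewrite big1// => q _ /=.
    by rewrite xo mul0r.
  by rewrite subnn z mulr0.
exists alpha, (unlower alpha, unlower S); split.
- by [].
- by rewrite /jac /= /psconj al10 al01 conjC1 conjC0 mulr1 mulr0 subr0 oner_eq0.
- split; [exact: convergent_unlower|exact: convergent_unlower|split => //=].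
  by rewrite /unlower /= /S pscomp00 ?r2//; case: fal.
- have g11 : pscomp g alpha (psconj alpha) 1%N 1%N = 0.
    rewrite gE big1// => -[[|[|l]] hl] _; last by rewrite al2 ?mulr0.
      by rewrite (r2 0%N 0%N)// mul0r.
    by rewrite (r2 1%N 0%N)// mul0r.
  have C00 : C 0%N 0%N = 1.
    have m00 : monom R 0 0 0%N 0%N = 1 by [].
    have A00 : A 0%N 0%N = 1 by rewrite /A pserDE Xl// addr0.
    have [? ?] := fal.
    rewrite /C psmul_row big_ord1 subnn pserDE pscomp00// k0 addr0 m00 mulr1.
    by rewrite psmul_row big_ord1 subnn /psconj A00 conjC1 mulr1.
  have S11 : S 1%N 1%N = be by rewrite SE pserDE pserZE g11 psmul_monom /= subnn C00 add0r mulr1.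
  by rewrite /jac /= /unlower /= al10 al11 mul0r subr0 mul1r S11.
have h1 := near_unlower calpha lalpha.
have h2 := near_unlower cS lS.
have h3 := near_pseval_pscomp cr calpha ccal fal.
by apply: filterS3 h1 h2 h3 => p e1 e2 e3; rewrite /mapeval /= e1 e2 /S e3.
Qed.

Lemma near_swap_conj (P : C2 R -> Prop) : (\forall p \near (0 : C2 R), P p) ->
  \forall p \near (0 : C2 R), P (p.2^*, p.1^*).
Proof. by case/near0_C2 => e e0 h; apply/near0_C2; exists e => // x y hx hy; apply: h; rewrite nm_conj. Qed.

Lemma near_fst (P : cplx R -> Prop) : (\forall z \near (0 : cplx R), P z) ->
  \forall p \near (0 : C2 R), P p.1.
Proof.
case/nbhs_nm => e e0 h; apply/near0_C2; exists e => // x y hx _.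
by apply: h; rewrite sub0r nmN.
Qed.

(** The equation alpha(Z, Zbar) = x can be solved for Z: the inverse of the
   complexified map commutes with the conjugation (z, w) -> (wbar, zbar), so it
   preserves the set w = zbar. *)
Lemma real_inverse alpha : convergent alpha -> alpha 0%N 0%N = 0 ->
  jac (alpha, psconj alpha) != 0 -> exists G, holo_germ G /\
  \forall x \near (0 : cplx R), (mapeval G (x, x^*)).2 = (mapeval G (x, x^*)).1^* /\
     pseval alpha (mapeval G (x, x^*)).1 (mapeval G (x, x^*)).2 = x.
Proof.
move=> ca a0 ja.
have hchi : holo_germ (alpha, psconj alpha).
  by split; [exact: ca|exact: convergent_psconj|split => //=; rewrite /psconj a0 conjC0].
have [G [_ hG Gchi chiG]] := inverse_function hchi ja; exists G; split => //.
have h1 := near_pseval_psconj ca.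
have sym : \forall q \near (0 : C2 R), mapeval (alpha, psconj alpha) (q.2^*, q.1^*) =
    ((mapeval (alpha, psconj alpha) q).2^*, (mapeval (alpha, psconj alpha) q).1^*).
  by apply: filterS2 h1 (near_swap_conj h1) => q e1 e2; rewrite /mapeval /= e2 e1 !conjCK.
have k1 := near_conj (near_mapeval hG sym).
have k2 := near_conj chiG.
have k3 := near_conj (near_mapeval hG (near_swap_conj Gchi)).
apply: filterS3 k1 k2 k3 => x e1 e2 e3.
move: e3; rewrite e1 e2 -[(x, x^*).2]/(x^*) -[(x, x^*).1]/x conjCK => e3.
by split; [exact: (congr1 (fun q : C2 R => q.2) e3)|exact: (congr1 (fun q : C2 R => q.1) e2)].
Qed.

(** Phi maps M0 into M by construction. It maps onto M near 0 because
   alpha(Z, Zbar) = z can be solved for Z; the inverse of Phi is the required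
   map. *)
Theorem biholo_equiv_M0 (M : set (C2 R)) rho : convergent rho -> vanishes2 rho ->
  germ_eq M (graph rho) -> (forall j, rho 0%N j = 0) -> rho 1%N 1%N != 0 ->
  biholo_equiv M (M0 R).
Proof.
move=> cr r2 gM r0 r11.
have [alpha [Phi [[ca a0] ja hPhi jPhi PhiE]]] := quadric_parametrization cr r2 r0 r11.
have [F [_ hF FPhi PhiF]] := inverse_function hPhi jPhi.
exists F; split.
  by split => //; exists Phi; split => //; apply: filterS2 FPhi PhiF => p.
have [G [hG GE]] := real_inverse ca a0 ja.
have cj : \forall z \near (0 : cplx R), pseval (psconj alpha) z z^* = (pseval alpha z z^*)^*.
  by have := near_conj (near_pseval_psconj ca); apply: filterS => z; rewrite conjCK.
have on_M : \forall z \near (0 : cplx R), mapeval Phi (z, z * z^*) =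
    (pseval alpha z z^*, pseval rho (pseval alpha z z^*) (pseval alpha z z^*)^*).
  apply: filterS2 cj (near_conj PhiE) => z e1 e2; apply: (etrans e2).
  exact: (congr1 (fun t => (pseval alpha z z^*, pseval rho (pseval alpha z z^*) t)) e1).
have M0_M : \forall q \near (0 : C2 R), M0 R q -> graph rho (mapeval Phi q).
  apply: filterS (near_fst on_M) => -[z w] e hw.
  have -> : w = z * z^* by move: hw; rewrite /M0 /= normCK.
  by rewrite (e : mapeval Phi (z, z * z^*) = _).
have hsq : holo_germ (monom R 1 0, monom R 1 1).
  by split; [exact: convergent_monom|exact: convergent_monom|].
have h1 := near_mapeval hF (near_mapeval hPhi gM).
have h2 := near_mapeval hF M0_M.
have dir1 : \forall p \near (0 : C2 R), M0 R (mapeval F p) -> M p.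
  by apply: filterS3 h1 h2 PhiF => p e1 e2 e3; rewrite e3 in e1 e2 => /e2 /e1.
have k1 := near_conj (near_mapeval hG (near_fst on_M)).
have k2 := near_conj (near_mapeval hG (near_mapeval hsq FPhi)).
have solve : \forall x \near (0 : cplx R), exists z, 
    mapeval Phi (z, z * z^*) = (x, pseval rho x x^*) /\
    mapeval F (mapeval Phi (z, z * z^*)) = (z, z * z^*).
  apply: filterS3 GE k1 k2 => x.
  case: (mapeval G (x, x^*)) => Z W [e1 e2] e3 e4; exists Z.
  have {}e1 : W = Z^* := e1; subst W.
  have {}e2 : pseval alpha Z Z^* = x := e2.
  have sq : mapeval (monom R 1 0, monom R 1 1) (Z, Z^*) = (Z, Z * Z^*).
    by rewrite mapeval_graph pseval_monom !expr1.
  split; last by rewrite -sq.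
  apply: (etrans e3); rewrite -[(Z, Z^*).1]/Z e2; exact: erefl.
have gM' : \forall p \near (0 : C2 R), M p <-> graph rho p := gM.
have dir2 : \forall p \near (0 : C2 R), M p -> M0 R (mapeval F p).
  apply: filterS2 gM' (near_fst solve) => -[x u] e [z [e1 e2]] Mp.
  have -> : u = pseval rho x x^* := e.1 Mp.
  by rewrite -[(x, u).1]/x in e1; rewrite -e1 e2 /M0 /= normCK.
apply: filterS2 dir1 dir2 => p d1 d2; split; [exact: d2|exact: d1].
Qed.

End Quadric.

(** * Multiplicities and invariants of M *)

Section Conclusion.
Variable R : realType.
Implicit Types (rho : pser R) (F : pser R * pser R) (M N : set (C2 R)).

Lemma finite_parametrization_order N F M rho k : convergent rho -> vanishes2 rho ->
  germ_eq M (graph rho) -> finite_parametrization N F M ->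
  row_ord k rho -> rho 0%N k != 0 -> mult0 F (Some k).
Proof.
move=> cr r2 gM fp hk rk.
have [T [T' [TT' E]]] := finite_parametrization_normal_form cr r2 gM fp.
have [_ _ hF _ _] := fp.
rewrite -(mcompK hF TT') E.
exact: mult0_mcomp (holo_graph cr r2) (inverse_germs_sym TT') (mult0_graph cr hk rk).
Qed.

Lemma finite_parametrization_row N F M rho : convergent rho -> vanishes2 rho ->
  germ_eq M (graph rho) -> finite_parametrization N F M -> exists j, rho 0%N j != 0.
Proof.
move=> cr r2 gM fp; apply: contrapT => r0.
have {}r0 j : rho 0%N j = 0 by apply/eqP/negPn/negP => rj; apply: r0; exists j.
have [T [T' [TT' E]]] := finite_parametrization_normal_form cr r2 gM fp.
have [_ _ hF [n mF] _] := fp.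
by apply: (@not_finite_graph _ rho n r0); rewrite -E; exact: mult0_mcomp hF TT' mF.
Qed.

Lemma vanishes2_xy : vanishes2 (monom R 1 1).
Proof. by move=> i j ij; rewrite monom_eq0// xpair_eqE; lia. Qed.

Lemma bishop_quadric_small (gamma : \bar R) i j : (i + j < 2)%N -> bishop_quadric gamma i j = 0.
Proof.
move=> ij; have z p q : (p + q = 2)%N -> monom R p q i j = 0.
  by move=> pq; rewrite monom_eq0// xpair_eqE; lia.
by rewrite /bishop_quadric; case: gamma => [r||]; rewrite !(pserDE, pserZE) !z// !(mulr0, addr0).
Qed.

Lemma bishop_quadric_02 (gamma : \bar R) : (0 <= gamma)%E -> gamma <> 0%E ->
  bishop_quadric gamma 0%N 2%N != 0.
Proof.
have m02 : monom R 0 2 0%N 2%N = 1 by [].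
have m20 : monom R 2 0 0%N 2%N = 0 by [].
have m11 : monom R 1 1 0%N 2%N = 0 by [].
rewrite /bishop_quadric; case: gamma => [r||] //= _ g0.
- rewrite !(pserDE, pserZE) m02 m20 m11 !add0r mulr1; apply: contra_not_neq g0.
  by move=> /(@ofreal_inj R r 0) ->.
- by rewrite pserDE m02 m20 add0r oner_eq0.
Qed.

End Conclusion.

Theorem theorem3p3 (R : realType) (M : set (C2 R)) (rho : pser R)
    (rho_conv : convergent rho) (rho_ord : vanishes2 rho)
    (M_graph : germ_eq M (graph rho)) (M_CRsing : CR_singular0 M) :
  let cond_i := exists N F, finite_parametrization N F M in
  let cond_ii := exists j : nat, rho 0%N j != 0 in
  (cond_i <-> cond_ii) /\
  (bishop_surface rho ->
     [/\ cond_i <-> ~ biholo_equiv M (M0 R),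
         cond_ii <-> ~ biholo_equiv M (M0 R) &
         forall (N : set (C2 R)) (F : pser R * pser R) (gamma : \bar R),
           finite_parametrization N F M -> bishop_invariant M gamma ->
           (gamma <> 0%E -> mult0 F (Some 2%N)) /\
           (gamma = 0%E ->
              forall s : option nat, moser_invariant rho s -> mult0 F s)]).
Proof.
move=> cond_i cond_ii.
have i_ii : cond_i <-> cond_ii.
  split; last by move=> ii; exists (@antidiag R), (monom R 1 0, rho); exact: antidiag_parametrization.
  by move=> [N [F fp]]; exact: finite_parametrization_row fp.
split => // -[_ bishop].
have ii_M0 : cond_ii <-> ~ biholo_equiv M (M0 R).
  split=> [[j rj]|nM0].
    rewrite M0_graph => eqM; move/negP: rj; apply; apply/eqP.
    have [F tF] := biholo_equiv_transforms rho_conv (convergent_monom R 1 1)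
      rho_ord (@vanishes2_xy R) M_graph eqM.
    by apply: (transforms_row0 rho_ord (@vanishes2_xy R) tF).2.
  apply: contrapT => r0; apply: nM0.
  have {}r0 j : rho 0%N j = 0 by apply/eqP/negPn/negP => rj; apply: r0; exists j.
  by apply: (biholo_equiv_M0 rho_conv rho_ord M_graph r0); case: bishop => //; rewrite r0 eqxx.
split => //; first by rewrite i_ii.
move=> N F gamma fp [gamma0 [rho' [cr' quad eqM]]]; split => [gamma_neq0|_ s].
  have r2' : vanishes2 rho'.
    by move=> i j ij; rewrite quad ?bishop_quadric_small//; exact: ltnW.
  have [G tG] := biholo_equiv_transforms rho_conv cr' rho_ord r2' M_graph eqM.
  have hk : row_ord 2 rho' by move=> m m2; apply: r2'.
  have rk : rho' 0%N 2%N != 0 by rewrite quad//; exact: bishop_quadric_02.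
  have [h1 h2] := transforms_order rho_ord r2' tG hk rk.
  exact: finite_parametrization_order fp h1 h2.
case: s => [n|] /=; last first.
  case/formal_equiv_transforms => G tG; exfalso.
  have [j /negP] : cond_ii by apply/i_ii; exists N, F.
  by apply; apply/eqP/(transforms_row0 rho_ord (@vanishes2_xy R) tG).2.
move=> [n3 [rho1 [rho1E /formal_equiv_transforms[G tG]]]].
have E i j : (i + j <= n)%N -> rho1 i j = monom R 1 1 i j + monom R n 0 i j + monom R 0 n i j.
  exact: rho1E.
have r2' : vanishes2 rho1.
  move=> i j ij; rewrite E; last by lia.
  by rewrite !monom_eq0 ?addr0 ?xpair_eqE//; lia.
have hk : row_ord n rho1.
  move=> m mn; rewrite E; last by lia.
  by rewrite !monom_eq0 ?addr0 ?xpair_eqE//; lia.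
have rk : rho1 0%N n != 0.
  rewrite E// (@monom_eq0 R 1 1)// (@monom_eq0 R n 0); last by rewrite xpair_eqE; lia.
  by rewrite /monom !eqxx !add0r oner_eq0.
have [h1 h2] := transforms_order rho_ord r2' tG hk rk.
exact: finite_parametrization_order fp h1 h2.
Qed.
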